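(* Let $a>b>0$ and $\delta\in(0,1)$ be constants with $a+b>4$, and let $p=a\log n/n$, $q=b\log n/n$. Given $(\sigma,\ell)\in\mathfrak C(\delta)$, let $A$ be drawn from $\mathrm{PL\text{-}SBM}(p,q,\sigma,\ell)$. Then, as $n\to\infty$, the mixed QSD estimator $\hat\sigma_M$ satisfies $$\mathbb E\left[r(\hat\sigma_M)\right]\le n^{-(1+o(1))(\sqrt a-\sqrt b)^2/2}+o(n^{-1}).$$
   Context: Balanced partitions and partial labels. Let $\mathcal V=[n]$, with $n$ even and $\delta n/2$ an integer. A partition map is $\sigma:\mathcal V\to\{-1,1\}$, with communities $\mathcal C_+=\sigma^{-1}(1)$, $\mathcal C_-=\sigma^{-1}(-1)$. Partial labels are a map $\ell:\mathcal V\to\{-1,0,1\}$ with $\ell(v)=\sigma(v)$ whenever $\ell(v)\ne0$. Put $\mathcal R_+=\ell^{-1}(1)$, $\mathcal R_-=\ell^{-1}(-1)$ (revealed sets) and $\mathcal U=\ell^{-1}(0)$ (unrevealed set). Write $(\sigma,\ell)\in\mathfrak C(\delta)$ if $|\mathcal C_+|=|\mathcal C_-|=n/2$ and $|\mathcal R_+|=|\mathcal R_-|=\delta n/2$. Model. For fixed $(\sigma,\ell)\in\mathfrak C(\delta)$, $\mathrm{PL\text{-}SBM}(p,q,\sigma,\ell)$ is the law of a random symmetric matrix $A\in\{0,1\}^{n\times n}$ whose entries $A(u,v)$, $u\le v$, are independent, with $A(u,v)\sim$ Bernoulli$(p)$ if $\sigma(u)=\sigma(v)$ (including $u=v$) and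 Bernoulli$(q)$ if $\sigma(u)\neq\sigma(v)$. Scores. Let $d(u)=\sum_vA(u,v)$, $D=\mathrm{diag}(d(u))$, $P=D^{-1}A$ (rows with $d(u)=0$ set to zero). For $i\in\{+,-\}$ let $-i$ be the opposite sign, $\mathcal V_i=\mathcal V\setminus\mathcal R_i$, $\mathcal U_i=\mathcal C_i\setminus\mathcal R_i$, and let $P_i=P|_{\mathcal V_i,\mathcal V_i}$ be the principal submatrix. Let $\mu_i$ be the left principal eigenvector of $P_i$ (nonnegative, for the largest eigenvalue), normalized by $\|\mu_i\|_1=1$; whenever it is not uniquely determined an arbitrary choice is made. For $u\in\mathcal U$ set $Q(u)=\mu_-(u)-\mu_+(u)$ and $S(u)=\sum_{v\in\mathcal R_+}A(u,v)-\sum_{v\in\mathcal R_-}A(u,v)$. Mixed QSD estimator. For $u\in\mathcal U$, $$M(u)=\bar c\,\gamma\,n\log n\;Q(u)-S(u),\qquad \hat\sigma_M(u)=\mathrm{Sgn}(M(u)),$$ where $\mathrm{Sgn}$ is the sign function with $\mathrm{Sgn}(0)=0$ and $$\rho=\tfrac1{2b}\left(a\delta+\sqrt{a^2\delta^2+4(1-\delta)b^2}\right),\qquad \gamma=\sqrt{\tfrac{1-\delta+\rho^2}{2}},$$ $$\bar c=\frac{\|\bar A_i\bar\pi_i\|_1}{\sqrt n\log n}=\frac1{4\gamma}\left(a(\rho+(1-\delta)^2)+b(\rho+1)(1-\delta)\right).$$ Here $\bar A_i$ is the restriction of $\bar A=\mathbb E[A]$ to $\mathcal V_i\times\mathcal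 V_i$ and $\bar\pi_i=\frac1{\gamma\sqrt n}(\mathbf 1_{\mathcal U_i}+\rho\,\mathbf 1_{\mathcal C_{-i}})$; $\bar c$ does not depend on $i$ or $n$. Error rate. $r(\hat\sigma)=\frac1{|\mathcal U|}\sum_{v\in\mathcal U}\mathbf 1\{\hat\sigma(v)\neq\sigma(v)\}$; the expectation is over $A$ with $(\sigma,\ell)$ fixed. *)

(* Defs.v *)
From HB Require Import structures.
From mathcomp Require Import all_boot all_order all_algebra.
From mathcomp Require Import all_classical all_reals all_analysis.

Set Implicit Arguments.
Unset Strict Implicit.
Unset Printing Implicit Defensive.

Import Order.TTheory GRing.Theory Num.Theory.
Import numFieldNormedType.Exports.

Local Open Scope classical_set_scope.
Local Open Scope ring_scope.

(* Signs + and - are the integers 1 and -1; partition maps and partial labels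
   are integer-valued functions on 'I_n. *)

Section Labels.
Variables (n : nat) (sigma ell : 'I_n -> int).

Definition community (i : int) : {set 'I_n} := [set v | sigma v == i].
Definition revealed (i : int) : {set 'I_n} := [set v | ell v == i].
Definition unrevealed : {set 'I_n} := [set v | ell v == 0].
Definition kept (i : int) : {set 'I_n} := ~: revealed i.

(* The cardinality conditions are equalities of reals: they force n to be even
   and delta * n / 2 to be an integer. *)
Definition admissible (R : realType) (delta : R) : Prop :=
  [/\ (forall v, sigma v = 1 \/ sigma v = -1),
      (forall v, [\/ ell v = 1, ell v = 0 | ell v = -1]),
      (forall v, ell v != 0 -> ell v = sigma v),
      (forall i : int, i = 1 \/ i = -1 -> #|community i|%:R = n%:R / 2 :> R) &
      (forall i : int, i = 1 \/ i = -1 ->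
         #|revealed i|%:R = delta * n%:R / 2 :> R)].

End Labels.

Section Model.
Variables (R : realType) (n : nat).

(* The joint law of the symmetric matrix: the entries on and above the diagonal
   are independent Bernoulli variables, and asymmetric matrices have mass 0. *)
Definition plsbm_pmf (p q : R) (sigma : 'I_n -> int) (A : 'M[bool]_n) : R :=
  if A == A^T then
    \prod_(u < n) \prod_(v < n | (u <= v)%N)
      bernoulli_pmf (if sigma u == sigma v then p else q) (A u v)
  else 0.

Definition plsbm_expectation (p q : R) (sigma : 'I_n -> int)
    (f : 'M[bool]_n -> R) : R :=
  \sum_(A : 'M[bool]_n) plsbm_pmf p q sigma A * f A.

End Model.

Section Scores.
Variables (R : realType) (n : nat) (ell : 'I_n -> int).

Definition degree (A : 'M[bool]_n) (u : 'I_n) : R := \sum_(v < n) (A u v)%:R.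

(* D^-1 A; since x / 0 = 0, the rows of degree 0 vanish. *)
Definition walk_mx (A : 'M[bool]_n) : 'M[R]_n :=
  \matrix_(u, v) ((A u v)%:R / degree A u).

Definition killed_walk_mx (A : 'M[bool]_n) (i : int) : 'M[R]_#|kept ell i| :=
  mxsub enum_val enum_val (walk_mx A).

(* For symmetric A, conjugating killed_walk_mx A i by the square roots of the
   degrees (vertices of degree 0 have zero row and column) makes it symmetric:
   its spectrum is real, so the largest eigenvalue is the largest real one. *)
Definition principal_left_eigenvector m (B : 'M[R]_m) (mu : 'rV[R]_m) : Prop :=
  exists lambda : R,
    [/\ eigenvalue B lambda,
        (forall lambda', eigenvalue B lambda' -> lambda' <= lambda),
        mu *m B = lambda *: mu,
        (forall j, 0 <= mu 0 j) &
        \sum_j `|mu 0 j| = 1].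

(* A selection, for each matrix and each sign, of a left principal eigenvector;
   the eigenvector need not be unique. *)
Definition principal_choice
    (mu : forall i : int, 'M[bool]_n -> 'rV[R]_#|kept ell i|) : Prop :=
  forall (i : int) (A : 'M[bool]_n), i = 1 \/ i = -1 -> A = A^T ->
    principal_left_eigenvector (killed_walk_mx A i) (mu i A).

(* The entry of x at the vertex u, and 0 if u is not in V. *)
Definition entry_at (V : {set 'I_n}) (x : 'rV[R]_#|V|) (u : 'I_n) : R :=
  \sum_(j < #|V| | enum_val j == u) x 0 j.

Definition qsd_score (mu : forall i : int, 'M[bool]_n -> 'rV[R]_#|kept ell i|)
    (A : 'M[bool]_n) (u : 'I_n) : R :=
  entry_at (mu (-1) A) u - entry_at (mu 1 A) u.

Definition revealed_score (A : 'M[bool]_n) (u : 'I_n) : R :=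
  \sum_(v in revealed ell 1) (A u v)%:R - \sum_(v in revealed ell (-1)) (A u v)%:R.

End Scores.

Section Constants.
Variables (R : realType) (a b delta : R).

Definition rho : R :=
  (a * delta + Num.sqrt (a ^+ 2 * delta ^+ 2 + 4 * (1 - delta) * b ^+ 2)) / (2 * b).

Definition gamma : R := Num.sqrt ((1 - delta + rho ^+ 2) / 2).

(* The value, independent of n and of the sign i, of
   |EA_i pi_i|_1 / (sqrt n * ln n), where EA_i is the restriction of the mean
   of A to the vertices outside revealed i, and pi_i is 1 / (gamma * sqrt n)
   on the unrevealed part of community i and rho / (gamma * sqrt n) on the
   opposite community. *)
Definition cbar : R :=
  (a * (rho + (1 - delta) ^+ 2) + b * (rho + 1) * (1 - delta)) / (4 * gamma).

End Constants.

Definition mixed_score (R : realType) (a b delta : R) (n : nat)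
    (ell : 'I_n -> int)
    (mu : forall i : int, 'M[bool]_n -> 'rV[R]_#|kept ell i|)
    (A : 'M[bool]_n) (u : 'I_n) : R :=
  cbar a b delta * gamma a b delta * n%:R * ln n%:R * qsd_score mu A u
  - revealed_score R ell A u.

Definition mixed_estimator (R : realType) (a b delta : R) (n : nat)
    (ell : 'I_n -> int)
    (mu : forall i : int, 'M[bool]_n -> 'rV[R]_#|kept ell i|)
    (A : 'M[bool]_n) (u : 'I_n) : int :=
  sgz (mixed_score a b delta mu A u).

Definition error_rate (R : realType) (n : nat) (sigma ell est : 'I_n -> int) : R :=
  #|unrevealed ell|%:R^-1 * \sum_(v in unrevealed ell) (est v != sigma v)%:R.

(* Main.v *)
Require Import Defs.
From HB Require Import structures.
From mathcomp Require Import all_boot all_order all_algebra.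
From mathcomp Require Import all_classical all_reals all_analysis.
From mathcomp Require Import ring lra zify.

Set Implicit Arguments.
Unset Strict Implicit.
Unset Printing Implicit Defensive.

Import Order.TTheory GRing.Theory Num.Theory.
Import numFieldNormedType.Exports.

Local Open Scope ring_scope.

(** The score of an unrevealed vertex is, up to a small fraction of [ln n], a positive
    multiple of its signed number of neighbours in the two communities. The error
    rate is therefore that of the majority vote among the neighbours, whose Chernoff
    exponent is [(sqrt a - sqrt b) ^ 2 / 2].

    Let [L := ln n]. If [mu] is a left principal eigenvector of the walk killed at one
    revealed set and [h := D^-1 mu], then [A h = lam D h]: so [mu u] is proportional
    to the sum of [h] over the neighbours of [u], and it suffices that in this sum [h]
    may be replaced by a multiple of the Perron profile of the mean matrix, 1 on the
    unrevealed part of one community and [rho] on the other community. The two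
    eigenvectors then give neighbour counts in which revealed and unrevealed
    neighbours have different weights, and subtracting the revealed score makes the
    weights equal to [rho - 1] (mixed_estimator_correct).

    The degrees are not uniformly close to their mean, so [h] is not uniformly close
    to the profile. It is close in mean square: the centered matrix has operator norm
    at most [eps * L] (op_norm_centered), the degrees are at least a constant times
    [L] because [a + b > 4] (degree_tail), the mean has rank two, and these facts make
    the equation [(A - lam D) f = r] coercive away from the profile (spectral_gap,
    principal_vector_profile). To pass to the sum over the neighbours of one vertex
    [u], isolate [u]. The eigenvector [h'] of the new matrix is independent of the row
    of [u], and by the spectral gap it differs from [h] in Euclidean norm by at most a
    constant times [s / L], where [s] is the sum of [h'] over the neighbours of [u]
    (leave_one_out_distance). The row of [u] has about [L] entries, so replacing [h]
    by [h'] in the sum costs [s / sqrt L]. A sum of a bounded function that is small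
    in mean over independent coins is at most a small fraction of [L] with
    probability [1 - n ^- 3] (row_tail), and at the maximum of [h] this yields the
    bound on [h] that makes the argument close (local_form, local_expansion).

    The operator norm comes from discrepancy: by a union bound the number of edges
    between any two sets of comparable sizes deviates by at most a small multiple of
    [L * sqrt (#|S| * #|T|)] (prob_discrepant), and cutting vectors into their binary
    digits turns this into a bound on the bilinear form (op_norm). The law of the
    matrix is a product of independent coins, and the coins in the row of [u] can be
    tossed again without changing it, which is how independence is used
    (coin_mean_resample, row_mgf).

    The exceptional events have total probability [o(1 / n)], and every fixed slack in
    the exponent is admissible; vanishing_slack turns it into [o(1)]. *)

(** Linear arithmetic on the goal alone: the context is cleared first, which
    matters when it is large. *)
Ltac lin := repeat match goal with
  | H : ?P |- _ => match type of P with Prop => clear H end end; intros; lra.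

(** * Euclidean geometry of functions on a finite set *)

Section Dot.
Variables (R : realType) (I : finType).
Implicit Types (f g : I -> R) (k : I -> I -> R) (c : R).

Definition dot f g : R := \sum_v f v * g v.
Definition nrm f : R := Num.sqrt (dot f f).
Definition app k f (u : I) : R := \sum_v k u v * f v.

Lemma dotC f g : dot f g = dot g f.
Proof. by apply: eq_bigr => v _; rewrite mulrC. Qed.

Lemma eq_dot f1 f2 g1 g2 : f1 =1 f2 -> g1 =1 g2 -> dot f1 g1 = dot f2 g2.
Proof. by move=> e1 e2; apply: eq_bigr => v _; rewrite e1 e2. Qed.

Lemma dotDr f g1 g2 : dot f (fun v => g1 v + g2 v) = dot f g1 + dot f g2.
Proof. by rewrite -big_split; apply: eq_bigr => v _; rewrite mulrDr. Qed.

Lemma dotZr f g c : dot f (fun v => c * g v) = c * dot f g.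
Proof. by rewrite [RHS]mulr_sumr; apply: eq_bigr => v _; rewrite mulrCA. Qed.

Lemma dotBr f g1 g2 : dot f (fun v => g1 v - g2 v) = dot f g1 - dot f g2.
Proof. by rewrite /dot -sumrB; apply: eq_bigr => v _; rewrite mulrBr. Qed.

Lemma dotDl f1 f2 g : dot (fun v => f1 v + f2 v) g = dot f1 g + dot f2 g.
Proof. by rewrite dotC dotDr !(dotC g). Qed.

Lemma dotBl f1 f2 g : dot (fun v => f1 v - f2 v) g = dot f1 g - dot f2 g.
Proof. by rewrite dotC dotBr !(dotC g). Qed.

Lemma dotZl f g c : dot (fun v => c * f v) g = c * dot f g.
Proof. by rewrite dotC dotZr dotC. Qed.

Lemma dotMA f (w : I -> R) g : dot (fun v => w v * f v) g = dot f (fun v => w v * g v).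
Proof. by apply: eq_bigr => v _; ring. Qed.

Lemma dot_ge0 f : 0 <= dot f f.
Proof. by apply: sumr_ge0 => v _; rewrite -expr2 sqr_ge0. Qed.

Lemma nrm_ge0 f : 0 <= nrm f.
Proof. exact: sqrtr_ge0. Qed.

Lemma nrm_sqr f : nrm f ^+ 2 = dot f f.
Proof. by rewrite sqr_sqrtr ?dot_ge0. Qed.

Lemma eq_nrm f g : f =1 g -> nrm f = nrm g.
Proof. by move=> e; rewrite /nrm (eq_dot e e). Qed.

Lemma dotff_eq0 f : dot f f = 0 -> forall v, f v = 0.
Proof.
move=> /eqP; rewrite psumr_eq0 => [/allP h v|v _]; last by rewrite -expr2 sqr_ge0.
by have /= := h v (mem_index_enum v); rewrite mulf_eq0 orbb => /eqP.
Qed.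

Lemma nrm_eq0 f : nrm f = 0 -> forall v, f v = 0.
Proof. by move=> h; apply: dotff_eq0; rewrite -nrm_sqr h expr0n. Qed.

Lemma cauchy_schwarz f g : `|dot f g| <= nrm f * nrm g.
Proof.
rewrite -(@ler_pXn2r _ 2) ?nnegrE ?mulr_ge0 ?nrm_ge0 //.
rewrite real_normK ?num_real// exprMn !nrm_sqr.
have [/dotff_eq0 g0|] := eqVneq (dot g g) 0.
  rewrite [dot f g]big1 => [|v _]; last by rewrite g0 mulr0.
  by rewrite expr0n mulr_ge0 ?dot_ge0.
rewrite neq_lt ltNge dot_ge0 /= => g0.
rewrite -subr_ge0 -(pmulr_rge0 _ g0).
have := dot_ge0 (fun v => dot g g * f v - dot f g * g v).
rewrite dotBl !dotBr !dotZl !dotZr (dotC g f).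
by congr (_ <= _); ring.
Qed.

Lemma dot_le_nrm f g : dot f g <= nrm f * nrm g.
Proof. exact: le_trans (ler_norm _) (cauchy_schwarz f g). Qed.

Lemma nrmD f g : nrm (fun v => f v + g v) <= nrm f + nrm g.
Proof.
rewrite -(@ler_pXn2r _ 2) ?nnegrE ?addr_ge0 ?nrm_ge0 //.
rewrite sqrrD !nrm_sqr dotDl !dotDr (dotC g f).
have := dot_le_nrm f g; lra.
Qed.

Lemma nrmZ f c : nrm (fun v => c * f v) = `|c| * nrm f.
Proof.
by rewrite /nrm dotZl dotZr mulrA -expr2 sqrtrM ?sqr_ge0 // sqrtr_sqr.
Qed.

Lemma nrmN f : nrm (fun v => - f v) = nrm f.
Proof.
rewrite -[RHS]mul1r -normr1 -[in RHS]normrN -nrmZ.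
by apply: eq_nrm => v; rewrite mulN1r.
Qed.

Lemma ler_nrm f g : (forall v, `|f v| <= g v) -> nrm f <= nrm g.
Proof.
move=> fg; rewrite /nrm ler_wsqrtr //; apply: ler_sum => v _.
rewrite -!expr2 -[leLHS]real_normK ?num_real // ler_pXn2r ?nnegrE //.
exact: le_trans (fg v).
Qed.

Lemma nrm_mul_le f g c : (forall v, `|f v| <= c) ->
  nrm (fun v => f v * g v) <= c * nrm g.
Proof.
move=> fc; have [c0|c0] := leP 0 c; last first.
  have /= gE : g =1 fun=> 0.
    by move=> v; have := le_lt_trans (fc v) c0; rewrite normr_lt0.
  have -> : nrm (fun v => f v * g v) = nrm g.
    by apply: eq_nrm => v; rewrite gE mulr0.
  rewrite [nrm g](_ : _ = 0) ?mulr0 //.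
  by rewrite /nrm [dot _ _]big1 ?sqrtr0 // => v _; rewrite gE mulr0.
rewrite -[X in X * _](ger0_norm c0) -nrmZ.
have -> : nrm (fun v => c * g v) = nrm (fun v => `|c * g v|).
  by congr Num.sqrt; apply: eq_bigr => v _; rewrite -expr2 -normrM ger0_norm -expr2 // sqr_ge0.
apply: ler_nrm => v; rewrite !normrM (ger0_norm c0).
by apply: ler_wpM2r.
Qed.

Lemma coord_le_nrm f v : `|f v| <= nrm f.
Proof.
rewrite -sqrtr_sqr ler_wsqrtr // expr2 [leRHS](bigD1 v) //= lerDl.
by apply: sumr_ge0 => w _; rewrite -expr2 sqr_ge0.
Qed.

Lemma nrm_le_sum f : (forall v, 0 <= f v) -> nrm f <= \sum_v f v.
Proof.
move=> f0; have s0 : 0 <= \sum_v f v by apply: sumr_ge0.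
rewrite -(@ler_pXn2r _ 2) ?nnegrE ?nrm_ge0 // nrm_sqr expr2 mulr_suml.
apply: ler_sum => v _; apply: ler_wpM2l => //.
by rewrite (bigD1 v) //= lerDl sumr_ge0.
Qed.

Lemma nrm_dual f c : 0 <= c -> (forall g, dot g f <= c * nrm g) -> nrm f <= c.
Proof.
move=> c0 /(_ f); rewrite -nrm_sqr expr2 => h.
have [->//|n0] := eqVneq (nrm f) 0.
by rewrite -(ler_pM2r (_ : 0 < nrm f)) // lt_neqAle eq_sym n0 nrm_ge0.
Qed.

Lemma app_adjoint k f g : (forall u v, k u v = k v u) ->
  dot f (app k g) = dot (app k f) g.
Proof.
move=> ks; rewrite /dot /app; under eq_bigr do rewrite mulr_sumr.
rewrite exchange_big; apply: eq_bigr => v _.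
by rewrite mulr_suml; apply: eq_bigr => u _; rewrite ks; ring.
Qed.

Lemma appB k f g u : app k (fun v => f v - g v) u = app k f u - app k g u.
Proof. exact: dotBr. Qed.

Lemma appZ k f c u : app k (fun v => c * f v) u = c * app k f u.
Proof. exact: dotZr. Qed.

End Dot.

(** * Kernels close to a two-block mean *)

Section TwoBlocks.
Variables (R : realType) (I : finType).
Implicit Types (f g h w : I -> R) (k : I -> I -> R) (U C : {set I}).

Definition ind (S : {set I}) (v : I) : R := (v \in S)%:R.

Definition mean_kernel (a b : R) U C (u v : I) : R :=
  (a * (ind U u * ind U v + ind C u * ind C v)
   + b * (ind U u * ind C v + ind C u * ind U v)) / #|I|%:R.

Definition profile (rho : R) U C (v : I) : R := ind U v + rho * ind C v.

Definition block_sizes (u1 : R) U C : Prop :=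
  [/\ (0 < #|I|)%N, [disjoint U & C], #|U|%:R = u1 * #|I|%:R / 2 :> R
    & #|C|%:R = #|I|%:R / 2 :> R].

(** [k] stands for the adjacency matrix and [w] for the degrees, both divided by
    [ln n]: [k] is close to its mean in operator norm, while the weights, which
    fluctuate by a constant factor, are close to their mean in mean square only. *)
Definition concentrated (a b cmin cmax eps : R) U C k w : Prop :=
  [/\ (forall u v, k u v = k v u),
      (forall f g, `|dot f (app k g) - dot f (app (mean_kernel a b U C) g)|
                   <= eps * (nrm f * nrm g)),
      (forall v, cmin <= w v <= cmax)
    & nrm (fun v => w v - (a + b) / 2) <= eps * Num.sqrt #|I|%:R].

Lemma dot_indE (S : {set I}) f : dot (ind S) f = \sum_(v in S) f v.
Proof.
rewrite [RHS]big_mkcond; apply: eq_bigr => v _.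
by rewrite /ind; case: (v \in S); rewrite ?mul1r ?mul0r.
Qed.

Lemma dot_ind_ind (S : {set I}) : dot (ind S) (ind S) = #|S|%:R.
Proof.
rewrite dot_indE -sumr_const; apply: eq_bigr => v vS.
by rewrite /ind vS.
Qed.

Lemma dot_ind_disj U C : [disjoint U & C] -> dot (ind U) (ind C) = 0.
Proof.
move=> dUC; rewrite dot_indE big1 // => v vU.
by rewrite /ind (disjointFr dUC vU).
Qed.

Lemma app_mean_kernel a b U C g u :
  app (mean_kernel a b U C) g u =
    ((a * dot (ind U) g + b * dot (ind C) g) * ind U u
     + (b * dot (ind U) g + a * dot (ind C) g) * ind C u) / #|I|%:R.
Proof.
rewrite /app (_ : (_ + _) / _ = \sum_v
   ((a * (ind U v * g v) + b * (ind C v * g v)) * ind U u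
     + (b * (ind U v * g v) + a * (ind C v * g v)) * ind C u) / #|I|%:R).
  by apply: eq_bigr => v _; rewrite /mean_kernel; ring.
by rewrite -mulr_suml !(big_split, =^~ mulr_suml, =^~ mulr_sumr).
Qed.

Lemma dot_mean_kernel a b U C f g :
  dot f (app (mean_kernel a b U C) g) =
    (a * (dot (ind U) f * dot (ind U) g + dot (ind C) f * dot (ind C) g)
     + b * (dot (ind U) f * dot (ind C) g + dot (ind C) f * dot (ind U) g))
    / #|I|%:R.
Proof.
rewrite (_ : dot f _ = dot f (fun u =>
    ((a * dot (ind U) g + b * dot (ind C) g) / #|I|%:R) * ind U u
     + ((b * dot (ind U) g + a * dot (ind C) g) / #|I|%:R) * ind C u)).
  by rewrite dotDr !dotZr !(dotC f); ring.
by apply: eq_dot => // u; rewrite app_mean_kernel; ring.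
Qed.

Lemma dot_profile rho U C f :
  dot (profile rho U C) f = dot (ind U) f + rho * dot (ind C) f.
Proof. by rewrite dotDl dotZl. Qed.

Lemma nrm_ind_le (S : {set I}) : nrm (ind S) <= Num.sqrt #|I|%:R.
Proof. by rewrite /nrm dot_ind_ind ler_wsqrtr // ler_nat max_card. Qed.

Lemma ind_ge0 (S : {set I}) v : 0 <= ind S v. Proof. exact: ler0n. Qed.
Lemma ind_le1 (S : {set I}) v : ind S v <= 1. Proof. by rewrite lern1 leq_b1. Qed.

Lemma profile_ge0 rho U C v : 0 <= rho -> 0 <= profile rho U C v.
Proof. by move=> r0; rewrite addr_ge0 ?ind_ge0 // mulr_ge0 ?ind_ge0. Qed.

Lemma profile_le rho U C v : 1 <= rho -> [disjoint U & C] ->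
  profile rho U C v <= rho.
Proof.
move=> r1 dUC; rewrite /profile /ind.
have [vU|_] := boolP (v \in U); last by case: (v \in C) => /=; lra.
by rewrite (disjointFr dUC vU) mulr0 addr0.
Qed.

Lemma nrm_profile_le rho U C : 1 <= rho -> [disjoint U & C] ->
  nrm (profile rho U C) <= rho * Num.sqrt #|I|%:R.
Proof.
move=> r1 dUC; have r0 : 0 <= rho by lra.
have -> : rho * Num.sqrt #|I|%:R = nrm (fun _ : I => rho).
  rewrite /nrm /dot sumr_const -[in RHS]mulr_natr sqrtrM -expr2 ?sqr_ge0 //.
  by rewrite sqrtr_sqr ger0_norm.
apply: ler_nrm => v; rewrite ger0_norm ?profile_ge0 //.
exact: profile_le.
Qed.

(** The fluctuation of the weights is only small in mean square, so it is
    controlled against functions one of which is bounded. *)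
Lemma dot_weight (w g f : I -> R) (c x B : R) : 0 <= B ->
  nrm (fun v => w v - x) <= c -> (forall v, `|g v| <= B) ->
  `|dot g (fun v => w v * f v) - x * dot g f| <= B * c * nrm f.
Proof.
move=> B0 wc gB.
have -> : dot g (fun v => w v * f v) - x * dot g f
          = dot (fun v => g v * (w v - x)) f.
  by rewrite -dotZr -dotBr; apply: eq_bigr => v _; ring.
apply: le_trans (cauchy_schwarz _ _) _; apply: ler_wpM2r; first exact: nrm_ge0.
by apply: le_trans (nrm_mul_le _ gB) _; apply: ler_wpM2l.
Qed.

Lemma dot_weight_lb w f cmin : (forall v, cmin <= w v) ->
  cmin * nrm f ^+ 2 <= dot f (fun v => w v * f v).
Proof.
move=> wc; rewrite nrm_sqr -dotZr; apply: ler_sum => v _.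
by rewrite !(mulrCA (f v)) ler_wpM2r // -expr2 sqr_ge0.
Qed.

End TwoBlocks.

(** [rho] is the ratio of the coordinates of the Perron eigenvector of the
    two-block mean matrix with block sizes [u1] and [1]. *)
Definition perron_ratio (R : realType) (a b u1 rho : R) : Prop :=
  [/\ 0 < b, b <= a, 0 < u1 <= 1, 1 <= rho
    & b * u1 + a * rho = rho * (a * u1 + b * rho)].

(** The equation [(k - lam * w) f = r] is coercive where the mean kernel vanishes,
    that is, on functions of sum zero on both blocks, as [k] minus its mean is small
    there and [lam * w] is not. If only the sum over [U] is zero, pairing with the
    indicator of [C] recovers the sum over [C]. *)
Lemma spectral_gap (R : realType) (a b u1 rho cmin cmax : R) :
  perron_ratio a b u1 rho -> 0 < cmin ->
  exists2 tau : R, 0 < tau &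
  forall (I : finType) (U C : {set I}) k w eps lam (f r : I -> R),
    block_sizes u1 U C -> concentrated a b cmin cmax eps U C k w ->
    0 <= eps -> eps <= tau ->
    `|lam * ((a + b) / 2) - (a * u1 + b * rho) / 2| <= tau ->
    dot (ind R U) f = 0 ->
    (forall v, app k f v - lam * (w v * f v) = r v) ->
    nrm f <= tau^-1 * nrm r.
Proof.
move=> [b0 ab /andP[u0 u1le] rho1 rhoE] cmin0.
have a0 : 0 < a by lra.
have [Lam LamE] : exists x : R, x = (a * u1 + b * rho) / 2 by eexists.
have Lam0 : 0 < Lam by rewrite LamE; rewrite divr_gt0 // addr_gt0 // mulr_gt0 //; lra.
have [g gdef] : exists x : R, x = b * u1 / (2 * rho) by eexists.
have g0 : 0 < g by rewrite gdef; rewrite divr_gt0 ?mulr_gt0 ?ltr0n //; lra.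
have gE : Lam - a / 2 = g.
  rewrite LamE gdef; have rn0 : rho != 0 by apply: lt0r_neq0; lra.
  have -> : b * u1 = rho * (a * u1 + b * rho) - a * rho by rewrite -rhoE; ring.
  by field.
have [lam0 lam0E] : exists x : R, x = Lam / (a + b) by eexists.
have [lam1 lam1E] : exists x : R, x = 3 * Lam / (a + b) by eexists.
have ab0 : 0 < a + b by lra.
have lam00 : 0 < lam0 by rewrite lam0E divr_gt0.
have lam10 : 0 < lam1 by rewrite lam1E divr_gt0 ?mulr_gt0 ?ltr0n.
have [A AE] : exists x : R, x = 4 * a * (2 + lam1) ^+ 2 / g ^+ 2 + 2 by eexists.
have A0 : 0 < A.
  rewrite AE addr_gt0 // divr_gt0 ?exprn_gt0 // mulr_gt0 ?exprn_gt0 ?mulr_gt0 ?ltr0n //; lra.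
pose tau := Num.min (Num.min 1 (Lam / 2)) (Num.min (g / 2) (lam0 * cmin / (2 * A))).
have tau0 : 0 < tau by rewrite !lt_min ltr01 !divr_gt0 ?mulr_gt0 ?ltr0n.
have tau1 : tau <= 1 by rewrite !ge_min lexx.
have tauL : tau <= Lam / 2 by rewrite !ge_min lexx !orbT.
have taug : tau <= g / 2 by rewrite !ge_min lexx !orbT.
have tauA : tau <= lam0 * cmin / (2 * A) by rewrite !ge_min lexx !orbT.
clearbody tau; exists tau => // I U C k w eps lam f r.
move=> [I0 dUC cU cC] [ks kop wb wdeg] eps0 epst lamt xf0 req.
move: lamt; rewrite -LamE ler_norml => /andP[lamlo lamhi].
have laml : lam0 <= lam by rewrite lam0E ler_pdivrMr //; lra.
have lamh : lam <= lam1 by rewrite lam1E ler_pdivlMr //; lra.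
have N0 : 0 < #|I|%:R :> R by rewrite ltr0n.
set N := #|I|%:R in N0 cU cC wdeg *.
set sN := Num.sqrt N in wdeg.
have sN0 : 0 < sN by rewrite sqrtr_gt0.
have sNN : sN * sN = N by rewrite -expr2 sqr_sqrtr // ltW.
set F := nrm f; set R' := nrm r.
have F0 : 0 <= F by exact: nrm_ge0.
have R0 : 0 <= R' by exact: nrm_ge0.
set y := dot (ind R C) f.
have rdot g' : dot g' r = dot g' (app k f) - lam * dot g' (fun v => w v * f v).
  rewrite -dotZr -dotBr; apply: eq_dot => // v; exact/esym.
(* The mass of f on C: the coefficient lam * (a + b) / 2 - a / 2 is at least g / 2. *)
have ybd : (g / 2) * `|y| <= sN * ((1 + lam1) * eps * F + R').
  have h1 := kop (ind R C) f.
  rewrite dot_mean_kernel (dotC (ind R U) (ind R C)) in h1.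
  rewrite (dotC (ind R C) (ind R U)) dot_ind_disj // dot_ind_ind cC xf0 -/y -/N in h1.
  have C1 v : `|ind R C v| <= 1 by rewrite ger0_norm ?ind_ge0 ?ind_le1.
  have := dot_weight f ler01 wdeg C1.
  rewrite -/y mul1r -/F => h2.
  have h3 := cauchy_schwarz (ind R C) r.
  have hC : nrm (ind R C) <= sN by exact: nrm_ind_le.
  rewrite rdot in h3.
  set p := dot (ind R C) (app k f) in h1 h3.
  set q := dot (ind R C) (fun v => w v * f v) in h2 h3.
  have h1' : `|p - a / 2 * y| <= eps * (sN * F).
    have -> : a / 2 * y = (a * (0 * 0 + N / 2 * y) + b * (0 * y + N / 2 * 0)) / N.
      by field; rewrite lt0r_neq0.
    apply: le_trans h1 _; rewrite ler_wpM2l // ler_wpM2r //.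
  have h2' : `|lam * (q - (a + b) / 2 * y)| <= lam1 * (eps * sN * F).
    rewrite normrM ler_pM //; rewrite ger0_norm //; lra.
  have h3' : `|p - lam * q| <= sN * R'.
    by apply: le_trans h3 _; rewrite ler_wpM2r.
  have : `|(lam * ((a + b) / 2) - a / 2) * y| <= sN * ((1 + lam1) * eps * F + R').
    have -> : (lam * ((a + b) / 2) - a / 2) * y =
      (p - a / 2 * y) - lam * (q - (a + b) / 2 * y) - (p - lam * q) by ring.
    apply: le_trans (ler_normB _ _) _.
    have := ler_normB (p - a / 2 * y) (lam * (q - (a + b) / 2 * y)).
    have -> : sN * ((1 + lam1) * eps * F + R') =
       eps * (sN * F) + lam1 * (eps * sN * F) + sN * R' by ring.
    move: h1' h2' h3'; lin.
  rewrite normrM; apply: le_trans; rewrite ler_wpM2r //.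
  by rewrite ger0_norm; move: gE taug lamlo g0; lin.
(* Coercivity, up to the contribution of y to the mean kernel. *)
have coer : lam0 * cmin * F ^+ 2 <= a * y ^+ 2 / N + eps * F ^+ 2 + F * R'.
  have h1 := kop f f; rewrite dot_mean_kernel xf0 -/y -/N in h1.
  have h2 : dot f (fun v => w v * f v) >= cmin * F ^+ 2.
    by apply: dot_weight_lb => v; have /andP[] := wb v.
  have h3 := cauchy_schwarz f r; rewrite rdot in h3.
  move: h1 h3; rewrite !ler_norml => /andP[_ h1] /andP[h3 _].
  have h4 : lam0 * (cmin * F ^+ 2) <= lam * dot f (fun v => w v * f v).
    apply: ler_pM => //; first exact: ltW.
    by rewrite mulr_ge0 ?sqr_ge0 // ltW.
  have -> : a * y ^+ 2 / N = (a * (0 * 0 + y * y) + b * (0 * y + y * 0)) / N by ring.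
  by rewrite -/F -/R' in h1 h3; move: h1 h3 h4; lin.
rewrite leNgt; apply/negP => FR.
have {}FR : R' < tau * F by rewrite -ltr_pdivrMl.
have Fp : 0 < F by rewrite -(pmulr_rgt0 _ tau0); exact: le_lt_trans FR.
have y2 : `|y| <= 2 / g * (sN * ((2 + lam1) * tau * F)).
  have gn0 : g != 0 by exact: lt0r_neq0.
  rewrite -ler_pdivrMl ?divr_gt0 ?ltr0n // invf_div; apply: le_trans ybd _.
  apply: ler_wpM2l; first exact: ltW.
  have : (1 + lam1) * eps * F <= (1 + lam1) * tau * F.
    by rewrite ler_wpM2r // ler_wpM2l //; move: lam10; lin.
  move: FR; lin.
have y3 : a * y ^+ 2 / N <= 4 * a * (2 + lam1) ^+ 2 / g ^+ 2 * (tau ^+ 2 * F ^+ 2).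
  rewrite ler_pdivrMr // -[y ^+ 2]real_normK ?num_real //.
  have -> : 4 * a * (2 + lam1) ^+ 2 / g ^+ 2 * (tau ^+ 2 * F ^+ 2) * N
    = a * (2 / g * (sN * ((2 + lam1) * tau * F))) ^+ 2.
    by rewrite -sNN; field; exact: lt0r_neq0.
  by rewrite ler_pM2l // ler_pXn2r ?nnegrE //; apply: le_trans y2.
have t2 : tau ^+ 2 * F ^+ 2 <= tau * F ^+ 2.
  by rewrite ler_wpM2r ?sqr_ge0 // expr2 ler_piMl // ltW.
have e2 : eps * F ^+ 2 + F * R' <= 2 * (tau * F ^+ 2).
  have : F * R' <= F * (tau * F) by rewrite ler_wpM2l // ltW.
  have : eps * F ^+ 2 <= tau * F ^+ 2 by rewrite ler_wpM2r ?sqr_ge0.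
  lin.
have A2 : 0 <= 4 * a * (2 + lam1) ^+ 2 / g ^+ 2 by rewrite divr_ge0 ?sqr_ge0 // mulr_ge0 ?sqr_ge0 // mulr_ge0 ?ler0n // ltW.
have y4 : 4 * a * (2 + lam1) ^+ 2 / g ^+ 2 * (tau ^+ 2 * F ^+ 2)
   <= 4 * a * (2 + lam1) ^+ 2 / g ^+ 2 * (tau * F ^+ 2) by exact: ler_wpM2l.
have : lam0 * cmin * F ^+ 2 <= A * tau * F ^+ 2.
  by rewrite AE; move: coer y3 y4 t2 e2; lin.
rewrite ler_pM2r ?exprn_gt0 // leNgt => /negP; apply.
move: tauA; rewrite ler_pdivlMr ?mulr_gt0 ?ltr0n //.
have : 0 < lam0 * cmin by rewrite mulr_gt0.
lin.
Qed.

Definition rayleigh_bound (R : realType) (I : finType) (k : I -> I -> R)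
    (w : I -> R) (lam : R) : Prop :=
  forall f, dot f (app k f) <= lam * dot f (fun v => w v * f v).

Definition eigen_eq (R : realType) (I : finType) (k : I -> I -> R)
    (w : I -> R) (lam : R) (h : I -> R) : Prop :=
  forall v, app k h v = lam * (w v * h v).

Lemma app_mean_profile (R : realType) (I : finType) (a b u1 rho : R)
    (U C : {set I}) v :
  perron_ratio a b u1 rho -> block_sizes u1 U C ->
  app (mean_kernel a b U C) (profile rho U C) v
    = (a * u1 + b * rho) / 2 * profile rho U C v.
Proof.
move=> [b0 ab u0 r1 rE] [I0 dUC cU cC].
have N0 : #|I|%:R != 0 :> R by rewrite pnatr_eq0 -lt0n.
rewrite app_mean_kernel !(dotC _ (profile _ _ _)) !dot_profile.
rewrite (dotC (ind R C) (ind R U)) (dot_ind_disj R dUC) !dot_ind_ind cU cC.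
rewrite /profile.
have -> : (a * u1 + b * rho) / 2 * (ind R U v + rho * ind R C v) =
  (a * u1 + b * rho) / 2 * ind R U v + rho * (a * u1 + b * rho) / 2 * ind R C v by ring.
by rewrite -rE; field.
Qed.

(** The principal eigenvector is aligned with the Perron profile: the Rayleigh
    quotient of the profile bounds [lam] from below, pairing the eigenvector with
    the profile, which is nonnegative, bounds it from above, and the spectral gap
    then controls the component of [h] that is not proportional to the profile. *)
Lemma principal_vector_profile (R : realType) (a b u1 rho cmin cmax : R) :
  perron_ratio a b u1 rho -> 0 < cmin ->
  exists tau K : R, [/\ 0 < tau, 0 < K &
  forall (I : finType) (U C : {set I}) k w eps lam (h : I -> R),
    block_sizes u1 U C -> concentrated a b cmin cmax eps U C k w ->
    0 <= eps -> eps <= tau ->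
    (forall v, 0 <= h v) -> (exists v, h v != 0) ->
    eigen_eq k w lam h -> rayleigh_bound k w lam ->
    `|lam * ((a + b) / 2) - (a * u1 + b * rho) / 2| <= K * eps /\
    exists2 t : R, 0 < t &
      dot (ind R U) h = t * (u1 * #|I|%:R / 2) /\
      nrm (fun v => h v - t * profile rho U C v)
        <= K * eps * t * Num.sqrt #|I|%:R].
Proof.
move=> PR cmin0.
have [tau1 tau10 gap] := spectral_gap cmax PR cmin0.
have [b0 ab /andP[u0 u1le] rho1 rhoE] := PR.
have a0 : 0 < a by lra.
have [Lam LamE] : exists x : R, x = (a * u1 + b * rho) / 2 by eexists.
have Lam0 : 0 < Lam.
  by rewrite LamE divr_gt0 ?ltr0n // addr_gt0 // mulr_gt0 //; lra.
have [wb wbE] : exists x : R, x = (a + b) / 2 by eexists.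
have wb0 : 0 < wb by rewrite wbE; lra.
have [c1 c1E] : exists x : R, x = 1 + 2 * rho * Lam / wb by eexists.
have c10 : 0 < c1.
  by rewrite c1E addr_gt0 // divr_gt0 // !mulr_gt0 ?ltr0n //; lra.
have [lam0 lam0E] : exists x : R, x = Lam / 2 / wb by eexists.
have lam00 : 0 < lam0 by rewrite lam0E !divr_gt0 ?ltr0n.
have [c2 c2E] : exists x : R, x = Num.sqrt (lam0 * cmin / 2 / a) by eexists.
have c20 : 0 < c2 by rewrite c2E sqrtr_gt0 !divr_gt0 ?mulr_gt0 ?ltr0n.
have [lam1 lam1E] : exists x : R, x = (4 * a + 1) / cmin by eexists.
have lam10 : 0 < lam1 by rewrite lam1E divr_gt0 //; lra.
have [c3 c3E] : exists x : R, x = rho * (1 + lam1) / c2 by eexists.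
have c30 : 0 < c3 by rewrite c3E divr_gt0 // mulr_gt0 //; lra.
have [c4 c4E] : exists x : R, x = rho * (1 + c3 + lam1) by eexists.
have c40 : 0 < c4 by rewrite c4E mulr_gt0 //; lra.
pose tau := Num.min (Num.min 1 tau1)
  (Num.min (Num.min (tau1 / c3) (Lam / 2 / c1)) (Num.min (Lam / 2) (lam0 * cmin / 2))).
have tau0 : 0 < tau by rewrite !lt_min ltr01 tau10 !divr_gt0 ?mulr_gt0 ?ltr0n.
have [ta tb tc] : [/\ tau <= 1, tau <= tau1 & tau <= tau1 / c3].
  by split; rewrite !ge_min lexx ?orbT.
have [td te tf] : [/\ tau <= Lam / 2 / c1, tau <= Lam / 2 & tau <= lam0 * cmin / 2].
  by split; rewrite !ge_min lexx ?orbT.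
clearbody tau.
exists tau, (Num.max c3 (tau1^-1 * c4)); split => //.
  by rewrite lt_max c30.
move=> I U C k w eps lam h BS CO eps0 epst h0 hn eig ray.
have [I0 dUC cU cC] := BS; have [ks kop wbd wdeg] := CO.
have N0 : 0 < #|I|%:R :> R by rewrite ltr0n.
have prE v := app_mean_profile v PR BS.
set p := profile rho U C in prE *; set N := #|I|%:R in N0 cU cC wdeg *.
set sN := Num.sqrt N in wdeg *.
have sN0 : 0 < sN by rewrite sqrtr_gt0.
have sNN : sN * sN = N by rewrite -expr2 sqr_sqrtr // ltW.
have r0 : 0 < rho by move: rho1; lin.
have pn : nrm p <= rho * sN by exact: nrm_profile_le.
have pB v : `|p v| <= rho by rewrite ger0_norm ?profile_ge0 ?profile_le // ltW.
have pmean f : dot f (app (mean_kernel a b U C) p) = Lam * dot f p.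
  by rewrite -dotZr; apply: eq_dot => // v; rewrite prE LamE.
rewrite -LamE -wbE; rewrite -wbE in wdeg.
have pp : dot p p = (u1 + rho ^+ 2) * N / 2.
  rewrite dot_profile !(dotC _ p) !dot_profile.
  by rewrite (dotC (ind R C) (ind R U)) (dot_ind_disj R dUC) !dot_ind_ind cU cC; ring.
have rho2 : 1 <= rho ^+ 2 by rewrite expr_ge1 // ltW.
have pp0 : 0 < dot p p by rewrite pp divr_gt0 ?mulr_gt0 ?ltr0n //; lra.
have sNp : sN <= 2 * nrm p.
  rewrite -(@ler_pXn2r _ 2) ?nnegrE ?(ltW sN0) ?mulr_ge0 ?ler0n ?nrm_ge0 //.
  rewrite exprMn nrm_sqr pp expr2 sNN.
  have : N <= (u1 + rho ^+ 2) * N by rewrite ler_peMl ?(ltW N0) //; move: u0 rho2; lin.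
  move: N0; lin.
(* The Rayleigh quotient of the profile bounds lam from below. *)
have lamlb : Lam - c1 * eps <= lam * wb.
  have h1 := kop p p; rewrite pmean -expr2 nrm_sqr in h1.
  have h2 := dot_weight p (ltW r0) wdeg pB.
  have h3 : rho * (eps * sN) * nrm p <= 2 * rho * eps * dot p p.
    rewrite -nrm_sqr expr2 !mulrA ler_wpM2r ?nrm_ge0 //.
    have : eps * rho * sN <= eps * rho * (2 * nrm p) by rewrite ler_wpM2l // mulr_ge0 // ltW.
    by lin.
  have h4 := ray p.
  move: h1 h2; rewrite !ler_norml => /andP[h1 _] /andP[_ h2].
  set q := dot p (fun v => _) in h2 h4.
  have q0 : 0 < q.
    apply: lt_le_trans (dot_weight_lb p (fun v => proj1 (andP (wbd v)))).
    by rewrite nrm_sqr mulr_gt0.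
  have lampos : 0 < lam.
    rewrite -(pmulr_lgt0 _ q0); apply: lt_le_trans h4.
    have : 0 < (Lam - eps) * dot p p by rewrite mulr_gt0 //; move: te epst Lam0; lin.
    move: h1; lin.
  have [lw|lw] := leP Lam (lam * wb).
    have : 0 <= c1 * eps by rewrite mulr_ge0 // ltW.
    move: lw; lin.
  have lL : lam <= Lam / wb by rewrite ler_pdivlMr // ltW.
  have h5 : lam * q <= lam * (wb + 2 * rho * eps) * dot p p.
    rewrite -mulrA ler_wpM2l ?(ltW lampos) //; move: h2 h3; lin.
  have h6 : (Lam - eps) * dot p p <= lam * (wb + 2 * rho * eps) * dot p p by move: h1 h4 h5; lin.
  rewrite ler_pM2r // in h6.
  have h7 : lam * (2 * rho * eps) <= Lam / wb * (2 * rho * eps).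
    by rewrite ler_wpM2r // !mulr_ge0 ?ler0n // ltW.
  have -> : c1 * eps = eps + Lam / wb * (2 * rho * eps) by rewrite c1E; ring.
  move: h6 h7; lin.
have laml : lam0 <= lam.
  rewrite lam0E ler_pdivrMr //; apply: le_trans lamlb.
  have : c1 * eps <= Lam / 2.
    by rewrite mulrC -ler_pdivlMr //; exact: le_trans td.
  lin.
have lampos : 0 < lam by exact: lt_le_trans laml.
set H := nrm h; set x := dot (ind R U) h; set y := dot (ind R C) h.
have x0 : 0 <= x by apply: sumr_ge0 => v _; rewrite mulr_ge0 ?ind_ge0.
have y0 : 0 <= y by apply: sumr_ge0 => v _; rewrite mulr_ge0 ?ind_ge0.
have H0 : 0 < H.
  rewrite lt_neqAle nrm_ge0 andbT eq_sym; apply/eqP => /nrm_eq0 hz.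
  by have [v] := hn; rewrite hz eqxx.
have khE f : dot f (app k h) = lam * dot f (fun v => w v * h v).
  by rewrite -dotZr; apply: eq_dot => // v; rewrite eig.
have hwh := dot_weight_lb h (fun v => proj1 (andP (wbd v))).
(* Were the mass x + y of h small, k would act on h as its small centered part. *)
have coer : lam * cmin * H ^+ 2 <= a * (x + y) ^+ 2 / N + eps * H ^+ 2.
  have h1 := kop h h; rewrite khE dot_mean_kernel -/x -/y -/N in h1.
  have h3 : (a * (x * x + y * y) + b * (x * y + y * x)) / N <= a * (x + y) ^+ 2 / N.
    rewrite ler_wpM2r ?invr_ge0 ?(ltW N0) //.
    have : b * (x * y) <= a * (x * y) by rewrite ler_wpM2r // mulr_ge0.
    lin.
  have h4 : lam * (cmin * H ^+ 2) <= lam * dot h (fun v => w v * h v).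
    by rewrite ler_wpM2l // ltW.
  move: h1; rewrite ler_norml -expr2 -/H => /andP[_ h1]; move: h1 h3 h4; lin.
have xyH : c2 * sN * H <= x + y.
  rewrite -(@ler_pXn2r _ 2) ?nnegrE ?addr_ge0 ?mulr_ge0 ?(ltW c20) ?(ltW sN0) ?(ltW H0) //.
  rewrite !exprMn [sN ^+ 2]expr2 sNN c2E sqr_sqrtr; last first.
    by rewrite !divr_ge0 ?mulr_ge0 ?ler0n // ltW.
  have -> : lam0 * cmin / 2 / a * N * H ^+ 2 = lam0 * cmin / 2 * H ^+ 2 / (a / N).
    by field; rewrite !lt0r_neq0.
  rewrite ler_pdivrMr ?divr_gt0 //.
  have : lam0 * cmin * H ^+ 2 <= lam * cmin * H ^+ 2.
    by rewrite ler_wpM2r ?sqr_ge0 // ler_wpM2r // ltW.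
  have : eps * H ^+ 2 <= lam0 * cmin / 2 * H ^+ 2.
    by rewrite ler_wpM2r ?sqr_ge0 // (le_trans epst).
  have -> : (x + y) ^+ 2 * (a / N) = a * (x + y) ^+ 2 / N by ring.
  move: coer; lin.
have xsN : x <= sN * H.
  by apply: le_trans (dot_le_nrm _ _) _; rewrite ler_wpM2r ?(ltW H0) // nrm_ind_le.
have ysN : y <= sN * H.
  by apply: le_trans (dot_le_nrm _ _) _; rewrite ler_wpM2r ?(ltW H0) // nrm_ind_le.
have lamh : lam <= lam1.
  rewrite lam1E ler_pdivlMr // -(@ler_pM2r _ (H ^+ 2)) ?exprn_gt0 //.
  apply: le_trans coer _.
  have : (x + y) ^+ 2 <= (2 * sN * H) ^+ 2.
    rewrite ler_pXn2r ?nnegrE ?addr_ge0 ?mulr_ge0 ?(ltW sN0) ?(ltW H0) //; move: xsN ysN; lin.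
  rewrite !exprMn [sN ^+ 2]expr2 sNN => h1.
  have : a * (x + y) ^+ 2 / N <= 4 * a * H ^+ 2.
    rewrite ler_pdivrMr //.
    have := ler_wpM2l (ltW a0) h1; lin.
  have : eps * H ^+ 2 <= 1 * H ^+ 2 by rewrite ler_wpM2r ?sqr_ge0 // (le_trans epst).
  lin.
(* The profile is an eigenvector of the mean kernel, and its product with h is at
   least x + y because both are nonnegative. *)
have lamc : `|lam * wb - Lam| <= c3 * eps.
  have h1 := kop p h.
  have -> : lam * wb - Lam = - (Lam - lam * wb) by ring.
  rewrite (app_adjoint (k := mean_kernel a b U C) p h) in h1; last first.
    by move=> u v; rewrite /mean_kernel; ring.
  rewrite khE (dotC _ h) pmean in h1.
  have h2 := dot_weight h (ltW r0) wdeg pB.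
  rewrite (dotC h p) in h1.
  have phE : dot p h = x + rho * y by rewrite dot_profile.
  have h3 : `|(Lam - lam * wb) * dot p h| <= eps * (nrm p * H) + lam * (rho * (eps * sN) * H).
    set q := dot p (fun v => _) in h1 h2.
    have -> : (Lam - lam * wb) * dot p h = lam * (q - wb * dot p h) - (lam * q - Lam * dot p h) by ring.
    apply: le_trans (ler_normB _ _) _; rewrite addrC lerD //.
    by rewrite normrM gtr0_norm // ler_wpM2l // ltW.
  have h4 : x + y <= dot p h.
    by rewrite phE lerD2l ler_peMl.
  have h5 : eps * (nrm p * H) + lam * (rho * (eps * sN) * H) <= rho * (1 + lam1) * eps * (sN * H).
    have : eps * (nrm p * H) <= eps * (rho * sN * H) by rewrite ler_wpM2l // ler_wpM2r // ltW.
    have : lam * (rho * (eps * sN) * H) <= lam1 * (rho * (eps * sN) * H).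
      by rewrite ler_wpM2r // !mulr_ge0 // ltW.
    lin.
  rewrite normrN -(@ler_pM2r _ (c2 * sN * H)) ?mulr_gt0 //.
  have h6 : `|Lam - lam * wb| * (c2 * sN * H) <= `|(Lam - lam * wb) * dot p h|.
    rewrite normrM ler_wpM2l // (le_trans xyH) // (le_trans h4) // ler_norm //.
  apply: le_trans h6 _; apply: le_trans h3 _; apply: le_trans h5 _.
  rewrite c3E le_eqVlt; apply/orP; left; apply/eqP; field.
  exact: lt0r_neq0.
split.
  by apply: le_trans lamc _; rewrite ler_wpM2r // le_max lexx.
pose t := x / (u1 * N / 2).
have u1N : 0 < u1 * N / 2 by rewrite divr_gt0 ?mulr_gt0 ?ltr0n.
have xE : x = t * (u1 * N / 2) by rewrite /t divfK // lt0r_neq0.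
have t0 : 0 <= t by rewrite /t divr_ge0 // ltW.
clearbody t.
have xf0 : dot (ind R U) (fun v => h v - t * p v) = 0.
  rewrite dotBr dotZr (dotC _ p) dot_profile -/x xE dot_ind_ind.
  by rewrite (dotC (ind R C)) (dot_ind_disj R dUC) cU; ring.
have lamt : `|lam * wb - Lam| <= tau1.
  by apply: le_trans lamc _; rewrite mulrC -ler_pdivlMr // (le_trans epst).
have epst1 : eps <= tau1 by exact: le_trans tb.
rewrite wbE LamE in lamt.
pose r v := app k (fun v => h v - t * p v) v - lam * (w v * (h v - t * p v)).
have := gap I U C k w eps lam _ r BS CO eps0 epst1 lamt xf0 (fun=> erefl).
have rE v : r v = - t * (app k p v - lam * (w v * p v)).
  by rewrite /r appB appZ eig; ring.
rewrite (eq_nrm rE) nrmZ normrN ger0_norm //.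
set m := nrm (fun v => app k p v - _).
have mle : m <= c4 * eps * sN.
  apply: nrm_dual => [|g]; first by rewrite !mulr_ge0 // ltW.
  rewrite dotBr dotZr.
  have h1 := kop g p; rewrite pmean in h1.
  have := dot_weight g (ltW r0) wdeg pB; rewrite (dotC p g).
  have -> : dot p (fun v => w v * g v) = dot g (fun v => w v * p v).
    by apply: eq_bigr => v _; ring.
  set q := dot g (fun v => _) => h2.
  have -> : dot g (app k p) - lam * q = (dot g (app k p) - Lam * dot g p)
     - (lam * wb - Lam) * dot g p - lam * (q - wb * dot g p) by ring.
  have gp : `|dot g p| <= nrm g * (rho * sN).
    by apply: le_trans (cauchy_schwarz _ _) _; rewrite ler_wpM2l ?nrm_ge0.
  have k1 : dot g (app k p) - Lam * dot g p <= eps * (rho * sN * nrm g).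
    apply: le_trans (ler_norm _) _; apply: le_trans h1 _.
    by rewrite ler_wpM2l // mulrC ler_wpM2r ?nrm_ge0.
  have k2 : - ((lam * wb - Lam) * dot g p) <= c3 * eps * (nrm g * (rho * sN)).
    apply: le_trans (ler_norm _) _; rewrite normrN normrM ler_pM //.
  have k3 : - (lam * (q - wb * dot g p)) <= lam1 * (rho * (eps * sN) * nrm g).
    apply: le_trans (ler_norm _) _; rewrite normrN normrM gtr0_norm //.
    by rewrite ler_pM // ltW.
  by rewrite c4E; move: k1 k2 k3; lin.
move=> fle.
have {}fle : nrm (fun v => h v - t * p v) <= tau1^-1 * c4 * eps * t * sN.
  apply: le_trans fle _; rewrite -!mulrA ler_wpM2l ?invr_ge0 ?(ltW tau10) //.
  rewrite (_ : c4 * _ = t * (c4 * eps * sN)); last by ring.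
  exact: ler_wpM2l.
have tpos : 0 < t.
  rewrite lt_neqAle t0 andbT eq_sym; apply/eqP => tz.
  move: fle; rewrite tz mulr0 mul0r => fle.
  have /nrm_eq0 z : nrm (fun v => h v - 0 * p v) = 0.
    by apply/eqP; rewrite eq_le fle nrm_ge0.
  by have [v] := hn; have := z v; rewrite mul0r subr0 => ->; rewrite eqxx.
exists t => //; split => //; apply: le_trans fle _.
by do 3 (apply: ler_wpM2r; first exact: ltW || by []); rewrite le_max lexx orbT.
Qed.

(** Isolating the vertex [u] moves the principal eigenvector by at most a constant
    times the single number [app k h' u], the mass that the row of [u] collects
    from the eigenvector of the modified kernel: off [u] the two equations differ
    by that row only, the shift of the eigenvalue is of lower order by
    self-adjointness, and the spectral gap turns the defect into a distance. *)
Lemma leave_one_out_distance (R : realType) (a b u1 rho cmin cmax K0 : R) :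
  perron_ratio a b u1 rho -> 0 < cmin -> cmin <= cmax -> 0 < K0 ->
  exists tau K : R, [/\ 0 < tau, 0 < K &
  forall (I : finType) (U C : {set I}) k w eps lam (h : I -> R)
         k' w' lam' (h' : I -> R) (u : I),
    block_sizes u1 U C -> concentrated a b cmin cmax eps U C k w ->
    0 <= eps -> eps <= tau ->
    (forall v z, 0 <= k v z) -> (forall v, 0 <= h v) -> (forall v, 0 <= h' v) ->
    eigen_eq k w lam h -> eigen_eq k' w' lam' h' ->
    `|lam * ((a + b) / 2) - (a * u1 + b * rho) / 2| <= K0 * eps ->
    `|lam' * ((a + b) / 2) - (a * u1 + b * rho) / 2| <= K0 * eps ->
    dot (ind R U) h = u1 * #|I|%:R / 2 -> dot (ind R U) h' = u1 * #|I|%:R / 2 ->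
    nrm (fun v => h v - profile rho U C v) <= K0 * eps * Num.sqrt #|I|%:R ->
    nrm (fun v => h' v - profile rho U C v) <= K0 * eps * Num.sqrt #|I|%:R ->
    h' u = 0 -> (forall z, k' u z = 0) ->
    (forall v z, v != u -> z != u -> k' v z = k v z) ->
    (forall v, `|w v - w' v| * h' v <= k u v * h' v) ->
    nrm (fun v => h' v - h v) <= K * app k h' u].
Proof.
move=> PR cmin0 cmM K00.
have [tau1 tau10 gap] := spectral_gap cmax PR cmin0.
have [b0 ab /andP[u0 u1le] rho1 rhoE] := PR.
have a0 : 0 < a by exact: lt_le_trans ab.
have r0 : 0 < rho by exact: lt_le_trans rho1.
have cmax0 : 0 < cmax by exact: lt_le_trans cmM.
have [Lam LamE] : exists x : R, x = (a * u1 + b * rho) / 2 by eexists.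
have Lam0 : 0 < Lam by rewrite LamE divr_gt0 ?ltr0n // addr_gt0 // mulr_gt0.
have [wb wbE] : exists x : R, x = (a + b) / 2 by eexists.
have wb0 : 0 < wb by rewrite wbE divr_gt0 ?ltr0n // addr_gt0.
have [lam1 lam1E] : exists x : R, x = 3 * Lam / (2 * wb) by eexists.
have lam10 : 0 < lam1 by rewrite lam1E divr_gt0 ?mulr_gt0 ?ltr0n.
have [K7 K7E] : exists x : R, x = 4 * (rho + 1) ^+ 2 * (1 + lam1) * cmax / cmin by eexists.
have K70 : 0 < K7.
  by rewrite K7E divr_gt0 // !mulr_gt0 ?exprn_gt0 ?ltr0n // addr_gt0.
pose tau := Num.min (Num.min tau1 (tau1 / K0))
  (Num.min (Lam / 2 / K0) ((4 * (2 * rho + 1))^-1 / K0)).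
have tau0 : 0 < tau.
  by rewrite !lt_min tau10 !divr_gt0 ?invr_gt0 ?mulr_gt0 ?ltr0n // addr_gt0 ?mulr_gt0 ?ltr0n.
have [ta tb tc td] : [/\ tau <= tau1, tau <= tau1 / K0, tau <= Lam / 2 / K0 &
   tau <= (4 * (2 * rho + 1))^-1 / K0].
  by split; rewrite !ge_min lexx ?orbT.
clearbody tau.
exists tau, (tau1^-1 * (1 + lam1 + K7)); split => //.
  by rewrite mulr_gt0 ?invr_gt0 // !addr_gt0.
move=> I U C k w eps lam h k' w' lam' h' u BS CO eps0 epst k0 h0 h'0 eig eig'.
rewrite -LamE -wbE => lamc lamc' xh xh' hp hp' h'u k'u k'k ww.
have [I0 dUC cU cC] := BS; have [ks kop wbd wdeg] := CO.
have N0 : 0 < #|I|%:R :> R by rewrite ltr0n.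
set p := profile rho U C in hp hp' *.
set N := #|I|%:R in N0 cU cC wdeg xh xh' hp hp'.
set sN := Num.sqrt N in wdeg hp hp'.
have sN0 : 0 < sN by rewrite sqrtr_gt0.
have sNN : sN * sN = N by rewrite -expr2 sqr_sqrtr // ltW.
have [Ke1 Ke2 Ke3] : [/\ K0 * eps <= tau1, K0 * eps <= Lam / 2 &
     K0 * eps <= (4 * (2 * rho + 1))^-1].
  by split; rewrite mulrC -ler_pdivlMr //; apply: le_trans epst _.
have lamb l : `|l * wb - Lam| <= K0 * eps -> 0 <= l <= lam1.
  rewrite ler_norml => /andP[l1 l2]; apply/andP; split.
    rewrite -(pmulr_lge0 _ wb0); move: l1 Ke2 Lam0; lin.
  rewrite lam1E ler_pdivlMr ?mulr_gt0 ?ltr0n //; move: l2 Ke2 Lam0; lin.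
have /andP[lam0 lamh] := lamb _ lamc; have /andP[lam'0 lam'h] := lamb _ lamc'.
have epst1 : eps <= tau1 by exact: le_trans ta.
set s := app k h' u.
have s0 : 0 <= s by apply: sumr_ge0 => v _; rewrite mulr_ge0.
pose A v := s * (v == u)%:R : R.
pose B v := - lam' * ((w v - w' v) * h' v).
pose D v := (lam' - lam) * (w v * h' v).
pose r v := A v + B v + D v.
have rE v : app k (fun z => h' z - h z) v - lam * (w v * (h' v - h v)) = r v.
  rewrite appB eig /r /A /B /D.
  have -> : app k h' v = app k' h' v + s * (v == u)%:R.
    have [->|vu] := eqVneq v u.
      by rewrite /= mulr1 [app k' _ _]big1 ?add0r // => z _; rewrite k'u mul0r.
    rewrite mulr0 addr0; apply: eq_bigr => z _.
    have [->|zu] := eqVneq z u; first by rewrite h'u !mulr0.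
    by rewrite k'k.
  by rewrite eig'; ring.
have kh' v : k u v * h' v >= 0 by rewrite mulr_ge0.
have nA : nrm A = s.
  rewrite /nrm /dot (bigD1 u) //= big1 => [|v vu]; last first.
    by rewrite /A (negbTE vu) !mulr0.
  by rewrite /A eqxx !mulr1 addr0 -expr2 sqrtr_sqr ger0_norm.
have nkh : nrm (fun v => k u v * h' v) <= s by exact: nrm_le_sum.
have Bbd v : `|B v| <= lam1 * (k u v * h' v).
  rewrite /B normrM normrN (ger0_norm lam'0) normrM (ger0_norm (h'0 v)).
  by rewrite ler_pM // mulr_ge0.
have nB : nrm B <= lam1 * s.
  apply: le_trans (ler_nrm Bbd) _; rewrite nrmZ gtr0_norm //.
  by rewrite ler_wpM2l // ltW.
have pn : nrm p <= rho * sN by exact: nrm_profile_le.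
have Ke4 : K0 * eps <= 1.
  apply: le_trans Ke3 _; rewrite invf_le1 ?mulr_gt0 ?ltr0n ?addr_gt0 ?mulr_gt0 ?ltr0n //; move: rho1; lin.
have nle g : nrm (fun v => g v - p v) <= K0 * eps * sN -> nrm g <= (rho + 1) * sN.
  move=> gp; have -> : nrm g = nrm (fun v => p v + (g v - p v)).
    by apply: eq_nrm => v; rewrite addrC subrK.
  apply: le_trans (nrmD _ _) _; rewrite mulrDl lerD // mul1r.
  by apply: le_trans gp _; rewrite ler_piMl // ltW.
have nh := nle _ hp; have nh' := nle _ hp'.
have hh' : N / 4 <= dot h h'.
  have -> : dot h h' = dot p p + dot p (fun v => h' v - p v)
     + dot (fun v => h v - p v) h' by rewrite dotBr dotBl; ring.
  have pp : N / 2 <= dot p p.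
    rewrite dot_profile !(dotC _ p) !dot_profile.
    rewrite (dotC (ind R C) (ind R U)) (dot_ind_disj R dUC) !dot_ind_ind cU cC.
    have : N <= rho ^+ 2 * N by rewrite ler_peMl ?(ltW N0) // expr_ge1 // ltW.
    have : 0 <= u1 * N by rewrite mulr_ge0 // ltW.
    lin.
  have h1 := cauchy_schwarz p (fun v => h' v - p v).
  have h2 := cauchy_schwarz (fun v => h v - p v) h'.
  have h3 : nrm p * nrm (fun v => h' v - p v) <= rho * sN * (K0 * eps * sN).
    by apply: ler_pM; rewrite ?nrm_ge0.
  have h4 : nrm (fun v => h v - p v) * nrm h' <= K0 * eps * sN * ((rho + 1) * sN).
    by apply: ler_pM; rewrite ?nrm_ge0.
  have h5 : rho * sN * (K0 * eps * sN) + K0 * eps * sN * ((rho + 1) * sN) <= N / 4.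
    have -> : rho * sN * (K0 * eps * sN) + K0 * eps * sN * ((rho + 1) * sN)
      = K0 * eps * ((2 * rho + 1) * N) by rewrite -sNN; ring.
    have r21 : 0 < 2 * rho + 1 by rewrite addr_gt0 ?mulr_gt0 ?ltr0n.
    have r21N : 0 < (2 * rho + 1) * N by rewrite mulr_gt0.
    apply: le_trans (ler_wpM2r (ltW r21N) Ke3) _.
    rewrite le_eqVlt; apply/orP; left; apply/eqP; field.
    exact: lt0r_neq0.
  move: h1 h2; rewrite !ler_norml => /andP[h1 _] /andP[h2 _].
  move: pp h1 h2 h3 h4 h5; lin.
have hr : dot h r = 0.
  rewrite -(eq_dot (fun=> erefl) rE) dotBr dotZr.
  rewrite app_adjoint // -dotMA -dotZl -dotBl [LHS]big1 // => v _.
  by rewrite eig subrr mul0r.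
have dl : `|lam' - lam| * (cmin * N / 4) <= (1 + lam1) * s * ((rho + 1) * sN).
  have whh : cmin * N / 4 <= dot h (fun v => w v * h' v).
    apply: (@le_trans _ _ (cmin * dot h h')).
      by rewrite -mulrA ler_wpM2l // ltW.
    rewrite -dotZr; apply: ler_sum => v _; rewrite ler_wpM2l // ler_wpM2r //.
    by have /andP[] := wbd v.
  have wh0 : 0 <= dot h (fun v => w v * h' v).
    apply: le_trans whh; rewrite divr_ge0 ?mulr_ge0 ?ler0n // ltW //.
  apply: (@le_trans _ _ `|dot h (fun v => A v + B v)|).
    have -> : dot h (fun v => A v + B v) = - ((lam' - lam) * dot h (fun v => w v * h' v)).
      have -> : dot h (fun v => A v + B v) = dot h r - dot h D.
        by rewrite -dotBr; apply: eq_dot => // v; rewrite /r addrK.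
      by rewrite hr sub0r /D dotZr.
    by rewrite normrN normrM (ger0_norm wh0) ler_wpM2l.
  apply: le_trans (cauchy_schwarz _ _) _; rewrite mulrC.
  apply: ler_pM; rewrite ?nrm_ge0 //; apply: le_trans (nrmD _ _) _.
  by rewrite nA; move: nB; lin.
have nD : nrm D <= K7 * s.
  rewrite /D nrmZ.
  have wh : nrm (fun v => w v * h' v) <= cmax * ((rho + 1) * sN).
    apply: le_trans (nrm_mul_le h' (c := cmax) _) _ => [v|].
      have /andP[w1 w2] := wbd v; rewrite ger0_norm //; apply: le_trans w1; exact: ltW.
    by rewrite ler_wpM2l // ltW.
  have cN : 0 < cmin * N / 4 by rewrite divr_gt0 ?mulr_gt0 ?ltr0n.
  rewrite -(@ler_pM2r _ (cmin * N / 4)) // mulrAC.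
  apply: (@le_trans _ _ ((1 + lam1) * s * ((rho + 1) * sN) * (cmax * ((rho + 1) * sN)))).
    apply: ler_pM => //; rewrite ?nrm_ge0 // mulr_ge0 ?normr_ge0 // ltW //.
  rewrite le_eqVlt; apply/orP; left; apply/eqP; rewrite K7E -sNN; field.
  exact: lt0r_neq0.
have xf : dot (ind R U) (fun v => h' v - h v) = 0 by rewrite dotBr xh xh' subrr.
have lamt : `|lam * wb - Lam| <= tau1 by exact: le_trans Ke1.
rewrite wbE LamE in lamt.
apply: le_trans (gap I U C k w eps lam _ r BS CO eps0 epst1 lamt xf rE) _.
rewrite -mulrA ler_wpM2l ?invr_ge0 ?(ltW tau10) //.
apply: le_trans (nrmD _ _) _; have := nrmD A B; rewrite nA.
move: nB nD; lin.
Qed.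

Definition principal (R : realType) (I : finType) (k : I -> I -> R)
    (w : I -> R) (lam : R) (h : I -> R) : Prop :=
  [/\ forall v, 0 <= h v, exists v, h v != 0, eigen_eq k w lam h
    & rayleigh_bound k w lam].

Definition normalized (R : realType) (I : finType) (u1 : R) (U : {set I})
    (h : I -> R) (v : I) : R := h v / (dot (ind R U) h / (u1 * #|I|%:R / 2)).

Definition deviation (R : realType) (I : finType) (u1 rho : R) (U C : {set I})
    (h : I -> R) (v : I) : R :=
  `|normalized u1 U h v - profile rho U C v|.

(** [k'] is [k] with the vertex [u] isolated, which changes the weights of the
    neighbours of [u]. The equation at [u] forces [h'] to vanish there, whatever the
    weight of [u]. *)
Definition isolates (R : realType) (I : finType) (k : I -> I -> R) (w : I -> R)
    (u : I) (k' : I -> I -> R) (w' h' : I -> R) : Prop :=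
  [/\ forall z, k' u z = 0,
      forall v z, v != u -> z != u -> k' v z = k v z
    & forall v, v != u -> `|w v - w' v| * h' v <= k u v * h' v].

(** The row of [u] meets the few vertices of large deviation rarely, so that it
    collects at most a small multiple of the maximal deviation. The maximum is
    taken with 1 so that the bound remains meaningful when all deviations are
    small. *)
Definition row_deviation_small (R : realType) (I : finType) (u1 rho eta0 kap : R)
    (U C : {set I}) (k : I -> I -> R) (u : I) (h' : I -> R) : Prop :=
  \sum_v deviation u1 rho U C h' v <= kap * #|I|%:R ->
  app k (deviation u1 rho U C h') u
    <= eta0 * \big[Num.max/1]_v deviation u1 rho U C h' v.

(** Since [s := app k h' u] is comparable to [h u], the leave-one-out distance is
    at most a constant times the maximum of [h]. The row of [u] sees a small
    multiple of that maximum, so at the maximum of [h] the eigenvector equation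
    bounds it by a constant; once it is bounded the same inequality says that
    [lam * w u * h u] is the value of [k] at the profile. *)
Lemma local_form (R : realType) (a b u1 rho cmin cmax : R) :
  perron_ratio a b u1 rho -> 0 < cmin -> cmin <= cmax ->
  forall eta : R, 0 < eta -> exists2 eta0 : R, 0 < eta0 &
  forall kap : R, 0 < kap -> exists2 eps0 : R, 0 < eps0 &
  forall (I : finType) (U C : {set I}) k w eps lam (h : I -> R) k' w' lam' h',
    block_sizes u1 U C -> concentrated a b cmin cmax eps U C k w ->
    0 <= eps -> eps <= eps0 ->
    (forall v z, 0 <= k v z) -> principal k w lam h ->
    (forall u, concentrated a b cmin cmax eps U C (k' u) (w' u)) ->
    (forall u, principal (k' u) (w' u) (lam' u) (h' u)) ->
    (forall u, isolates k w u (k' u) (w' u) (h' u)) ->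
    (forall u, nrm (k u) <= eps) -> (forall u, \sum_v k u v <= cmax) ->
    (forall u, row_deviation_small u1 rho eta0 kap U C k u (h' u)) ->
    exists2 t : R, 0 < t &
      forall u, `|lam * (w u * (h u / t)) - app k (profile rho U C) u| <= eta.
Proof.
move=> PR cmin0 cmM eta eta_gt0.
have [b0 ab /andP[u0 u1le] rho1 rhoE] := PR.
have a0 : 0 < a by exact: lt_le_trans ab.
have r0 : 0 < rho by exact: lt_le_trans rho1.
have cmax0 : 0 < cmax by exact: lt_le_trans cmM.
have [tau1 [K0 [tau10 K00 prof]]] := principal_vector_profile cmax PR cmin0.
have [tau2 [K1 [tau20 K10 loo]]] := leave_one_out_distance PR cmin0 cmM K00.
have [Lam LamE] : exists x : R, x = (a * u1 + b * rho) / 2 by eexists.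
have Lam0 : 0 < Lam by rewrite LamE divr_gt0 ?ltr0n // addr_gt0 // mulr_gt0.
have [wb wbE] : exists x : R, x = (a + b) / 2 by eexists.
have wb0 : 0 < wb by rewrite wbE divr_gt0 ?ltr0n // addr_gt0.
have [lam1 lam1E] : exists x : R, x = 3 * Lam / (2 * wb) by eexists.
have lam10 : 0 < lam1 by rewrite lam1E divr_gt0 ?mulr_gt0 ?ltr0n.
have [lam0 lam0E] : exists x : R, x = Lam / (2 * wb) by eexists.
have lam00 : 0 < lam0 by rewrite lam0E divr_gt0 ?mulr_gt0 ?ltr0n.
have [K2 K2E] : exists x : R, x = 2 * lam1 * cmax by eexists.
have K20 : 0 < K2 by rewrite K2E !mulr_gt0 ?ltr0n.
have [K3 K3E] : exists x : R, x = K1 * K2 + 1 + rho by eexists.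
have K31 : 1 <= K3.
  have : 0 < K1 * K2 by rewrite mulr_gt0.
  rewrite K3E; move: r0; lin.
have K30 : 0 < K3 by exact: lt_le_trans K31.
have [X1 X1E] : exists x : R, x = 4 * rho * cmax / (lam0 * cmin) + 1 by eexists.
have X10 : 0 < X1 by rewrite X1E addr_gt0 // divr_gt0 ?mulr_gt0 ?ltr0n.
pose eta0 := Num.min (lam0 * cmin / (4 * K3)) (eta / (2 * K3 * (X1 + 1))).
have eta00 : 0 < eta0 by rewrite lt_min !divr_gt0 ?mulr_gt0 ?ltr0n // addr_gt0.
have e01 : eta0 * K3 <= lam0 * cmin / 4.
  rewrite -ler_pdivlMr // (_ : lam0 * cmin / 4 / K3 = lam0 * cmin / (4 * K3)).
    by rewrite ge_min lexx.
  by field; exact: lt0r_neq0.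
have e02 : eta0 * (K3 * (X1 + 1)) <= eta / 2.
  rewrite -ler_pdivlMr ?mulr_gt0 ?addr_gt0 //.
  rewrite (_ : eta / 2 / (K3 * (X1 + 1)) = eta / (2 * K3 * (X1 + 1))).
    by rewrite ge_min lexx orbT.
  by field; rewrite !lt0r_neq0 // addr_gt0.
clearbody eta0; exists eta0 => // kap kap0.
pose eps0 := Num.min (Num.min (Num.min tau1 tau2) (Num.min (Lam / 2 / K0) (kap / K0)))
  (Num.min (2^-1 / K1) (eta / (2 * K1 * K2 * X1))).
have eps00 : 0 < eps0.
  by rewrite !lt_min tau10 tau20 !divr_gt0 ?mulr_gt0 ?invr_gt0 ?ltr0n.
have [ea eb ec] : [/\ eps0 <= tau1, eps0 <= tau2 & eps0 <= Lam / 2 / K0].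
  by split; rewrite !ge_min lexx ?orbT.
have [ed ee ef] : [/\ eps0 <= kap / K0, eps0 <= 2^-1 / K1 & eps0 <= eta / (2 * K1 * K2 * X1)].
  by split; rewrite !ge_min lexx ?orbT.
clearbody eps0; exists eps0 => //.
move=> I U C k w eps lam h k' w' lam' h' BS CO epsge epsle k0 [h0 hn eig ray] CO' PP' ISO kn krow rds.
have [I0 dUC cU cC] := BS; have [ks kop wbd wdeg] := CO.
have N0 : 0 < #|I|%:R :> R by rewrite ltr0n.
set p := profile rho U C; set N := #|I|%:R in N0 cU cC wdeg.
set sN := Num.sqrt N in wdeg.
have sN0 : 0 < sN by rewrite sqrtr_gt0.
have sNN : sN * sN = N by rewrite -expr2 sqr_sqrtr // ltW.
have u1N : 0 < u1 * N / 2 by rewrite divr_gt0 ?mulr_gt0 ?ltr0n.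
have [lamc [t t0 [xt dt]]] := prof I U C k w eps lam h BS CO epsge (le_trans epsle ea) h0 hn eig ray.
have scal (g : I -> R) s : 0 < s ->
   nrm (fun v => g v - s * p v) <= K0 * eps * s * sN ->
   nrm (fun v => g v / s - p v) <= K0 * eps * sN.
  move=> s0; have -> : nrm (fun v => g v - s * p v) = s * nrm (fun v => g v / s - p v).
    rewrite -[X in X * nrm _](gtr0_norm s0) -nrmZ; apply: eq_nrm => v.
    by field; exact: lt0r_neq0.
  move=> hy; rewrite -(ler_pM2l s0).
  by have -> : s * (K0 * eps * sN) = K0 * eps * s * sN by ring.
pose H v := h v / t.
have Hd : nrm (fun v => H v - p v) <= K0 * eps * sN by exact: scal.
have H0 v : 0 <= H v by rewrite divr_ge0 // ltW.
have xH : dot (ind R U) H = u1 * N / 2.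
  rewrite (@eq_dot _ _ _ (ind R U) _ (fun v => t^-1 * h v)) // => [|v]; last by rewrite mulrC.
  by rewrite dotZr xt mulKf // lt0r_neq0.
have eigZ k2 w2 l2 (g : I -> R) s : eigen_eq k2 w2 l2 g -> eigen_eq k2 w2 l2 (fun v => g v / s).
  move=> e v; have -> : app k2 (fun v => g v / s) v = app k2 (fun v => s^-1 * g v) v.
    by apply: eq_bigr => z _; rewrite (mulrC (g z)).
  by rewrite appZ e; ring.
pose H' u := normalized u1 U (h' u).
have Kel : K0 * eps <= Lam / 2 by rewrite mulrC -ler_pdivlMr //; exact: le_trans ec.
have dec u : [/\ forall v, 0 <= H' u v, nrm (fun v => H' u v - p v) <= K0 * eps * sN &
    nrm (fun v => H' u v - H v) <= K1 * app k (H' u) u].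
  have [h'0 h'n eig' ray'] := PP' u.
  have [lamc' [t' t'0 [xt' dt']]] := prof I U C (k' u) (w' u) eps (lam' u) (h' u) BS (CO' u) epsge (le_trans epsle ea) h'0 h'n eig' ray'.
  have H'E v : H' u v = h' u v / t'.
    by rewrite /H' /normalized xt' mulfK // lt0r_neq0.
  have H'0 v : 0 <= H' u v by rewrite H'E divr_ge0 // ltW.
  have H'd : nrm (fun v => H' u v - p v) <= K0 * eps * sN.
    rewrite (eq_nrm (g := fun v => h' u v / t' - p v)); first exact: scal.
    by move=> v; rewrite H'E.
  split => //.
  have xH' : dot (ind R U) (H' u) = u1 * N / 2.
    rewrite (@eq_dot _ _ _ (ind R U) _ (fun v => t'^-1 * h' u v)) // => [|v]; last by rewrite mulrC H'E.
    by rewrite dotZr xt' mulKf // lt0r_neq0.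
  have eH' : eigen_eq (k' u) (w' u) (lam' u) (H' u).
    by move=> v; exact: (eigZ _ _ _ _ (dot (ind R U) (h' u) / (u1 * N / 2)) eig').
  have [i2 i3 i4] := ISO u.
  have lam'0 : 0 < lam' u.
    move: lamc'; rewrite -LamE -wbE ler_norml => /andP[l1 _].
    by rewrite -(pmulr_lgt0 _ wb0); move: l1 Kel Lam0; lin.
  have i1 : h' u u = 0.
    have := eig' u; rewrite [app _ _ _]big1 => [|z _]; last by rewrite i2 mul0r.
    have [_ _ wbd' _] := CO' u; have /andP[w1 _] := wbd' u.
    move=> /esym/eqP; rewrite mulf_eq0 (gt_eqF lam'0) mulf_eq0 /= gt_eqF.
      by move=> /eqP.
    exact: lt_le_trans w1.
  apply: (loo I U C k w eps lam H (k' u) (w' u) (lam' u) (H' u) u) => //.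
  - exact: le_trans eb.
  - exact: eigZ.
  - by rewrite H'E i1 mul0r.
  - move=> v; rewrite H'E; have [->|vu] := eqVneq v u; first by rewrite i1 !mul0r !mulr0.
    by rewrite !mulrA ler_wpM2r ?i4 // invr_ge0 ltW.
have /andP[laml lamh] : lam0 <= lam <= lam1.
  move: lamc; rewrite -LamE -wbE ler_norml => /andP[l1 l2].
  apply/andP; split.
    rewrite lam0E ler_pdivrMr ?mulr_gt0 ?ltr0n //; move: l1 Kel; lin.
  rewrite lam1E ler_pdivlMr ?mulr_gt0 ?ltr0n //; move: l2 Kel; lin.
have lamp : 0 < lam by exact: lt_le_trans laml.
have kH u : app k H u = lam * (w u * H u) by exact: eigZ.
pose s u := app k (H' u) u.
have s0 u : 0 <= s u.
  by apply: sumr_ge0 => v _; rewrite mulr_ge0 //; have [] := dec u.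
have w0 u : 0 <= w u by have /andP[h1 _] := wbd u; exact: le_trans (ltW cmin0) h1.
have ls u : `|lam * (w u * H u) - s u| <= eps * K1 * s u.
  rewrite -kH -appB; apply: le_trans (cauchy_schwarz _ _) _.
  rewrite -mulrA; apply: ler_pM; rewrite ?nrm_ge0 //.
  have [_ _ h1] := dec u; apply: le_trans h1.
  by rewrite -(nrmN (fun v => H' u v - H v)) (eq_nrm (g := fun v => - (H' u v - H v))) // => v; rewrite opprB.
have eK1 : eps * K1 <= 2^-1 by rewrite -ler_pdivlMr //; exact: le_trans ee.
have ls2 u : eps * K1 * s u <= 2^-1 * s u by rewrite ler_wpM2r.
have sH u : s u <= K2 * H u.
  have h1 : lam * (w u * H u) <= lam1 * (cmax * H u).
    apply: ler_pM => //; [exact: ltW|exact: mulr_ge0|].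
    by rewrite ler_wpM2r //; have /andP[] := wbd u.
  have := ls u; rewrite ler_norml => /andP[h2 _].
  rewrite K2E; move: h1 h2 (ls2 u); lin.
have /card_gt0P[i0 _] := I0.
have [us _ usP] := @arg_maxP _ _ _ i0 xpredT H isT.
set X := H us in usP *.
have HX v : H v <= X by exact: usP.
have X0 : 0 <= X by exact: H0.
(* The row of u sees the deviation of the eigenvector that does not depend on it. *)
pose x u := deviation u1 rho U C (h' u).
have xE u v : x u v = `|H' u v - p v| by [].
have x0 u v : 0 <= x u v by exact: normr_ge0.
have xbd u v : x u v <= K3 * (X + 1).
  have [_ _ h1] := dec u.
  have h2 : `|H' u v - H v| <= K1 * (K2 * X).
    apply: le_trans (coord_le_nrm (fun v => H' u v - H v) v) _.
    apply: le_trans h1 _; rewrite ler_wpM2l ?(ltW K10) //.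
    by apply: le_trans (sH u) _; rewrite ler_wpM2l // ltW.
  rewrite xE; have -> : H' u v - p v = (H' u v - H v) + H v - p v by rewrite subrK.
  apply: le_trans (ler_normB _ _) _.
  have h3 := ler_normD (H' u v - H v) (H v).
  have h4 : `|p v| <= rho by rewrite ger0_norm ?profile_ge0 ?profile_le // ltW.
  rewrite (ger0_norm (H0 v)) in h3.
  have h5 : 0 <= K1 * K2 by rewrite mulr_ge0 // ltW.
  have h6 : 0 <= rho * X by rewrite mulr_ge0 // ltW.
  rewrite K3E; move: h2 h3 h4 h5 h6 (HX v); lin.
have Mx u : \big[Num.max/1]_v x u v <= K3 * (X + 1).
  elim/big_ind: _ => [|y z hy hz|v _]; last exact: xbd.
  - have h1 : K3 * 1 <= K3 * (X + 1) by rewrite ler_wpM2l ?(ltW K30) // lerDr.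
    move: h1 K31; lin.
  - by rewrite ge_max hy hz.
have kx u : app k (x u) u <= eta0 * (K3 * (X + 1)).
  apply: (@le_trans _ _ (eta0 * \big[Num.max/1]_v x u v)).
    apply: rds.
    have [_ h1 _] := dec u.
    have h2 : \sum_v x u v <= nrm (fun _ : I => 1) * nrm (x u).
      apply: le_trans (dot_le_nrm _ _); apply: ler_sum => v _; by rewrite mul1r.
    have h3 : nrm (x u) = nrm (fun v => H' u v - p v).
      congr Num.sqrt; apply: eq_bigr => v _.
      by rewrite xE -normrM ger0_norm // -expr2 sqr_ge0.
    have h4 : nrm (fun _ : I => 1) = sN :> R.
      by rewrite /nrm /dot sumr_const mulr1.
    apply: le_trans h2 _; rewrite h3 h4.
    apply: (@le_trans _ _ (sN * (K0 * eps * sN))); first by rewrite ler_wpM2l // ltW.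
    rewrite mulrCA sNN ler_wpM2r ?(ltW N0) // mulrC -ler_pdivlMr //.
    exact: le_trans ed.
  by rewrite ler_wpM2l // ltW.
have kp u : app k p u <= rho * cmax.
  apply: (@le_trans _ _ (rho * \sum_v k u v)); last by rewrite ler_wpM2l // ltW.
  rewrite mulr_sumr; apply: ler_sum => v _; rewrite mulrC ler_wpM2r //.
  exact: profile_le.
have skp u : `|s u - app k p u| <= app k (x u) u.
  rewrite -appB; apply: le_trans (ler_norm_sum _ _ _) _; apply: ler_sum => v _.
  by rewrite normrM (ger0_norm (k0 _ _)) xE.
(* At a maximum of H the equation bounds X by a constant plus a small multiple of
   X. *)
have XX1 : X <= X1.
  have h1 := kx us; have h2 := kp us; have := skp us; have := ls us.
  rewrite !ler_norml => /andP[_ h3] /andP[_ h4].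
  have h5 : lam0 * (cmin * X) <= lam * (w us * H us).
    apply: ler_pM => //; [exact: ltW | by rewrite mulr_ge0 // ltW |].
    by rewrite ler_wpM2r //; have /andP[] := wbd us.
  have h6 : eta0 * (K3 * (X + 1)) <= lam0 * cmin / 4 * (X + 1).
    by rewrite mulrA ler_wpM2r // addr_ge0.
  have lc : 0 < lam0 * cmin by rewrite mulr_gt0.
  have h7 : X * (lam0 * cmin) <= X1 * (lam0 * cmin).
    have -> : X1 * (lam0 * cmin) = 4 * rho * cmax + lam0 * cmin.
      by rewrite X1E; field; rewrite !lt0r_neq0.
    move: h1 h2 h3 h4 h5 h6 (ls2 us) (s0 us) lc; lin.
  by rewrite (ler_pM2r lc) in h7.
exists t => // u.
have -> : lam * (w u * (h u / t)) - app k p u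
   = (lam * (w u * H u) - s u) + (s u - app k p u) by rewrite /H; ring.
apply: le_trans (ler_normD _ _) _.
have h1 : eps * K1 * s u <= eta / 2.
  apply: (@le_trans _ _ (eps * (K1 * K2 * X1))).
    rewrite -!mulrA ler_wpM2l // ler_wpM2l ?(ltW K10) //.
    apply: le_trans (sH u) _; rewrite ler_wpM2l ?(ltW K20) //.
    exact: le_trans XX1.
  have KK : 0 < K1 * K2 * X1 by rewrite !mulr_gt0.
  rewrite -ler_pdivlMr //; apply: le_trans epsle _; apply: le_trans ef _.
  by rewrite le_eqVlt; apply/orP; left; apply/eqP; field; rewrite !lt0r_neq0.
have h2 : eta0 * (K3 * (X + 1)) <= eta / 2.
  apply: le_trans e02; rewrite ler_wpM2l ?(ltW eta00) // ler_wpM2l ?(ltW K30) //.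
  by rewrite lerD2r.
move: h1 h2 (ls u) (skp u) (kx u); lin.
Qed.

(** The unknown scale of the eigenvector disappears when [w * h] has total mass 1:
    summing the local form over all vertices determines it. *)
Lemma local_expansion (R : realType) (a b u1 rho cmin cmax : R) :
  perron_ratio a b u1 rho -> 0 < cmin -> cmin <= cmax ->
  forall eta : R, 0 < eta -> exists2 eta0 : R, 0 < eta0 &
  forall kap : R, 0 < kap -> exists2 eps0 : R, 0 < eps0 &
  forall (I : finType) (U C : {set I}) k w eps lam (h : I -> R) k' w' lam' h',
    block_sizes u1 U C -> concentrated a b cmin cmax eps U C k w ->
    0 <= eps -> eps <= eps0 ->
    (forall v z, 0 <= k v z) -> principal k w lam h ->
    (forall u, concentrated a b cmin cmax eps U C (k' u) (w' u)) ->
    (forall u, principal (k' u) (w' u) (lam' u) (h' u)) ->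
    (forall u, isolates k w u (k' u) (w' u) (h' u)) ->
    (forall u, nrm (k u) <= eps) -> (forall u, \sum_v k u v <= cmax) ->
    (forall u, row_deviation_small u1 rho eta0 kap U C k u (h' u)) ->
    \sum_v w v * h v = 1 ->
    forall u, `|(a * (rho + u1 ^+ 2) + b * (rho + 1) * u1) / 4 * #|I|%:R * (w u * h u)
                - app k (profile rho U C) u| <= eta.
Proof.
move=> PR cmin0 cmM eta eta_gt0.
have [b0 ab /andP[u0 u1le] rho1 rhoE] := PR.
have a0 : 0 < a by exact: lt_le_trans ab.
have r0 : 0 < rho by exact: lt_le_trans rho1.
have cmax0 : 0 < cmax by exact: lt_le_trans cmM.
have [cg cgE] : exists x : R, x = (a * (rho + u1 ^+ 2) + b * (rho + 1) * u1) / 4 by eexists.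
have cg0 : 0 < cg.
  by rewrite cgE divr_gt0 ?ltr0n // addr_gt0 ?mulr_gt0 // addr_gt0 // exprn_gt0.
have [B BE] : exists x : R, x = rho * cmax + 1 by eexists.
have B0 : 0 < B by rewrite BE addr_gt0 // mulr_gt0.
pose eta1 := Num.min (Num.min (eta / 2) 1) (Num.min (cg / 4) (eta * cg / (8 * B))).
have eta10 : 0 < eta1 by rewrite !lt_min ltr01 !divr_gt0 ?mulr_gt0 ?ltr0n.
have [e1 e2] : eta1 <= eta / 2 /\ eta1 <= 1 by split; rewrite !ge_min lexx ?orbT.
have [e3 e4] : eta1 <= cg / 4 /\ eta1 <= eta * cg / (8 * B).
  by split; rewrite !ge_min lexx ?orbT.
clearbody eta1.
have [eta0 eta00 LF] := local_form PR cmin0 cmM eta10.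
exists eta0 => // kap kap0; have [eps1 eps10 {}LF] := LF kap kap0.
pose eps0 := Num.min eps1 (eta1 / rho).
have eps00 : 0 < eps0 by rewrite lt_min eps10 divr_gt0.
have [e5 e6] : eps0 <= eps1 /\ eps0 <= eta1 / rho by split; rewrite ge_min lexx ?orbT.
clearbody eps0; exists eps0 => //.
move=> I U C k w eps lam h k' w' lam' h' BS CO epsge epsle k0 PP CO' PP' ISO kn krow rds sum1 u.
have [t t0 lf] := LF I U C k w eps lam h k' w' lam' h' BS CO epsge (le_trans epsle e5) k0 PP CO' PP' ISO kn krow rds.
have [I0 dUC cU cC] := BS; have [ks kop wbd wdeg] := CO.
have N0 : 0 < #|I|%:R :> R by rewrite ltr0n.
set p := profile rho U C in lf *; set N := #|I|%:R in N0 cU cC wdeg *.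
have sNN : Num.sqrt N * Num.sqrt N = N by rewrite -expr2 sqr_sqrtr // ltW.
pose one (_ : I) : R := 1.
have tot : `|lam / t - cg * N| <= 2 * eta1 * N.
  have h1 : `|lam / t - dot one (app k p)| <= eta1 * N.
    have -> : lam / t = \sum_v lam * (w v * (h v / t)).
      by rewrite -[LHS]mulr1 -sum1 mulr_sumr; apply: eq_bigr => v _; ring.
    have -> : dot one (app k p) = \sum_v app k p v.
      by apply: eq_bigr => v _; rewrite mul1r.
    rewrite -sumrB; apply: le_trans (ler_norm_sum _ _ _) _.
    have -> : eta1 * N = \sum_(v : I) eta1 by rewrite sumr_const mulr_natr.
    exact: ler_sum.
  have h2 := kop one p.
  have nE : nrm one = Num.sqrt N by rewrite /nrm /dot /one sumr_const ?mulr1.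
  have h3 : eps * (nrm one * nrm p) <= eta1 * N.
    apply: (@le_trans _ _ (eps * (rho * N))).
      rewrite ler_wpM2l // nE -[X in rho * X]sNN mulrCA ler_wpM2l ?sqrtr_ge0 //.
      exact: nrm_profile_le.
    rewrite mulrA ler_wpM2r ?(ltW N0) // -ler_pdivlMr //.
    exact: le_trans e6.
  have h4 : dot one (app (mean_kernel a b U C) p) = cg * N.
    have -> : dot one (app (mean_kernel a b U C) p) = (a * u1 + b * rho) / 2 * dot one p.
      by rewrite -dotZr; apply: eq_dot => // v; rewrite (app_mean_profile v PR BS).
    rewrite dotC dot_profile !dot_indE !sumr_const cU cC cgE.
    have -> : (a * u1 + b * rho) / 2 * (u1 * N / 2 + rho * (N / 2))
      = (a * u1 ^+ 2 + b * rho * u1 + rho * (a * u1 + b * rho)) / 4 * N by field.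
    by rewrite -rhoE; field.
  rewrite h4 in h2; move: h1 h2 h3; rewrite !ler_norml => /andP[? ?] /andP[? ?].
  by move=> ?; apply/andP; split; lra.
have big : cg / 2 * N <= lam / t.
  have : 2 * eta1 * N <= cg / 2 * N by rewrite ler_wpM2r ?(ltW N0) //; move: e3; lin.
  move: tot; rewrite ler_norml => /andP[h1 _]; move: h1; lin.
have lt0 : 0 < lam / t by apply: lt_le_trans big; rewrite mulr_gt0 // divr_gt0 ?ltr0n.
have lamn : lam != 0 by apply/eqP => lz; rewrite lz mul0r ltxx in lt0.
set m := lam * (w u * (h u / t)).
have whE : w u * h u = m / (lam / t).
  by rewrite /m; field; rewrite lamn lt0r_neq0.
rewrite -cgE whE.
have m0 : 0 <= m.
  have -> : m = lam / t * (w u * h u) by rewrite /m; ring.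
  have /andP[w1 _] := wbd u; have [h0 _ _ _] := PP.
  by rewrite mulr_ge0 ?(ltW lt0) // mulr_ge0 // (le_trans _ w1) // ltW.
have kp : app k p u <= rho * cmax.
  apply: (@le_trans _ _ (rho * \sum_v k u v)); last by rewrite ler_wpM2l // ltW.
  rewrite mulr_sumr; apply: ler_sum => v _; rewrite mulrC ler_wpM2r //.
  exact: profile_le.
have mB : m <= B.
  have := lf u; rewrite -/m ler_norml BE => /andP[_]; move: kp e2; lin.
have -> : cg * N * (m / (lam / t)) - app k p u
   = (m - app k p u) - m * ((lam / t - cg * N) / (lam / t)).
  by field; rewrite lamn lt0r_neq0.
apply: le_trans (ler_normB _ _) _; have h1 := lf u; rewrite -/m in h1.
have h2 : `|m * ((lam / t - cg * N) / (lam / t))| <= eta / 2.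
  rewrite normrM (ger0_norm m0) normrM normfV (gtr0_norm lt0).
  apply: (@le_trans _ _ (B * (2 * eta1 * N / (cg / 2 * N)))).
    apply: ler_pM => //; first by rewrite mulr_ge0 // invr_ge0 ltW.
    apply: ler_pM => //; first by rewrite invr_ge0 ltW.
    by rewrite lef_pV2 ?posrE // mulr_gt0 // divr_gt0 ?ltr0n.
  have -> : B * (2 * eta1 * N / (cg / 2 * N)) = eta1 * (4 * B / cg).
    by field; rewrite !lt0r_neq0.
  rewrite -ler_pdivlMr ?divr_gt0 ?mulr_gt0 ?ltr0n //.
  have -> : eta / 2 / (4 * B / cg) = eta * cg / (8 * B) by field; rewrite !lt0r_neq0.
  by [].
move: h1 h2 e1; lin.
Qed.

(** * From discrepancy to operator norm *)

Definition between (R : realType) (I : finType) (E : I -> I -> R) (S T : {set I}) : R :=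
  \sum_(u in S) \sum_(v in T) E u v.

(** The binary digits of the coordinates of a vector cut it into indicator
    functions at dyadic scales. *)
Definition bit (k m : nat) : bool := odd (m %/ 2 ^ k).

Lemma bits_modn K m : (\sum_(k < K) 2 ^ k * bit k m = m %% 2 ^ K)%N.
Proof.
elim: K => [|K IH]; first by rewrite big_ord0 expn0 modn1.
rewrite big_ord_recr /= IH /bit.
have e1 := divn_eq m (2 ^ K); have e2 := divn_eq m (2 ^ K.+1).
have e3 : (m %/ 2 ^ K.+1 = (m %/ 2 ^ K)./2)%N by rewrite expnSr divnMA divn2.
have e4 := odd_double_half (m %/ 2 ^ K).
have e5 : (m %/ 2 ^ K * 2 ^ K = odd (m %/ 2 ^ K) * 2 ^ K + (m %/ 2 ^ K)./2 * 2 ^ K.+1)%N.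
  by rewrite -[in LHS]e4 mulnDl -mul2n expnS; congr (_ + _)%N; ring.
rewrite e3 in e2.
apply/eqP; rewrite -(eqn_add2l ((m %/ 2 ^ K)./2 * 2 ^ K.+1)) -e2 {4}e1 e5.
by apply/eqP; ring.
Qed.

Lemma nat_bits K m : (m < 2 ^ K)%N -> m = (\sum_(k < K) 2 ^ k * bit k m)%N.
Proof. by move=> mK; rewrite bits_modn modn_small. Qed.

Lemma sum_near K J k :
  (\sum_(l < K | (k <= l + J) && (l <= k + J)) 1 <= 2 * J + 1)%N.
Proof.
rewrite -(big_mkord (fun l => (k <= l + J) && (l <= k + J))%N (fun=> 1%N)).
rewrite sum1_count -size_filter -(size_iota (k - J) (2 * J + 1)).
apply: uniq_leq_size => [|l]; first by rewrite filter_uniq ?iota_uniq.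
rewrite mem_filter mem_iota => /andP[/andP[h1 h2] _].
by apply/andP; split; lia.
Qed.

Lemma sum_far K J k :
  (\sum_(l < K | l + J < k) 2 ^ l * 2 ^ J <= 2 ^ k)%N.
Proof.
have H : (\sum_(l < K | l + J < k) 2 ^ l < 2 ^ minn K (k - J))%N.
  elim: K => [|K IH]; first by rewrite big_ord0 expn_gt0.
  rewrite big_mkcond big_ord_recr /= -big_mkcond /=.
  case: ifPn => KJ.
    have -> : minn K.+1 (k - J) = (minn K (k - J)).+1 by lia.
    rewrite expnS mul2n -addnn -addSn leq_add //.
    by rewrite leq_exp2l //; lia.
  by rewrite addn0; apply: leq_trans IH _; rewrite leq_exp2l //; lia.
rewrite -big_distrl /=; have [kJ|Jk] := ltnP k J.
  rewrite big1 // => l; rewrite ltnNge; lia.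
have {1}-> : k = (k - J + J)%N by rewrite subnK.
rewrite [leqRHS](_ : _ = 2 ^ (k - J) * 2 ^ J)%N; last by rewrite -expnD subnK.
rewrite leq_mul2r; apply/orP; right; rewrite subnK //.
apply: leq_trans (ltnW H) _; by rewrite leq_exp2l //; lia.
Qed.

Section Digits.
Variables (R : realType) (I : finType) (E : I -> I -> R) (alpha Delta : R).
Hypotheses (alpha0 : 0 <= alpha) (D0 : 0 <= Delta).
Hypothesis Esym : forall u v, E u v = E v u.
Hypothesis disc : forall S T : {set I},
  `|between E S T| <= alpha * Num.sqrt (#|S|%:R * #|T|%:R).
Hypothesis row : forall u, \sum_v `|E u v| <= Delta.

Lemma between_le_l S T : `|between E S T| <= Delta * #|S|%:R.
Proof.
apply: le_trans (ler_norm_sum _ _ _) _.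
rewrite mulr_natr -sumr_const; apply: ler_sum => u _.
apply: le_trans (ler_norm_sum _ _ _) _; apply: le_trans (row u).
by rewrite big_mkcond; apply: ler_sum => v _; case: ifP.
Qed.

Lemma between_sym S T : between E S T = between E T S.
Proof. by rewrite /between exchange_big; do 2 apply: eq_bigr => ? _. Qed.

Lemma between_le_r S T : `|between E S T| <= Delta * #|T|%:R.
Proof. by rewrite between_sym between_le_l. Qed.

Definition digit_set k (m : I -> nat) : {set I} := [set v | bit k (m v)].

Lemma sum_digit_mass K (m : I -> nat) : (forall v, (m v < 2 ^ K)%N) ->
  \sum_(k < K) (2 ^ k)%:R ^+ 2 * #|digit_set k m|%:R
    <= \sum_v (m v)%:R ^+ 2 :> R.
Proof.
move=> mK; have -> : \sum_(k < K) (2 ^ k)%:R ^+ 2 * #|digit_set k m|%:R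
   = \sum_v \sum_(k < K) ((2 ^ k * bit k (m v))%N%:R : R) ^+ 2.
  rewrite exchange_big; apply: eq_bigr => k _.
  rewrite -sum1_card natr_sum mulr_sumr big_mkcond.
  apply: eq_bigr => v _; rewrite inE; case: (bit k (m v)); last by rewrite muln0 expr0n.
  by rewrite mulr1 muln1.
apply: ler_sum => v _; rewrite {2}(nat_bits (mK v)) natr_sum.
have h := @nrm_le_sum R 'I_K (fun k => (2 ^ k * bit k (m v))%N%:R) (fun=> ler0n _ _).
rewrite -(@ler_pXn2r _ 2) ?nnegrE ?nrm_ge0 // ?sumr_ge0 // in h.
rewrite nrm_sqr in h; apply: le_trans h; rewrite le_eqVlt; apply/orP; left.
by apply/eqP; apply: eq_bigr => k _; rewrite expr2.
Qed.

(** Pairs of digits at distance at most [J] are controlled by the discrepancy and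
    the others, whose weights decay geometrically, by the row sums. *)
Lemma bilinear_nat J (m m' : I -> nat) :
  `|\sum_u \sum_v (m u)%:R * E u v * (m' v)%:R|
    <= (alpha * (2 * J%:R + 1) / 2 + Delta / 2 ^+ J)
       * (\sum_v (m v)%:R ^+ 2 + \sum_v (m' v)%:R ^+ 2).
Proof.
have [K mK m'K] : exists2 K, (forall v, (m v < 2 ^ K)%N) & (forall v, (m' v < 2 ^ K)%N).
  exists (\max_v (m v + m' v)%N) => v; apply: leq_trans (ltn_expl _ (isT : 1 < 2)%N) _;
    rewrite leq_exp2l //; apply: leq_trans (leq_bigmax v); lia.
pose e k l := between E (digit_set k m) (digit_set l m').
pose P k : R := (2 ^ k)%:R ^+ 2 * #|digit_set k m|%:R.
pose Q k : R := (2 ^ k)%:R ^+ 2 * #|digit_set k m'|%:R.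
have P0 k : 0 <= P k by rewrite mulr_ge0 ?sqr_ge0.
have Q0 k : 0 <= Q k by rewrite mulr_ge0 ?sqr_ge0.
have -> : \sum_u \sum_v (m u)%:R * E u v * (m' v)%:R
   = \sum_(k < K) \sum_(l < K) (2 ^ k)%:R * (2 ^ l)%:R * e k l.
  have -> : \sum_u \sum_v (m u)%:R * E u v * (m' v)%:R =
    \sum_u \sum_v \sum_(k < K) \sum_(l < K) (2 ^ k)%:R * (2 ^ l)%:R *
       ((bit k (m u))%:R * (bit l (m' v))%:R * E u v).
    apply: eq_bigr => u _; apply: eq_bigr => v _.
    rewrite {1}(nat_bits (mK u)) {1}(nat_bits (m'K v)) !natr_sum mulr_suml mulr_suml.
    apply: eq_bigr => k _; rewrite mulr_sumr; apply: eq_bigr => l _.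
    by rewrite !natrM; ring.
  under eq_bigr => u _.
    rewrite exchange_big /=; under eq_bigr => k _ do rewrite exchange_big /=.
    over.
  rewrite exchange_big /=; apply: eq_bigr => k _; rewrite exchange_big /=.
  apply: eq_bigr => l _; rewrite /e /between mulr_sumr [RHS]big_mkcond /=.
  apply: eq_bigr => u _; rewrite inE; case: (bit k (m u)); last first.
    by rewrite big1 // => v _; rewrite !mul0r mulr0.
  rewrite mulr_sumr [RHS]big_mkcond; apply: eq_bigr => v _; rewrite inE.
  by case: (bit l (m' v)); rewrite ?mul1r // !mul0r mulr0.
have pe k l : `|(2 ^ k)%:R * (2 ^ l)%:R * e k l| <=
    (if ((k <= l + J) && (l <= k + J))%N then alpha / 2 * (P k + Q l) else 0)
    + (if (l + J < k)%N then Delta * P k * ((2 ^ l)%:R / (2 ^ k)%:R) else 0)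
    + (if (k + J < l)%N then Delta * Q l * ((2 ^ k)%:R / (2 ^ l)%:R) else 0).
  have k0 j : 0 < (2 ^ j)%:R :> R by rewrite ltr0n expn_gt0.
  have kn j : (2 ^ j)%:R != 0 :> R by exact: lt0r_neq0.
  rewrite normrM ger0_norm ?mulr_ge0 //.
  have [kl|kl] := leqP k (l + J); last first.
    rewrite ifN; last by lia.
    rewrite add0r addr0.
    have -> : Delta * P k * ((2 ^ l)%:R / (2 ^ k)%:R) = (2 ^ k)%:R * (2 ^ l)%:R * (Delta * #|digit_set k m|%:R).
      by rewrite /P; field.
    by rewrite ler_wpM2l ?mulr_ge0 // between_le_l.
  have [lk|lk] := leqP l (k + J); last first.
    rewrite !add0r.
    have -> : Delta * Q l * ((2 ^ k)%:R / (2 ^ l)%:R) = (2 ^ k)%:R * (2 ^ l)%:R * (Delta * #|digit_set l m'|%:R).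
      by rewrite /Q; field.
    by rewrite ler_wpM2l ?mulr_ge0 // between_le_r.
  rewrite /= !addr0.
  have h := disc (digit_set k m) (digit_set l m').
  rewrite sqrtrM // in h.
  set x := Num.sqrt _ in h; set y := Num.sqrt _ in h.
  have -> : P k = ((2 ^ k)%:R * x) ^+ 2 by rewrite exprMn /x sqr_sqrtr.
  have -> : Q l = ((2 ^ l)%:R * y) ^+ 2 by rewrite exprMn /y sqr_sqrtr.
  apply: (@le_trans _ _ ((2 ^ k)%:R * (2 ^ l)%:R * (alpha * (x * y)))).
    by rewrite ler_wpM2l ?mulr_ge0.
  rewrite -subr_ge0.
  have -> : alpha / 2 * (((2 ^ k)%:R * x) ^+ 2 + ((2 ^ l)%:R * y) ^+ 2)
     - (2 ^ k)%:R * (2 ^ l)%:R * (alpha * (x * y))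
     = alpha / 2 * ((2 ^ k)%:R * x - (2 ^ l)%:R * y) ^+ 2 by field.
  by rewrite mulr_ge0 ?sqr_ge0 // divr_ge0.
apply: (@le_trans _ _ (\sum_(k < K) \sum_(l < K) (
    (if ((k <= l + J) && (l <= k + J))%N then alpha / 2 * (P k + Q l) else 0)
    + (if (l + J < k)%N then Delta * P k * ((2 ^ l)%:R / (2 ^ k)%:R) else 0)
    + (if (k + J < l)%N then Delta * Q l * ((2 ^ k)%:R / (2 ^ l)%:R) else 0)))).
  apply: le_trans (ler_norm_sum _ _ _) _; apply: ler_sum => k _.
  by apply: le_trans (ler_norm_sum _ _ _) _; apply: ler_sum => l _; exact: pe.
have farb k : \sum_(l < K | (l + J < k)%N) ((2 ^ l)%:R / (2 ^ k)%:R : R) <= 1 / 2 ^+ J.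
  rewrite -mulr_suml ler_pdivrMr ?ltr0n ?expn_gt0 //.
  rewrite mulrC mulrA mulr1 ler_pdivlMr ?exprn_gt0 ?ltr0n //.
  have := sum_far K J k; rewrite -big_distrl /= -(ler_nat R) natrM natr_sum.
  by rewrite [in X in _ * X]natrX.
have nearb k : \sum_(l < K | ((k <= l + J) && (l <= k + J))%N) (1 : R) <= 2 * J%:R + 1.
  by have := sum_near K J k; rewrite -(ler_nat R) natr_sum natrD natrM.
have sP : \sum_(k < K) P k <= \sum_v (m v)%:R ^+ 2 by exact: sum_digit_mass.
have sQ : \sum_(k < K) Q k <= \sum_v (m' v)%:R ^+ 2 by exact: sum_digit_mass.
set nr := alpha * (2 * J%:R + 1) / 2; set fr := Delta / 2 ^+ J.
have nr0 : 0 <= nr by rewrite divr_ge0 // mulr_ge0 // addr_ge0 // mulr_ge0.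
have fr0 : 0 <= fr by rewrite divr_ge0 // exprn_ge0.
under eq_bigr do rewrite !big_split /=.
rewrite !big_split /=.
have t1 : \sum_(k < K) \sum_(l < K) (if ((k <= l + J) && (l <= k + J))%N then alpha / 2 * (P k + Q l) else 0)
   <= nr * (\sum_(k < K) P k + \sum_(k < K) Q k).
  have -> : \sum_(k < K) \sum_(l < K) (if ((k <= l + J) && (l <= k + J))%N then alpha / 2 * (P k + Q l) else 0)
   = \sum_(k < K) alpha / 2 * P k * (\sum_(l < K | ((k <= l + J) && (l <= k + J))%N) 1)
   + \sum_(k < K) alpha / 2 * Q k * (\sum_(l < K | ((k <= l + J) && (l <= k + J))%N) 1).
    under eq_bigr => k _ do rewrite -big_mkcond /=.
    under eq_bigr => k _.
      under eq_bigr => l _ do rewrite mulrDr.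
      rewrite big_split /=; over.
    rewrite big_split /=; congr (_ + _).
      apply: eq_bigr => k _; rewrite mulr_sumr; apply: eq_bigr => l _; by rewrite mulr1.
    rewrite (exchange_big_dep xpredT) //=; apply: eq_bigr => l _.
    rewrite mulr_sumr; apply: eq_big => [k|k _]; first by rewrite andbC.
    by rewrite mulr1.
  rewrite mulrDr !mulr_sumr; apply: lerD; apply: ler_sum => k _.
    rewrite /nr; have -> : alpha * (2 * J%:R + 1) / 2 * P k = alpha / 2 * P k * (2 * J%:R + 1) by ring.
    by rewrite ler_wpM2l // mulr_ge0 // divr_ge0.
  rewrite /nr; have -> : alpha * (2 * J%:R + 1) / 2 * Q k = alpha / 2 * Q k * (2 * J%:R + 1) by ring.
  by rewrite ler_wpM2l // mulr_ge0 // divr_ge0.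
have t2 : \sum_(k < K) \sum_(l < K) (if (l + J < k)%N then Delta * P k * ((2 ^ l)%:R / (2 ^ k)%:R) else 0)
   <= fr * \sum_(k < K) P k.
  rewrite mulr_sumr; apply: ler_sum => k _; rewrite -big_mkcond /= -mulr_sumr.
  have -> : fr * P k = Delta * P k * (1 / 2 ^+ J) by rewrite /fr; ring.
  by rewrite ler_wpM2l // mulr_ge0.
have t3 : \sum_(k < K) \sum_(l < K) (if (k + J < l)%N then Delta * Q l * ((2 ^ k)%:R / (2 ^ l)%:R) else 0)
   <= fr * \sum_(k < K) Q k.
  rewrite exchange_big mulr_sumr; apply: ler_sum => k _; rewrite -big_mkcond /= -mulr_sumr.
  have -> : fr * Q k = Delta * Q k * (1 / 2 ^+ J) by rewrite /fr; ring.
  by rewrite ler_wpM2l // mulr_ge0.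
apply: le_trans (lerD (lerD t1 t2) t3) _.
have := ler_wpM2l nr0 (lerD sP sQ).
have := ler_wpM2l fr0 (lerD sP sQ).
lin.
Qed.

(** Rounding to multiples of [1 / q] with [q] large reduces to integer vectors. *)
Lemma bilinear_ge0 J f g : (forall v, 0 <= f v) -> (forall v, 0 <= g v) ->
  `|dot f (app E g)|
    <= (alpha * (2 * J%:R + 1) / 2 + Delta / 2 ^+ J) * (dot f f + dot g g).
Proof.
move=> f0 g0; set th := (_ + _ / _).
apply/ler_addgt0Pr => e e0.
have bilE x y : dot x (app E y) = \sum_u \sum_v x u * E u v * y v.
  apply: eq_bigr => u _; rewrite /app mulr_sumr.
  by apply: eq_bigr => v _; rewrite mulrA.
pose W := \sum_u \sum_v `|E u v| * (f u + g v).
have W0 : 0 <= W.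
  by apply: sumr_ge0 => u _; apply: sumr_ge0 => v _; rewrite mulr_ge0 // addr_ge0.
pose q := (Num.truncn (W / e)).+1.
have q0 : 0 < q%:R :> R by rewrite ltr0n.
have qn : q%:R != 0 :> R by exact: lt0r_neq0.
have qW : W / q%:R <= e.
  rewrite ler_pdivrMr // mulrC -ler_pdivrMr // ltW //.
  exact: truncnS_gt.
pose r (x : I -> R) v := Num.truncn (q%:R * x v).
pose d (x : I -> R) v : R := (r x v)%:R / q%:R.
have dle x v : 0 <= x v -> 0 <= d x v <= x v /\ x v - d x v <= q%:R^-1.
  move=> x0; have x1 : 0 <= q%:R * x v by rewrite mulr_ge0.
  have /andP[h1 h2] := truncn_itv x1; rewrite -/(r x v) in h1 h2.
  rewrite /d divr_ge0 //= ler_pdivrMr // mulrC h1; split => //.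
  have -> : x v - (r x v)%:R / q%:R = (q%:R * x v - (r x v)%:R) / q%:R by field.
  rewrite ler_pdivrMr // mulVf //; move: h2; rewrite -natr1; lin.
have h1 : `|dot (d f) (app E (d g))| <= th * (dot f f + dot g g).
  have := bilinear_nat J (r f) (r g); rewrite -/th bilE => h.
  have -> : \sum_u \sum_v d f u * E u v * d g v
     = q%:R ^- 2 * \sum_u \sum_v (r f u)%:R * E u v * (r g v)%:R.
    rewrite mulr_sumr; apply: eq_bigr => u _; rewrite mulr_sumr.
    by apply: eq_bigr => v _; rewrite /d; field.
  rewrite normrM gtr0_norm ?invr_gt0 ?exprn_gt0 //.
  apply: (@le_trans _ _ (q%:R ^- 2 * (th * (\sum_v (r f v)%:R ^+ 2 + \sum_v (r g v)%:R ^+ 2)))).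
    by rewrite ler_wpM2l // invr_ge0 exprn_ge0.
  rewrite mulrCA ler_wpM2l //.
    rewrite /th addr_ge0 // divr_ge0 ?exprn_ge0 ?ler0n //.
    by rewrite mulr_ge0 // addr_ge0 // mulr_ge0.
  have sq x : (forall v, 0 <= x v) -> q%:R ^- 2 * \sum_v (r x v)%:R ^+ 2 <= dot x x.
    move=> x0; rewrite mulr_sumr; apply: ler_sum => v _.
    have [/andP[d0 dx] _] := dle x v (x0 v).
    have -> : q%:R ^- 2 * (r x v)%:R ^+ 2 = d x v * d x v by rewrite /d; field.
    by apply: ler_pM.
  by rewrite mulrDr lerD // sq.
have h2 : `|dot f (app E g) - dot (d f) (app E (d g))| <= e.
  apply: le_trans qW; rewrite !bilE -sumrB /W mulr_suml.
  apply: le_trans (ler_norm_sum _ _ _) _; apply: ler_sum => u _.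
  rewrite -sumrB mulr_suml; apply: le_trans (ler_norm_sum _ _ _) _.
  apply: ler_sum => v _.
  have -> : f u * E u v * g v - d f u * E u v * d g v
     = E u v * ((f u - d f u) * g v + d f u * (g v - d g v)) by ring.
  rewrite normrM -mulrA ler_wpM2l //.
  have [/andP[a1 a2] a3] := dle f u (f0 u).
  have [/andP[c1 c2] c3] := dle g v (g0 v).
  have -> : (f u + g v) / q%:R = q%:R^-1 * g v + f u * q%:R^-1 by ring.
  rewrite ger0_norm; last by rewrite addr_ge0 // mulr_ge0 // subr_ge0.
  by apply: lerD; [rewrite ler_wpM2r | apply: ler_pM => //; rewrite subr_ge0].
have -> : dot f (app E g) = dot (d f) (app E (d g)) + (dot f (app E g) - dot (d f) (app E (d g))).
  by ring.
by apply: le_trans (ler_normD _ _) _; rewrite lerD.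
Qed.

(** [J] trades the near-diagonal term, which is linear in [J], for the other one,
    which decays geometrically: a discrepancy that is a small fraction of the row
    sums gives an operator norm that is a small fraction of them. *)
Lemma op_norm J f g :
  `|dot f (app E g)|
    <= 4 * (alpha * (2 * J%:R + 1) / 2 + Delta / 2 ^+ J) * (nrm f * nrm g).
Proof.
set th := (_ + _ / _).
pose pos (x : I -> R) v := Num.max (x v) 0.
pose neg (x : I -> R) v := Num.max (- x v) 0.
have pos0 x v : 0 <= pos x v by rewrite le_max lexx orbT.
have neg0 x v : 0 <= neg x v by rewrite le_max lexx orbT.
have dec x v : x v = pos x v - neg x v /\ x v * x v = pos x v * pos x v + neg x v * neg x v.
  rewrite /pos /neg; have [x0|x0] := leP (x v) 0.
    by rewrite max_l ?oppr_ge0 //; split; ring.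
  by rewrite max_r ?oppr_le0 ?ltW //; split; ring.
have sq x : dot x x = dot (pos x) (pos x) + dot (neg x) (neg x).
  by rewrite /dot -big_split; apply: eq_bigr => v _; rewrite (proj2 (dec x v)).
have gen x y : `|dot x (app E y)| <= 2 * th * (dot x x + dot y y).
  have -> : dot x (app E y) = dot (pos x) (app E (pos y)) - dot (pos x) (app E (neg y))
     - dot (neg x) (app E (pos y)) + dot (neg x) (app E (neg y)).
    have -> : dot x (app E y) = dot (fun v => pos x v - neg x v) (fun v => app E (pos y) v - app E (neg y) v).
      apply: eq_dot => v; first by have [] := dec x v.
      by rewrite -appB; apply: eq_bigr => z _; have [->] := dec y z.
    by rewrite dotBl !dotBr; ring.
  have b1 := bilinear_ge0 J (pos0 x) (pos0 y).
  have b2 := bilinear_ge0 J (pos0 x) (neg0 y).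
  have b3 := bilinear_ge0 J (neg0 x) (pos0 y).
  have b4 := bilinear_ge0 J (neg0 x) (neg0 y).
  rewrite -/th in b1 b2 b3 b4.
  apply: le_trans (ler_normD _ _) _.
  have n1 := ler_normB (dot (pos x) (app E (pos y)) - dot (pos x) (app E (neg y))) (dot (neg x) (app E (pos y))).
  have n2 := ler_normB (dot (pos x) (app E (pos y))) (dot (pos x) (app E (neg y))).
  rewrite (sq x) (sq y); move: b1 b2 b3 b4 n1 n2; lin.
have [f0|fn] := eqVneq (nrm f) 0.
  rewrite f0 mul0r mulr0 [dot _ _]big1 ?normr0 // => v _.
  by rewrite (nrm_eq0 f0) mul0r.
have [g0|gn] := eqVneq (nrm g) 0.
  rewrite g0 !mulr0 (_ : dot f _ = 0) ?normr0 //.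
  rewrite [LHS]big1 // => v _; rewrite [app _ _ _]big1 ?mulr0 // => z _.
  by rewrite (nrm_eq0 g0) mulr0.
have fp : 0 < nrm f by rewrite lt_neqAle eq_sym fn nrm_ge0.
have gp : 0 < nrm g by rewrite lt_neqAle eq_sym gn nrm_ge0.
have := gen (fun v => (nrm f)^-1 * f v) (fun v => (nrm g)^-1 * g v).
have -> : app E (fun v => (nrm g)^-1 * g v) = fun v => (nrm g)^-1 * app E g v.
  by apply/funext => v; rewrite appZ.
rewrite !dotZl !dotZr -!nrm_sqr => h.
have e1 : (nrm f)^-1 * ((nrm f)^-1 * nrm f ^+ 2) = 1 by field.
have e2 : (nrm g)^-1 * ((nrm g)^-1 * nrm g ^+ 2) = 1 by field.
have n1 : `|(nrm f)^-1| = (nrm f)^-1 by rewrite gtr0_norm ?invr_gt0.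
have n2 : `|(nrm g)^-1| = (nrm g)^-1 by rewrite gtr0_norm ?invr_gt0.
rewrite e1 e2 !normrM n1 n2 in h.
rewrite ler_pdivrMl // ler_pdivrMl // in h.
by apply: le_trans h _; rewrite le_eqVlt; apply/orP; left; apply/eqP; ring.
Qed.
End Digits.

(** * The largest eigenvalue as a maximal Rayleigh quotient *)

Lemma continuous_quadratic (R : realType) m (K : 'I_m -> 'I_m -> R) :
  continuous (fun x : 'rV[R]_m => dot (fun i => x ord0 i) (app K (fun i => x ord0 i))).
Proof.
have c i : continuous (fun x : 'rV[R]_m => x ord0 i) by exact: coord_continuous.
rewrite /dot; apply: continuous_big; first exact: add_continuous.
move=> i _ x; apply: continuousM; first exact: c.
rewrite /app; move: x; apply: continuous_big; first exact: add_continuous.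
by move=> j _ x; apply: continuousM; [exact: cst_continuous|exact: c].
Qed.

(** The maximum of the Rayleigh quotient is attained, and the positive
    semidefinite form that vanishes at a maximizer has the maximizer in its
    kernel. *)
Lemma exists_rayleigh_maximum (R : realType) m (K : 'I_m.+1 -> 'I_m.+1 -> R)
    (d : 'I_m.+1 -> R) :
  (forall i j, K i j = K j i) -> (forall i, 0 < d i) ->
  exists lam (f : 'I_m.+1 -> R), [/\ exists i, f i != 0, eigen_eq K d lam f
    & rayleigh_bound K d lam].
Proof.
move=> Ks d0.
pose D i j := (i == j)%:R * d i : R.
have DE f : dot f (app D f) = dot f (fun i => d i * f i).
  apply: eq_dot => // i; rewrite /app (bigD1 i) //= big1 ?addr0 => [|j ij].
    by rewrite /D eqxx mul1r.
  by rewrite /D eq_sym (negbTE ij) !mul0r.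
have dd f : 0 <= dot f (fun i => d i * f i).
  by apply: sumr_ge0 => i _; rewrite mulrCA mulr_ge0 ?(ltW (d0 _)) // -expr2 sqr_ge0.
have dz f : dot f (fun i => d i * f i) = 0 -> forall i, f i = 0.
  move=> /eqP; rewrite psumr_eq0 => [/allP h i|i _]; last first.
    by rewrite mulrCA mulr_ge0 ?(ltW (d0 _)) // -expr2 sqr_ge0.
  have /= := h i (mem_index_enum i).
  by rewrite !mulf_eq0 (negbTE (lt0r_neq0 (d0 i))) orFb orbb => /eqP.
pose S := [set x : 'rV[R]_m.+1 | dot (fun i => x ord0 i) (app D (fun i => x ord0 i)) = 1]%classic.
have cS : compact S.
  pose M := \sum_i (1 + (d i)^-1).
  have cb : compact [set v : 'rV[R]_m.+1 | forall i, v ord0 i \in `[(- M), M]%R]%classic.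
    apply: (@rV_compact _  _ (fun=> `[(- M), M]%classic)).
    by move=> _; apply: segment_compact.
  apply: subclosed_compact cb _.
    apply: (@closed_comp _ _ _ [set x : R | x = 1]%classic); last exact: closed_eq.
    by move=> x _; exact: continuous_quadratic.
  move=> x; rewrite /S /= DE => x1 i.
  have h1 : d i * x ord0 i ^+ 2 <= 1.
    rewrite -x1 /dot (bigD1 i) //= expr2 mulrCA lerDl.
    by apply: sumr_ge0 => j _; rewrite mulrCA mulr_ge0 ?(ltW (d0 _)) // -expr2 sqr_ge0.
  have h2 : x ord0 i ^+ 2 <= (d i)^-1 by rewrite -div1r ler_pdivlMr // mulrC.
  have h3 : 1 + (d i)^-1 <= M.
    rewrite /M (bigD1 i) //= lerDl; apply: sumr_ge0 => j _.
    by rewrite addr_ge0 // invr_ge0 ltW.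
  rewrite in_itv /= -ler_norml; apply: le_trans h3.
  have di : 0 < (d i)^-1 by rewrite invr_gt0.
  rewrite -(@ler_pXn2r _ 2) ?nnegrE ?addr_ge0 ?(ltW di) //.
  rewrite real_normK ?num_real //; apply: le_trans h2 _.
  have := sqr_ge0 ((d i)^-1); rewrite sqrrD; move: di; lin.
have S0 : (S !=set0)%classic.
  exists (\row_i (if i == ord0 then Num.sqrt (d ord0)^-1 else 0)).
  rewrite /S /= DE /dot (bigD1 ord0) //= big1 => [|i i0]; last first.
    by rewrite !mxE (negbTE i0) !mul0r.
  rewrite !mxE eqxx addr0 mulrCA -expr2 sqr_sqrtr ?invr_ge0 ?ltW //.
  by rewrite divff // lt0r_neq0.
have [x] := @EVT_max_rV _ _ _ S S0 cS
   (continuous_subspaceT (@continuous_quadratic R m.+1 K)).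
rewrite inE /S /= DE => x1 xmax.
pose f i := x ord0 i; pose lam := dot f (app K f).
have ray : rayleigh_bound K d lam.
  move=> g; have [g0|gn] := eqVneq (dot g (fun i => d i * g i)) 0.
    rewrite g0 mulr0 [dot _ _]big1 // => i _.
    by rewrite (dz _ g0) mul0r.
  set s := dot g _ in gn *.
  have s0 : 0 < s by rewrite lt_neqAle eq_sym gn dd.
  pose c := Num.sqrt s; have c0 : 0 < c by rewrite sqrtr_gt0.
  have cc : s = c * c by rewrite -expr2 sqr_sqrtr // ltW.
  have cn : c != 0 by exact: lt0r_neq0.
  have gE : (fun i => (\row_j (c^-1 * g j)) ord0 i) = fun i => c^-1 * g i.
    by apply/funext => i; rewrite mxE.
  have := xmax (\row_j (c^-1 * g j)); rewrite inE /S /= DE gE.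
  have appE (K' : 'I_m.+1 -> 'I_m.+1 -> R) : app K' (fun i => c^-1 * g i) = fun i => c^-1 * app K' g i.
    by apply/funext => i; rewrite appZ.
  rewrite appE !dotZl !dotZr -/lam.
  have -> : dot g (fun i => d i * (\row_j (c^-1 * g j)) ord0 i) = c^-1 * s.
    by rewrite /s -dotZr; apply: eq_bigr => i _; rewrite mxE; ring.
  move=> h; have {h}/h : c^-1 * (c^-1 * s) = 1 by rewrite cc; field.
  rewrite -/f -/lam => h.
  rewrite cc mulrA -!ler_pdivrMr //.
  by apply: le_trans h; rewrite le_eqVlt; apply/orP; left; apply/eqP; field.
exists lam, f; split=> //.
  apply/not_existsP => h; move: x1; rewrite [dot _ _]big1 => [/esym/eqP|i _].
    by rewrite oner_eq0.
  have /negP := h i; rewrite negbK => /eqP; rewrite /f => ->; by rewrite mul0r.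
(* The form q of lam * d - K is nonnegative and vanishes at f; were its gradient r
   at f nonzero, q would be negative at f + s * r for a small negative s. *)
have [r rE] : exists r : 'I_m.+1 -> R, r = fun i => lam * (d i * f i) - app K f i by eexists.
pose q (g : 'I_m.+1 -> R) := lam * dot g (fun i => d i * g i) - dot g (app K g).
have q0 g : 0 <= q g by rewrite subr_ge0; exact: ray.
have qf : q f = 0 by rewrite /q x1 mulr1 subrr.
suff r0 : dot r r = 0.
  by move=> i; have := dotff_eq0 r0 i; rewrite rE => /eqP; rewrite subr_eq0 => /eqP.
have qexp (s : R) : q (fun i => f i + s * r i) = 2 * s * dot r r + s ^+ 2 * q r.
  have e1 : app K (fun i => f i + s * r i) = fun i => app K f i + s * app K r i.
    by apply/funext => i; rewrite -appZ /app -big_split; apply: eq_bigr => j _; rewrite mulrDr.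
  have e2 : (fun i => d i * (f i + s * r i)) = fun i => d i * f i + s * (d i * r i).
    by apply/funext => i; ring.
  rewrite /q e1 e2 !(dotDl, dotDr) !(dotZl, dotZr).
  have e3 : dot f (fun i => d i * r i) = dot r (fun i => d i * f i).
    by apply: eq_bigr => i _; ring.
  have e4 : dot f (app K r) = dot r (app K f).
    by rewrite app_adjoint // dotC.
  have e5 : dot r r = lam * dot r (fun i => d i * f i) - dot r (app K f).
    by rewrite {2}rE dotBr dotZr.
  have := qf; rewrite /q => e6.
  rewrite e3 e4 e5.
  transitivity ((lam * dot f (fun i => d i * f i) - dot f (app K f))
     + 2 * s * (lam * dot r (fun i => d i * f i) - dot r (app K f))
     + s ^+ 2 * (lam * dot r (fun i => d i * r i) - dot r (app K r))); first by ring.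
  by rewrite e6 add0r.
apply/eqP; rewrite eq_le dot_ge0 andbT leNgt; apply/negP => rr.
pose s := - dot r r / (q r + 1).
have qr1 : 0 < q r + 1 by rewrite ltr_wpDl.
have := q0 (fun i => f i + s * r i); rewrite qexp.
have -> : 2 * s * dot r r + s ^+ 2 * q r
   = - (dot r r / (q r + 1)) ^+ 2 * (q r + 2).
  by rewrite /s; field; exact: lt0r_neq0.
rewrite leNgt => /negP; apply.
rewrite mulNr oppr_lt0 mulr_gt0 ?exprn_gt0 ?divr_gt0 // ltr_wpDl //.
Qed.

(** * The random matrix as a product of independent coins *)

Section Coins.
Variables (R : realType) (E : finType) (wt : E -> bool -> R).
Hypothesis wt_ge0 : forall e b, 0 <= wt e b.
Hypothesis wt_sum : forall e, \sum_b wt e b = 1.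
Implicit Types (Z : {ffun E -> bool} -> R) (S : {set E}).

Definition weight (om : {ffun E -> bool}) : R := \prod_e wt e (om e).
Definition coin_mean Z : R := \sum_om weight om * Z om.

Lemma weight_ge0 om : 0 <= weight om.
Proof. exact: prodr_ge0. Qed.

Lemma coin_mean_prod (phi : E -> bool -> R) :
  coin_mean (fun om => \prod_e phi e (om e)) = \prod_e \sum_b wt e b * phi e b.
Proof.
rewrite bigA_distr_bigA; apply: eq_bigr => om _.
by rewrite /weight -big_split.
Qed.

Lemma sum_weight : \sum_om weight om = 1.
Proof.
transitivity (coin_mean (fun om => \prod_(e : E) (1 : R))).
  by apply: eq_bigr => om _; rewrite big1 ?mulr1.
rewrite (coin_mean_prod (fun _ _ => 1)) big1 // => e _.
by rewrite -[RHS](wt_sum e); apply: eq_bigr => b _; rewrite mulr1.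
Qed.

Definition mix S (om tau : {ffun E -> bool}) : {ffun E -> bool} :=
  [ffun e => if e \in S then tau e else om e].

Lemma mixK S : involutive (fun x : {ffun E -> bool} * {ffun E -> bool} =>
  (mix S x.1 x.2, mix S x.2 x.1)).
Proof.
by move=> [om tau]; congr (_, _); apply/ffunP => e; rewrite !ffunE /=; case: ifP => // ->.
Qed.

Lemma weight_mix S om tau :
  weight (mix S om tau) * weight (mix S tau om) = weight om * weight tau.
Proof.
rewrite /weight -!big_split; apply: eq_bigr => e _; rewrite !ffunE.
by case: ifP => // _; rewrite /= mulrC.
Qed.

(** Tossing the coins of [S] again does not change the law. *)
Lemma coin_mean_resample S Z :
  coin_mean Z = \sum_om weight om * coin_mean (fun tau => Z (mix S om tau)).
Proof.
have -> : \sum_om weight om * coin_mean (fun tau => Z (mix S om tau))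
   = \sum_(x : {ffun E -> bool} * {ffun E -> bool}) weight x.1 * weight x.2 * Z (mix S x.1 x.2).
  rewrite -(pair_bigA _ (fun om tau => weight om * weight tau * Z (mix S om tau))) /=.
  by apply: eq_bigr => om _; rewrite mulr_sumr; apply: eq_bigr => tau _; rewrite mulrA.
rewrite (reindex_inj (inv_inj (@mixK S))) /=.
have -> : \sum_(x : {ffun E -> bool} * {ffun E -> bool})
     weight (mix S x.1 x.2) * weight (mix S x.2 x.1)
       * Z (mix S (mix S x.1 x.2) (mix S x.2 x.1))
   = \sum_(x : {ffun E -> bool} * {ffun E -> bool}) weight x.1 * weight x.2 * Z x.1.
  apply: eq_bigr => -[om tau] _ /=; rewrite weight_mix.
  by have /(congr1 fst) /= -> := mixK S (om, tau).
rewrite -(pair_bigA _ (fun om tau => weight om * weight tau * Z om)) /=.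
apply: eq_bigr => om _; rewrite -[LHS]mulr1 -sum_weight mulr_sumr.
by apply: eq_bigr => tau _; ring.
Qed.

(** Conditionally on the coins outside [S], the coins of [S] are independent. *)
Lemma coin_mean_conditional S (phi : {ffun E -> bool} -> E -> bool -> R) (B : R) :
  (forall om tau, phi (mix S om tau) = phi om) ->
  (forall om e b, e \notin S -> phi om e b = 1) ->
  (forall om, \prod_(e in S) \sum_b wt e b * phi om e b <= B) ->
  coin_mean (fun om => \prod_e phi om e (om e)) <= B.
Proof.
move=> phiS phi1 phiB; rewrite (coin_mean_resample S).
apply: (@le_trans _ _ (\sum_om weight om * B)); last first.
  by rewrite -mulr_suml sum_weight mul1r.
apply: ler_sum => om _; rewrite ler_wpM2l ?weight_ge0 //.
apply: le_trans (phiB om); rewrite le_eqVlt; apply/orP; left; apply/eqP.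
transitivity (coin_mean (fun tau => \prod_e phi om e (tau e))).
  apply: eq_bigr => tau _; congr (_ * _); apply: eq_bigr => e _.
  rewrite phiS ffunE; case: ifPn => // eS; by rewrite !phi1.
rewrite coin_mean_prod [RHS]big_mkcond; apply: eq_bigr => e _.
case: ifPn => // eS; rewrite -[RHS](wt_sum e).
by apply: eq_bigr => b _; rewrite phi1 // mulr1.
Qed.

End Coins.

Section RandomMatrix.
Variables (R : realType) (n : nat) (p q : R) (sigma : 'I_n -> int).
Hypotheses (p01 : 0 <= p <= 1) (q01 : 0 <= q <= 1).
Implicit Types (A : 'M[bool]_n) (u v : 'I_n) (om : {ffun 'I_n * 'I_n -> bool}).
Local Notation mean := (plsbm_expectation p q sigma).

Definition edge_prob u v : R := if sigma u == sigma v then p else q.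

Lemma edge_prob01 u v : 0 <= edge_prob u v <= 1.
Proof. by rewrite /edge_prob; case: ifP. Qed.

Lemma edge_probC u v : edge_prob u v = edge_prob v u.
Proof. by rewrite /edge_prob eq_sym. Qed.

(** Deterministic coins below the diagonal make the coin tosses of positive weight
    correspond to the symmetric matrices. *)
Definition coin (e : 'I_n * 'I_n) (b : bool) : R :=
  if (e.1 <= e.2)%N then (if b then edge_prob e.1 e.2 else 1 - edge_prob e.1 e.2)
  else (~~ b)%:R.

Lemma coin_ge0 e b : 0 <= coin e b.
Proof.
rewrite /coin; case: ifP => // _; have /andP[h0 h1] := edge_prob01 e.1 e.2.
by case: b => //; rewrite subr_ge0.
Qed.

Lemma coin_sum e : \sum_b coin e b = 1.
Proof.
rewrite big_bool /coin; case: ifP => _; last by rewrite /= add0r.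
by rewrite /= subrKC.
Qed.

Definition edge u v : 'I_n * 'I_n := if (u <= v)%N then (u, v) else (v, u).
Definition sym_mx om : 'M[bool]_n := \matrix_(u, v) om (edge u v).
Definition upper A : {ffun 'I_n * 'I_n -> bool} :=
  [ffun e : 'I_n * 'I_n => (e.1 <= e.2)%N && A e.1 e.2].

Lemma edgeC u v : edge u v = edge v u.
Proof.
rewrite /edge; case: leqP => uv; case: leqP => vu //.
  by have -> : u = v by apply/val_inj/eqP; rewrite eqn_leq uv vu.
by have := ltn_trans uv vu; rewrite ltnn.
Qed.

Lemma edge_le u v : ((edge u v).1 <= (edge u v).2)%N.
Proof. by rewrite /edge; case: (leqP u v) => // /ltnW. Qed.

Lemma sym_mx_tr om : (sym_mx om)^T = sym_mx om.
Proof. by apply/matrixP => u v; rewrite !mxE edgeC. Qed.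

Lemma sym_upper A : A = A^T -> sym_mx (upper A) = A.
Proof.
move=> As; apply/matrixP => u v; rewrite !mxE !ffunE edge_le /edge.
by case: ifP => //= _; rewrite [in LHS]As mxE.
Qed.

Lemma mean_coins f : mean f = coin_mean coin (fun om => f (sym_mx om)).
Proof.
pose low om := [forall e : 'I_n * 'I_n, (e.1 <= e.2)%N || ~~ om e].
have w0 om : ~~ low om -> weight coin om = 0.
  rewrite negb_forall => /existsP[e]; rewrite negb_or negbK => /andP[e12 ome].
  by rewrite /weight (bigD1 e) //= /coin (negbTE e12) ome mul0r.
rewrite /coin_mean (bigID low) /= [X in _ + X]big1 ?addr0; last first.
  by move=> om /w0 ->; rewrite mul0r.
rewrite /plsbm_expectation (bigID (fun A => A == A^T)) /= [X in _ + X]big1 ?addr0; last first.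
  by move=> A /negbTE As; rewrite /plsbm_pmf As mul0r.
rewrite (reindex_onto sym_mx upper); last by move=> A /eqP /sym_upper.
apply: eq_big => [om|om].
  rewrite sym_mx_tr eqxx /=; apply/eqP/forallP => [<- e|lo].
    by rewrite ffunE; case: (_ <= _)%N.
  apply/ffunP => -[u v]; rewrite ffunE mxE /=; have := lo (u, v) => /=.
  by rewrite /edge; case: leqP => //= _ /negbTE.
move=> /andP[_ /eqP omE]; congr (_ * _).
rewrite /plsbm_pmf sym_mx_tr eqxx pair_big_dep /= /weight.
rewrite [RHS](bigID (fun e : 'I_n * 'I_n => (e.1 <= e.2)%N)) /= [X in _ * X]big1 ?mulr1.
  apply: eq_bigr => -[u v] /= uv; rewrite /coin /= uv mxE /edge uv /edge_prob.
  by rewrite /bernoulli_pmf.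
move=> [u v] /= uv; rewrite /coin /= (negbTE uv).
by have := congr1 (fun g : {ffun 'I_n * 'I_n -> bool} => g (u, v)) omE; rewrite ffunE /= (negbTE uv) => <-.
Qed.

End RandomMatrix.

Lemma expR_taylor2 (R : realType) (t : R) : expR t - 1 - t <= t ^+ 2 * expR `|t|.
Proof.
have h1 : expR t - 1 <= t * expR t.
  have := expR_ge1Dx (- t); rewrite -(ler_pM2l (expR_gt0 t)) expRxMexpNx_1; lin.
have h2 := expR_ge1Dx t.
have [t0|t0] := leP 0 t.
  rewrite ger0_norm //; have := ler_wpM2l t0 h1; move: h1; rewrite expr2; lin.
have e1 : 1 <= expR `|t| by rewrite -expR0 ler_expR.
have h3 : t * (expR t - 1) <= t * t by rewrite ler_nM2l //; move: h2; lin.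
have := ler_wpM2l (sqr_ge0 t) e1; move: h1 h3; rewrite expr2; lin.
Qed.

Section Moments.
Variables (R : realType) (n : nat) (p q : R) (sigma : 'I_n -> int).
Hypotheses (p01 : 0 <= p <= 1) (q01 : 0 <= q <= 1).
Implicit Types (A : 'M[bool]_n) (u v : 'I_n) (om : {ffun 'I_n * 'I_n -> bool}).
Local Notation mean := (plsbm_expectation p q sigma).
Local Notation edge_prob := (edge_prob p q sigma).
Local Notation coin := (coin p q sigma).

Lemma pmf_ge0 A : 0 <= plsbm_pmf p q sigma A.
Proof.
rewrite /plsbm_pmf; case: ifP => // _; apply: prodr_ge0 => u _.
by apply: prodr_ge0 => v _; apply: bernoulli_pmf_ge0; case: ifP.
Qed.

Lemma ler_mean f g : (forall A, A = A^T -> f A <= g A) -> mean f <= mean g.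
Proof.
move=> fg; apply: ler_sum => A _.
have [/eqP As|As] := boolP (A == A^T); first by rewrite ler_wpM2l ?pmf_ge0 ?fg.
by rewrite /plsbm_pmf (negbTE As) !mul0r.
Qed.

Lemma meanD f g : mean (fun A => f A + g A) = mean f + mean g.
Proof. by rewrite -big_split; apply: eq_bigr => A _; rewrite mulrDr. Qed.

Lemma meanZ (c : R) f : mean (fun A => c * f A) = c * mean f.
Proof. by rewrite [RHS]mulr_sumr; apply: eq_bigr => A _; rewrite mulrCA. Qed.

Lemma mean_sum (J : finType) (P : pred J) (f : J -> 'M[bool]_n -> R) :
  mean (fun A => \sum_(j | P j) f j A) = \sum_(j | P j) mean (f j).
Proof.
by rewrite exchange_big /=; apply: eq_bigr => A _; rewrite mulr_sumr.
Qed.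

Definition isolate u A : 'M[bool]_n :=
  \matrix_(v, w) [&& A v w, v != u & w != u].

Definition touching u : {set 'I_n * 'I_n} := [set e | (e.1 == u) || (e.2 == u)].
Definition other u (e : 'I_n * 'I_n) : 'I_n := if e.1 == u then e.2 else e.1.

Lemma prod_touching u (F : 'I_n * 'I_n -> R) :
  \prod_(e in touching u | (e.1 <= e.2)%N) F e = \prod_v F (edge u v).
Proof.
rewrite (reindex_onto (edge u) (other u)) => [|[x y]]; last first.
  rewrite !inE /= /other /= => /andP[]; case: eqVneq => [-> _ uy|xu /= /eqP -> xu'].
    by rewrite /edge uy.
  by rewrite edgeC /edge xu'.
apply: eq_bigl => v; rewrite edge_le andbT !inE /edge /other.
by case: leqP => uv /=; rewrite ?eqxx ?orbT //=; case: (eqVneq v u) => [->|_]; rewrite eqxx.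
Qed.

(** Conditionally on the rest of the matrix, the row of [u] is made of
    independent coins: the coefficients of a linear form in that row may be
    chosen from the matrix in which [u] is isolated. *)
Lemma row_mgf u (x : 'M[bool]_n -> 'I_n -> R) (B : R) :
  (forall A, expR (\sum_v edge_prob u v * (expR (x A v) - 1)) <= B) ->
  mean (fun A => expR (\sum_v x (isolate u A) v * (A u v)%:R)) <= B.
Proof.
move=> xB; rewrite mean_coins //.
pose phi om (e : 'I_n * 'I_n) (b : bool) : R :=
  if (e \in touching u) && (e.1 <= e.2)%N
  then expR (x (isolate u (sym_mx om)) (other u e) * b%:R) else 1.
have oe v : other u (edge u v) = v.
  rewrite /other /edge; case: leqP => _ /=; rewrite ?eqxx //.
  by case: eqVneq.
have te v : edge u v \in touching u.
  by rewrite inE /edge; case: leqP => _ /=; rewrite eqxx ?orbT.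
have -> : coin_mean coin (fun om => expR (\sum_v x (isolate u (sym_mx om)) v * (sym_mx om u v)%:R))
  = coin_mean coin (fun om => \prod_e phi om e (om e)).
  apply: eq_bigr => om _; congr (_ * _).
  rewrite expR_sum (bigID (fun e : 'I_n * 'I_n => (e \in touching u) && (e.1 <= e.2)%N)) /=.
  rewrite [X in _ = _ * X]big1 ?mulr1; last by move=> e /negbTE h; rewrite /phi h.
  rewrite prod_touching; apply: eq_bigr => v _.
  by rewrite /phi te edge_le /= oe mxE.
apply: (@coin_mean_conditional R _ coin _ _ (touching u) phi B).
- exact: coin_ge0.
- exact: coin_sum.
- move=> om tau; rewrite /phi; have -> : isolate u (sym_mx (mix (touching u) om tau)) = isolate u (sym_mx om).
    apply/matrixP => v w; rewrite !mxE ffunE.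
    have [->|vu] := eqVneq v u; first by rewrite !andbF.
    have [->|wu] := eqVneq w u; first by rewrite !andbF.
    rewrite ifN // inE negb_or /edge.
    by case: leqP => _ /=; rewrite ?vu ?wu.
  by [].
- by move=> om e b eS; rewrite /phi (negbTE eS).
move=> om; apply: le_trans (xB (isolate u (sym_mx om))).
rewrite (bigID (fun e : 'I_n * 'I_n => (e.1 <= e.2)%N)) /= [X in _ * X]big1 ?mulr1; last first.
  move=> e /andP[_ e12]; rewrite -[RHS](coin_sum p q sigma e).
  by apply: eq_bigr => b _; rewrite /phi (negbTE e12) andbF mulr1.
rewrite prod_touching expR_sum; apply: ler_prod => v _.
rewrite big_bool /phi te edge_le /= oe /coin edge_le mulr1 mulr0 expR0 mulr1.
have -> : edge_prob (edge u v).1 (edge u v).2 = edge_prob u v.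
  by rewrite /edge; case: leqP => //= _; rewrite edge_probC.
have /andP[h0 h1] := edge_prob01 sigma p01 q01 u v.
set pr := edge_prob u v in h0 h1 *; set y := x _ v.
apply/andP; split.
  by rewrite addr_ge0 ?subr_ge0 // mulr_ge0 // expR_ge0.
have -> : pr * expR y + (1 - pr) = 1 + pr * (expR y - 1) by ring.
exact: expR_ge1Dx.
Qed.

Lemma sum_pairs (F : 'I_n -> 'I_n -> R) :
  \sum_u \sum_v F u v = \sum_(e : 'I_n * 'I_n | (e.1 <= e.2)%N)
     (F e.1 e.2 + (e.1 != e.2)%:R * F e.2 e.1).
Proof.
rewrite pair_big /= (bigID (fun e : 'I_n * 'I_n => (e.1 <= e.2)%N)) /= big_split /=.
congr (_ + _).
rewrite (reindex_inj (h := fun e : 'I_n * 'I_n => (e.2, e.1))) /=; last first.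
  by move=> [a b] [c d] /= [-> ->].
rewrite big_mkcond [RHS]big_mkcond; apply: eq_bigr => -[u v] _ /=.
rewrite -ltnNge ltn_neqAle; case: (u <= v)%N; rewrite ?andbF // andbT.
have -> : (u != v :> nat) = (u != v) by [].
by case: (u != v); rewrite ?mul1r ?mul0r.
Qed.

Definition centered A u v : R := (A u v)%:R - edge_prob u v.

(** An edge inside the intersection of [S] and [T] is counted twice, whence the
    factors 2. *)
Lemma between_mgf (S T : {set 'I_n}) (s pmax : R) :
  (forall u v, edge_prob u v <= pmax) ->
  mean (fun A => expR (s * between (centered A) S T))
    <= expR (2 * s ^+ 2 * expR (2 * `|s|) * pmax * (#|S|%:R * #|T|%:R)).
Proof.
move=> pm.
pose c u v : R := (u \in S)%:R * (v \in T)%:R.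
pose C (e : 'I_n * 'I_n) := c e.1 e.2 + (e.1 != e.2)%:R * c e.2 e.1.
have betE F : between F S T = \sum_u \sum_v c u v * F u v.
  rewrite /between [LHS]big_mkcond; apply: eq_bigr => u _; rewrite /c.
  case: (u \in S); last by rewrite big1 // => v _; rewrite !mul0r.
  rewrite big_mkcond; apply: eq_bigr => v _.
  by case: (v \in T); rewrite ?mulr1 ?mul1r ?mulr0 ?mul0r.
have CS : \sum_(e : 'I_n * 'I_n | (e.1 <= e.2)%N) C e = #|S|%:R * #|T|%:R.
  rewrite -sum_pairs -!sum1_card !natr_sum mulr_suml [RHS]big_mkcond.
  apply: eq_bigr => u _; rewrite /c; case: (u \in S); last first.
    by rewrite big1 // => v _; rewrite mul0r.
  rewrite mulr_sumr [RHS]big_mkcond; apply: eq_bigr => v _.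
  by case: (v \in T); rewrite ?mulr1 ?mulr0.
have CE A : A = A^T -> between (centered A) S T
   = \sum_(e : 'I_n * 'I_n | (e.1 <= e.2)%N) C e * centered A e.1 e.2.
  move=> As; rewrite betE sum_pairs; apply: eq_bigr => e _.
  have -> : centered A e.2 e.1 = centered A e.1 e.2.
    by rewrite /centered edge_probC {1}As mxE.
  by rewrite /C; ring.
pose phi (e : 'I_n * 'I_n) (b : bool) : R :=
  if (e.1 <= e.2)%N then expR (s * C e * (b%:R - edge_prob e.1 e.2)) else 1.
rewrite mean_coins //.
have -> : coin_mean coin (fun om => expR (s * between (centered (sym_mx om)) S T))
   = coin_mean coin (fun om => \prod_e phi e (om e)).
  apply: eq_bigr => om _; congr (_ * _).
  rewrite CE ?sym_mx_tr // mulr_sumr expR_sum.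
  rewrite [RHS](bigID (fun e : 'I_n * 'I_n => (e.1 <= e.2)%N)) /=.
  rewrite [X in _ = _ * X]big1 ?mulr1; last by move=> e /negbTE h; rewrite /phi h.
  apply: eq_bigr => -[u v] /= uv.
  by rewrite /phi /= uv /centered mxE /edge uv mulrA.
rewrite coin_mean_prod (bigID (fun e : 'I_n * 'I_n => (e.1 <= e.2)%N)) /=.
rewrite [X in _ * X]big1 ?mulr1; last first.
  move=> e /negbTE h; rewrite -[RHS](coin_sum p q sigma e).
  by apply: eq_bigr => b _; rewrite /phi h mulr1.
rewrite -CS mulr_sumr expR_sum; apply: ler_prod => -[u v] /= uv.
rewrite big_bool /phi /coin /= uv.
have /andP[h0 h1] := edge_prob01 sigma p01 q01 u v.
have prm := pm u v.
set pr := edge_prob u v in h0 h1 prm *; set Ce := C (u, v).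
apply/andP; split.
  by rewrite addr_ge0 // mulr_ge0 ?expR_ge0 // subr_ge0.
have C0 : [\/ Ce = 0, Ce = 1 | Ce = 2].
  rewrite /Ce /C /c /=; case: (u \in S); case: (v \in T); case: (u != v); case: (v \in S); case: (u \in T);
   rewrite ?mulr1 ?mul1r ?mulr0 ?mul0r ?addr0 ?add0r; by [apply: Or31|apply: Or32|apply: Or33].
have [Cge Cle] : 0 <= Ce /\ Ce <= 2 by case: C0 => ->; split; lra.
have C2 : Ce ^+ 2 <= 2 * Ce by rewrite expr2 ler_wpM2r.
set t := s * Ce.
have -> : pr * expR (t * (1 - pr)) + (1 - pr) * expR (t * (0 - pr))
   = expR (- (t * pr)) * (1 + pr * (expR t - 1)).
  have -> : t * (1 - pr) = - (t * pr) + t by ring.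
  have -> : t * (0 - pr) = - (t * pr) by ring.
  by rewrite expRD; ring.
apply: (@le_trans _ _ (expR (- (t * pr)) * expR (pr * (expR t - 1)))).
  by rewrite ler_wpM2l ?expR_ge0 // expR_ge1Dx.
rewrite -expRD ler_expR.
have -> : - (t * pr) + pr * (expR t - 1) = pr * (expR t - 1 - t) by ring.
have t1 : expR `|t| <= expR (2 * `|s|).
  by rewrite ler_expR /t normrM mulrC ler_wpM2r // ger0_norm.
have t2 : t ^+ 2 <= 2 * s ^+ 2 * Ce.
  have -> : 2 * s ^+ 2 * Ce = s ^+ 2 * (2 * Ce) by ring.
  by rewrite /t exprMn ler_wpM2l ?sqr_ge0.
apply: (@le_trans _ _ (pr * (2 * s ^+ 2 * Ce * expR (2 * `|s|)))).
  rewrite ler_wpM2l //; apply: le_trans (expR_taylor2 t) _.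
  by apply: ler_pM; rewrite ?sqr_ge0 ?expR_ge0.
have -> : 2 * s ^+ 2 * expR (2 * `|s|) * pmax * Ce = pmax * (2 * s ^+ 2 * Ce * expR (2 * `|s|)) by ring.
by rewrite ler_wpM2r // mulr_ge0 ?expR_ge0 // mulr_ge0 // mulr_ge0 ?sqr_ge0.
Qed.

End Moments.

(** * Tail bounds *)

Section Tails.
Variables (R : realType) (n : nat) (a b : R) (sigma : 'I_n -> int).
Let N : R := n%:R.
Let L : R := ln N.
Hypotheses (n1 : (1 < n)%N) (b0 : 0 < b) (ab : b <= a) (aLN : a * L / N <= 1).
Hypothesis sigma_sign : forall v, sigma v = 1 \/ sigma v = -1.
Hypothesis balanced : forall i : int, i = 1 \/ i = -1 ->
  #|community sigma i|%:R = N / 2.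
Let p := a * L / N.
Let q := b * L / N.
Implicit Types (A : 'M[bool]_n) (P : pred 'M[bool]_n).
Local Notation mean := (plsbm_expectation p q sigma).
Local Notation edge_prob := (edge_prob p q sigma).

Lemma N_gt0 : 0 < N. Proof. by rewrite ltr0n ltnW. Qed.
Lemma L_gt0 : 0 < L. Proof. by rewrite ln_gt0 // ltr1n. Qed.
Lemma a_gt0 : 0 < a. Proof. exact: lt_le_trans ab. Qed.

Lemma p01 : 0 <= p <= 1.
Proof. by rewrite aLN andbT divr_ge0 ?mulr_ge0 ?(ltW N_gt0) ?(ltW L_gt0) ?(ltW a_gt0). Qed.

Lemma q_le_p : q <= p.
Proof. by rewrite ler_wpM2r ?invr_ge0 ?(ltW N_gt0) // ler_wpM2r ?(ltW L_gt0). Qed.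

Lemma q01 : 0 <= q <= 1.
Proof.
rewrite (le_trans q_le_p) // andbT.
by rewrite divr_ge0 ?mulr_ge0 ?(ltW N_gt0) ?(ltW L_gt0) ?(ltW b0).
Qed.

Lemma edge_prob_le_p u v : edge_prob u v <= p.
Proof. by rewrite /edge_prob; case: ifP => // _; exact: q_le_p. Qed.

Definition prob P : R := mean (fun A => (P A)%:R).

Lemma prob_le_mean_exp P (X : 'M[bool]_n -> R) :
  (forall A, A = A^T -> P A -> 0 <= X A) -> prob P <= mean (fun A => expR (X A)).
Proof.
move=> PX; apply: ler_mean; [exact: p01|exact: q01|move=> A As].
case: (boolP (P A)) => [PA|_]; last exact: expR_ge0.
by rewrite -expR0 ler_expR; exact: PX.
Qed.

Lemma sum_edge_prob u (y z : R) :
  \sum_v edge_prob u v * (if sigma u == sigma v then y else z)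
    = L * (a * y + b * z) / 2.
Proof.
have card i : i = 1 \/ i = -1 -> \sum_(v | sigma v == i) (1 : R) = N / 2.
  move=> h; rewrite -(balanced h) -sum1_card natr_sum.
  by apply: eq_bigl => v; rewrite inE.
have su := sigma_sign u.
have su' : - sigma u = 1 \/ - sigma u = -1.
  by case: su => ->; [right|left; rewrite opprK].
have N0 : N != 0 by rewrite lt0r_neq0 // N_gt0.
rewrite (bigID (fun v => sigma v == sigma u)) /=.
have -> : \sum_(v | sigma v == sigma u) edge_prob u v * (if sigma u == sigma v then y else z)
   = p * y * (N / 2).
  rewrite -(card _ su) mulr_sumr; apply: eq_bigr => v /eqP vu.
  by rewrite /edge_prob vu eqxx mulr1.
have -> : \sum_(v | sigma v != sigma u) edge_prob u v * (if sigma u == sigma v then y else z)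
   = q * z * (N / 2).
  rewrite -(card _ su') mulr_sumr; apply: eq_big => v.
    have := sigma_sign u; have := sigma_sign v.
    by move=> [-> | ->] [-> | ->].
  by rewrite eq_sym => /negbTE vu; rewrite /edge_prob vu mulr1.
by rewrite /p /q; field.
Qed.

Lemma degree_tail u (t y : R) :
  prob (fun A => t * (y * L) <= t * degree R A u)
    <= expR (L * ((a + b) / 2 * (expR t - 1) - t * y)).
Proof.
apply: le_trans (@prob_le_mean_exp _ (fun A => t * degree R A u - t * (y * L)) _) _.
  by move=> A _; rewrite subr_ge0.
have -> : mean (fun A => expR (t * degree R A u - t * (y * L)))
   = expR (- (t * (y * L))) * mean (fun A => expR (\sum_v t * (A u v)%:R)).
  rewrite -meanZ; apply: eq_bigr => A _; congr (_ * _).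
  by rewrite -expRD addrC -mulr_sumr.
have -> : L * ((a + b) / 2 * (expR t - 1) - t * y)
   = - (t * (y * L)) + L * ((a + b) / 2 * (expR t - 1)) by ring.
rewrite expRD ler_wpM2l ?expR_ge0 //.
apply: (row_mgf p01 q01 (x := fun _ _ => t)) => A; rewrite ler_expR.
have := sum_edge_prob u (expR t - 1) (expR t - 1).
under eq_bigr do rewrite if_same.
by move=> ->; rewrite le_eqVlt; apply/orP; left; apply/eqP; ring.
Qed.

(** The exponent is optimal at [expR t = sqrt a / sqrt b]. *)
Lemma majority_tail u (eta : R) :
  prob (fun A => \sum_v (if sigma u == sigma v then 1 else -1) * (A u v)%:R <= eta * L)
    <= expR (L * (ln (Num.sqrt a / Num.sqrt b) * eta
                  - (Num.sqrt a - Num.sqrt b) ^+ 2 / 2)).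
Proof.
set sa := Num.sqrt a; set sb := Num.sqrt b.
have sa0 : 0 < sa by rewrite sqrtr_gt0 a_gt0.
have sb0 : 0 < sb by rewrite sqrtr_gt0.
have saa : a = sa ^+ 2 by rewrite sqr_sqrtr // ltW // a_gt0.
have sbb : b = sb ^+ 2 by rewrite sqr_sqrtr // ltW.
set t := ln (sa / sb).
have et : expR t = sa / sb by rewrite lnK // posrE divr_gt0.
have t0 : 0 <= t by rewrite ln_ge0 // ler_pdivlMr // mul1r ler_wsqrtr.
pose X A := t * (eta * L) + \sum_v (if sigma u == sigma v then - t else t) * (A u v)%:R.
apply: le_trans (@prob_le_mean_exp _ X _) _.
  move=> A _; set s := \sum_v _ => h.
  have -> : X A = t * (eta * L - s).
    rewrite /X mulrBr; congr (_ + _); rewrite /s mulr_sumr -sumrN.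
    by apply: eq_bigr => v _; case: ifP => _; ring.
  by rewrite mulr_ge0 // subr_ge0.
have -> : mean (fun A => expR (X A))
   = expR (t * (eta * L)) * mean (fun A => expR (\sum_v (if sigma u == sigma v then - t else t) * (A u v)%:R)).
  by rewrite -meanZ; apply: eq_bigr => A _; rewrite /X expRD.
have -> : L * (t * eta - (sa - sb) ^+ 2 / 2) = t * (eta * L) + L * (- ((sa - sb) ^+ 2 / 2)) by ring.
rewrite expRD ler_wpM2l ?expR_ge0 //.
apply: (row_mgf p01 q01 (x := fun _ v => if sigma u == sigma v then - t else t)) => A.
rewrite ler_expR.
have := sum_edge_prob u (expR (- t) - 1) (expR t - 1).
have -> : \sum_v edge_prob u v * (if sigma u == sigma v then expR (- t) - 1 else expR t - 1)
  = \sum_v edge_prob u v * (expR (if sigma u == sigma v then - t else t) - 1).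
  by apply: eq_bigr => v _; case: ifP.
move=> ->; rewrite expRN et saa sbb le_eqVlt; apply/orP; left; apply/eqP; field.
by rewrite !lt0r_neq0.
Qed.

(** The logarithm of the moment generating function is of order [kap * ln n] for
    every fixed [theta]: a large [theta] and then a small [kap] make the probability
    an arbitrarily high power of [1 / n]. *)
Lemma row_tail u (x : 'M[bool]_n -> 'I_n -> R) (eta kap theta : R) :
  0 <= theta -> (forall A v, 0 <= x A v <= 1) ->
  (forall A, \sum_v x A v <= kap * N) ->
  prob (fun A => eta * L < \sum_v x (isolate u A) v * (A u v)%:R)
    <= expR (L * (a * kap * theta * expR theta - theta * eta)).
Proof.
move=> th0 x01 xk.
pose X A := - (theta * (eta * L)) + \sum_v (theta * x (isolate u A) v) * (A u v)%:R.
apply: le_trans (@prob_le_mean_exp _ X _) _.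
  move=> A _ h; have -> : X A = theta * (\sum_v x (isolate u A) v * (A u v)%:R - eta * L).
    rewrite /X mulrBr addrC; congr (_ - _); rewrite mulr_sumr.
    by apply: eq_bigr => v _; rewrite mulrA.
  by rewrite mulr_ge0 // subr_ge0 ltW.
have -> : mean (fun A => expR (X A))
   = expR (- (theta * (eta * L))) * mean (fun A => expR (\sum_v (theta * x (isolate u A) v) * (A u v)%:R)).
  by rewrite -meanZ; apply: eq_bigr => A _; rewrite /X expRD.
have -> : L * (a * kap * theta * expR theta - theta * eta)
   = - (theta * (eta * L)) + L * (a * kap * theta * expR theta) by ring.
rewrite expRD ler_wpM2l ?expR_ge0 //.
apply: (row_mgf p01 q01 (x := fun A v => theta * x A v)) => A; rewrite ler_expR.
have N0 : N != 0 by rewrite lt0r_neq0 // N_gt0.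
have -> : L * (a * kap * theta * expR theta) = p * (theta * expR theta * (kap * N)).
  by rewrite /p; field.
have te0 : 0 <= theta * expR theta by rewrite mulr_ge0 ?expR_ge0.
have /andP[p0 _] := p01.
apply: (@le_trans _ _ (p * (theta * expR theta * \sum_v x A v))); last first.
  by rewrite ler_wpM2l // ler_wpM2l.
rewrite !mulr_sumr; apply: ler_sum => v _.
have /andP[e0 _] := edge_prob01 sigma p01 q01 u v.
have /andP[x0 x1] := x01 A v.
have tx : theta * x A v <= theta by rewrite ler_piMr.
apply: ler_pM => //.
- by rewrite subr_ge0 -expR0 ler_expR mulr_ge0.
- exact: edge_prob_le_p.
have h1 := expR_ge1Dx (- (theta * x A v)).
have h2 : expR (theta * x A v) - 1 <= theta * x A v * expR (theta * x A v).
  by move: h1; rewrite -(ler_pM2l (expR_gt0 (theta * x A v))) expRxMexpNx_1; lin.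
apply: le_trans h2 _.
have -> : theta * expR theta * x A v = theta * x A v * expR theta by ring.
by rewrite ler_wpM2l ?ler_expR // mulr_ge0.
Qed.

Lemma discrepancy_tail (S T : {set 'I_n}) (eps theta : R) : 0 <= theta ->
  prob (fun A => eps * L * Num.sqrt (#|S|%:R * #|T|%:R) < `|between (centered p q sigma A) S T|)
    <= 2 * expR (L * (2 * theta ^+ 2 * expR (2 * theta) * a * (#|S|%:R * #|T|%:R / N)
                  - theta * eps * Num.sqrt (#|S|%:R * #|T|%:R))).
Proof.
move=> th0; set r := Num.sqrt _; set B := expR _.
have one s : `|s| = theta ->
   mean (fun A => expR (- (theta * (eps * L * r)) + s * between (centered p q sigma A) S T)) <= B.
  move=> sth.
  have -> : mean (fun A => expR (- (theta * (eps * L * r)) + s * between (centered p q sigma A) S T))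
    = expR (- (theta * (eps * L * r))) * mean (fun A => expR (s * between (centered p q sigma A) S T)).
    by rewrite -meanZ; apply: eq_bigr => A _; rewrite expRD.
  apply: (@le_trans _ _ (expR (- (theta * (eps * L * r))) *
     expR (2 * s ^+ 2 * expR (2 * `|s|) * p * (#|S|%:R * #|T|%:R)))).
    rewrite ler_wpM2l ?expR_ge0 //; apply: between_mgf; [exact: p01|exact: q01|exact: edge_prob_le_p].
  have s2 : s ^+ 2 = theta ^+ 2 by rewrite -sth real_normK ?num_real.
  rewrite -expRD ler_expR s2 sth le_eqVlt; apply/orP; left; apply/eqP; rewrite /p; field.
  by rewrite lt0r_neq0 // N_gt0.
have -> : 2 * B = B + B by ring.
apply: le_trans (lerD (one theta (ger0_norm th0)) (one (- theta) _)); last first.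
  by rewrite normrN ger0_norm.
rewrite -meanD; apply: ler_mean; [exact: p01|exact: q01|move=> A _].
case: (ltP (eps * L * r) `|between (centered p q sigma A) S T|) => h; last first.
  by rewrite addr_ge0 ?expR_ge0.
set Y := between _ S T in h *.
have [Y0|Y0] := leP 0 Y.
  rewrite (ger0_norm Y0) in h; apply: (@le_trans _ _ (expR (- (theta * (eps * L * r)) + theta * Y))); last by rewrite lerDl expR_ge0.
  by rewrite -expR0 ler_expR addrC -mulrBr mulr_ge0 // subr_ge0 ltW.
rewrite (ltr0_norm Y0) in h; apply: (@le_trans _ _ (expR (- (theta * (eps * L * r)) + - theta * Y))); last by rewrite lerDr expR_ge0.
rewrite -expR0 ler_expR addrC mulNr -mulrN -mulrBr mulr_ge0 // subr_ge0 ltW //.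
Qed.

End Tails.

(** * The discrepancy event *)

Lemma ln_large (R : realType) (M : R) :
  exists n0 : nat, forall n, (n0 <= n)%N -> M <= ln (n%:R : R).
Proof.
exists (Num.truncn (expR M)).+1 => n nn0.
have h : expR M <= n%:R.
  by apply: ltW; apply: lt_le_trans (truncnS_gt _) _; rewrite ler_nat.
by rewrite -(expRK M) ler_ln ?posrE ?expR_gt0 // (lt_le_trans (expR_gt0 M)).
Qed.

Lemma sum_subsets (R : realType) (I : finType) (z : R) :
  \sum_(S : {set I}) z ^+ #|S| = (1 + z) ^+ #|I|.
Proof.
have -> : (1 + z) ^+ #|I| = \prod_(i : I) (z + 1) by rewrite prodr_const addrC.
rewrite bigA_distr; apply: eq_big => // S _.
by rewrite -big_mkcond prodr_const.
Qed.

Section Union.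
Variables (R : realType) (n : nat) (a b : R) (sigma : 'I_n -> int).
Local Notation L := (ln (n%:R : R)).
Hypotheses (n1 : (1 < n)%N) (b0 : 0 < b) (ab : b <= a) (aLN : a * L / n%:R <= 1).
Local Notation prob := (prob a b sigma).

Lemma prob_union (J : finType) (P : J -> pred 'M[bool]_n) :
  prob (fun A => [exists j, P j A]) <= \sum_j prob (P j).
Proof.
rewrite -mean_sum; apply: ler_mean; [exact: (p01 n1 b0 ab aLN)|exact: (q01 n1 b0 ab aLN)|move=> A _].
case: existsP => [[j Pj]|_]; last by apply: sumr_ge0.
by rewrite (bigD1 j) //= Pj lerDl sumr_ge0.
Qed.

Lemma prob_or (P Q : pred 'M[bool]_n) :
  prob (fun A => P A || Q A) <= prob P + prob Q.
Proof.
rewrite -meanD; apply: ler_mean; [exact: (p01 n1 b0 ab aLN)|exact: (q01 n1 b0 ab aLN)|move=> A _].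
by case: (P A); case: (Q A) => /=; lra.
Qed.

Lemma ler_prob (P Q : pred 'M[bool]_n) :
  (forall A, A = A^T -> P A -> Q A) -> prob P <= prob Q.
Proof.
move=> PQ; apply: ler_mean; [exact: (p01 n1 b0 ab aLN)|exact: (q01 n1 b0 ab aLN)|move=> A As].
by case: (boolP (P A)) => [/(PQ _ As) ->|_].
Qed.

Definition discrepant (K eps : R) (A : 'M[bool]_n) : bool :=
  [exists S : {set 'I_n}, [exists T : {set 'I_n},
    [&& #|S|%:R <= K ^+ 2 * #|T|%:R, #|T|%:R <= K ^+ 2 * #|S|%:R
      & eps * L * Num.sqrt (#|S|%:R * #|T|%:R)
        < `|between (centered (a * L / n%:R) (b * L / n%:R) sigma A) S T|]]].

End Union.

(** Union bound over pairs of comparable sizes. Small pairs are beaten by a large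
    exponential parameter [th0], since their expected number of edges is a small
    fraction of [ln n] times the geometric mean of the sizes; the [4 ^ n] large
    pairs by a small parameter [th1], the exponent being of order [n * ln n]. *)
Lemma prob_discrepant (R : realType) (a b K eps : R) :
  0 < b -> b <= a -> 1 <= K -> 0 < eps ->
  exists2 n0 : nat, (1 < n0)%N & forall n (sigma : 'I_n -> int), (n0 <= n)%N ->
    a * ln (n%:R : R) / n%:R <= 1 ->
    prob a b sigma (discrepant a b sigma K eps)
      <= 2 * (expR 2 + 1) * expR (- (3 * ln (n%:R : R))).
Proof.
move=> b0 ab K1 eps0; have a0 : 0 < a by exact: lt_le_trans ab.
have K0 : 0 < K by exact: lt_le_trans K1.
(* In th0 * eps = 1 + 8 * K the 1 absorbs the quadratic term, and 8 * K yields 4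
   times the sum of the sizes, each of which is at most K * r. *)
have [th0 th0E] : exists x : R, x = (1 + 8 * K) / eps by eexists.
have th00 : 0 < th0 by rewrite th0E divr_gt0 // addr_gt0 ?mulr_gt0 ?ltr0n.
have [r0 r0E] : exists x : R, x = 2 * th0 ^+ 2 * expR (2 * th0) * a by eexists.
have r00 : 0 < r0 by rewrite r0E !mulr_gt0 ?exprn_gt0 ?expR_gt0 ?ltr0n.
have [th1 th10 th1E] : exists2 x : R, 0 < x & 2 * x ^+ 2 * expR (2 * x) * a <= x * eps / 2.
  pose x := Num.min 2^-1 (eps / (4 * a * expR 1)).
  have x0 : 0 < x by rewrite lt_min invr_gt0 ltr0n divr_gt0 ?mulr_gt0 ?expR_gt0 ?ltr0n.
  exists x => //.
  have x1 : x <= 2^-1 by rewrite ge_min lexx.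
  have x2 : x * (4 * a * expR 1) <= eps.
    by rewrite -ler_pdivlMr ?mulr_gt0 ?expR_gt0 ?ltr0n // ge_min lexx orbT.
  have e1 : expR (2 * x) <= expR 1 by rewrite ler_expR; lra.
  apply: (@le_trans _ _ (2 * x ^+ 2 * expR 1 * a)).
    by rewrite ler_wpM2r ?(ltW a0) // ler_wpM2l // mulr_ge0 ?ler0n ?sqr_ge0.
  have := ler_wpM2l (ltW x0) x2; rewrite expr2; lin.
have [c cE] : exists x : R, x = th1 * eps / (2 * r0) by eexists.
have c0 : 0 < c by rewrite cE divr_gt0 ?mulr_gt0 ?ltr0n.
have [n0 n0P] := ln_large (5 / c).
exists (maxn 2 n0) => [|n sigma]; first exact: leq_maxl.
rewrite geq_max => /andP[n2 nn0] aLN.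
set L := ln (n%:R : R).
have L0 : 0 < L by rewrite ln_gt0 // ltr1n.
have N0 : 0 < n%:R :> R by rewrite ltr0n ltnW.
have LN : L <= n%:R by apply: ltW; exact: ln_sublinear.
have cL : 5 <= c * L by rewrite mulrC -ler_pdivrMr //; exact: n0P.
pose W (S T : {set 'I_n}) : R := 2 * expR (- (3 * L)) *
   (expR (- L) ^+ #|S| * expR (- L) ^+ #|T| + expR (- (2 * n%:R))).
have pair (S T : {set 'I_n}) : prob a b sigma (fun A => [&& #|S|%:R <= K ^+ 2 * #|T|%:R, #|T|%:R <= K ^+ 2 * #|S|%:R
      & eps * L * Num.sqrt (#|S|%:R * #|T|%:R)
        < `|between (centered (a * L / n%:R) (b * L / n%:R) sigma A) S T|]) <= W S T.
  have W0 : 0 <= W S T.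
    by rewrite /W !(mulr_ge0, addr_ge0, exprn_ge0, expR_ge0, ler0n).
  have prob0 (P : pred 'M[bool]_n) : P =1 xpred0 -> prob a b sigma P <= W S T.
    by move=> P0; rewrite /prob /plsbm_expectation big1 => [//|A _]; rewrite P0 mulr0.
  set s := #|S|%N; set t := #|T|%N.
  have [st|] := boolP (((s%:R : R) <= K ^+ 2 * t%:R) && ((t%:R : R) <= K ^+ 2 * s%:R)); last first.
    by move=> /negbTE h; apply: prob0 => A; rewrite andbA h.
  have [/andP[/eqP s0 /eqP t0]|st0] := boolP ((s == 0) && (t == 0))%N.
    apply: prob0 => A; rewrite s0 t0 !mulr0n !mulr0 sqrtr0 mulr0.
    have -> : S = finset.set0 by exact: cards0_eq.
    by rewrite /between big_set0 normr0; apply/negbTE; rewrite !negb_and -!leNgt lexx !orbT.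
  apply: (@le_trans _ _ (prob a b sigma (fun A => eps * L * Num.sqrt (s%:R * t%:R)
        < `|between (centered (a * L / n%:R) (b * L / n%:R) sigma A) S T|))).
    by apply: (ler_prob sigma n2 b0 ab aLN) => A _ /and3P[].
  set r := Num.sqrt (s%:R * t%:R).
  have r2 : s%:R * t%:R = r ^+ 2 by rewrite sqr_sqrtr // mulr_ge0.
  have rge0 : 0 <= r by exact: sqrtr_ge0.
  have /andP[st1 st2] := st.
  have sr : s%:R <= K * r.
    rewrite -(@ler_pXn2r _ 2) ?nnegrE ?mulr_ge0 ?(ltW K0) // exprMn -r2 expr2.
    by rewrite mulrCA ler_wpM2l.
  have tr : t%:R <= K * r.
    rewrite -(@ler_pXn2r _ 2) ?nnegrE ?mulr_ge0 ?(ltW K0) // exprMn -r2 expr2.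
    by rewrite mulrA ler_wpM2r.
  have rn : r <= n%:R.
    rewrite -(@ler_pXn2r _ 2) ?nnegrE ?(ltW N0) // -r2 expr2.
    by apply: ler_pM => //; rewrite ler_nat -[leqRHS]card_ord max_card.
  have st1' : 1 <= s%:R + t%:R :> R.
    rewrite -natrD ler1n; move: st0; case: (s) => [|s'] //; case: (t) => [|t'] //.
  have [small|large] := leP (r * r0) n%:R.
    have := discrepancy_tail sigma n2 b0 ab aLN S T eps (ltW th00).
    rewrite -/s -/t -/r -/L r2 => /le_trans; apply.
    rewrite /W -[leRHS]mulrA ler_wpM2l //.
    apply: (@le_trans _ _ (expR (- (3 * L)) * (expR (- L) ^+ s * expR (- L) ^+ t))); last first.
      by rewrite ler_wpM2l ?expR_ge0 // lerDl expR_ge0.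
    rewrite -!expRM_natl -!expRD ler_expR -r0E.
    have h1 : r0 * (r ^+ 2 / n%:R) <= r.
      rewrite mulrA ler_pdivrMr // (_ : r0 * r ^+ 2 = r * (r * r0)); last by ring.
      by rewrite ler_wpM2l.
    have h2 : r0 * (r ^+ 2 / n%:R) - th0 * eps * r <= - (8 * K * r).
      have -> : th0 * eps = 1 + 8 * K by rewrite th0E divfK // lt0r_neq0.
      by move: h1; lin.
    have h3 : r0 * (r ^+ 2 / n%:R) - th0 * eps * r <= - (4 * (s%:R + t%:R)).
      by move: h2 sr tr; lin.
    apply: le_trans (ler_wpM2l (ltW L0) h3) _.
    have := ler_wpM2l (ltW L0) st1'; lin.
  have := discrepancy_tail sigma n2 b0 ab aLN S T eps (ltW th10).
  rewrite -/s -/t -/r -/L r2 => /le_trans; apply.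
    rewrite /W -[leRHS]mulrA ler_wpM2l //.
  apply: (@le_trans _ _ (expR (- (3 * L)) * expR (- (2 * n%:R)))); last first.
    by rewrite ler_wpM2l ?expR_ge0 // lerDr mulr_ge0 ?exprn_ge0 ?expR_ge0.
  rewrite -expRD ler_expR.
  have h1 : 2 * th1 ^+ 2 * expR (2 * th1) * a * (r ^+ 2 / n%:R) <= th1 * eps / 2 * r.
    apply: ler_pM => //.
    - by rewrite !mulr_ge0 ?sqr_ge0 ?expR_ge0 ?(ltW a0) // ltW.
    - by rewrite divr_ge0 ?sqr_ge0 ?(ltW N0).
    - by rewrite ler_pdivrMr // expr2 ler_wpM2l.
  have h2 : c * n%:R <= th1 * eps / 2 * r.
    have -> : c * n%:R = th1 * eps / 2 * (n%:R / r0) by rewrite cE; field; rewrite lt0r_neq0.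
    rewrite ler_wpM2l ?divr_ge0 ?mulr_ge0 ?(ltW th10) ?(ltW eps0) //.
    by rewrite ler_pdivrMr // ltW.
  have h3 : L * (2 * th1 ^+ 2 * expR (2 * th1) * a * (r ^+ 2 / n%:R) - th1 * eps * r)
     <= L * (- (c * n%:R)).
    by rewrite ler_wpM2l ?(ltW L0) //; move: h1 h2; lin.
  apply: le_trans h3 _.
  have h4 : 5 * n%:R <= c * L * n%:R by rewrite ler_wpM2r // ltW.
  by move: h4 LN; lin.
apply: (@le_trans _ _ (\sum_(S : {set 'I_n}) \sum_(T : {set 'I_n}) W S T)).
  apply: (le_trans (prob_union sigma n2 b0 ab aLN _)).
  apply: ler_sum => S _.
  apply: (le_trans (prob_union sigma n2 b0 ab aLN _)).
  by apply: ler_sum => T _; exact: pair.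
have sumE : \sum_(S : {set 'I_n}) \sum_(T : {set 'I_n}) W S T
   = 2 * expR (- (3 * L)) * ((1 + expR (- L)) ^+ n * (1 + expR (- L)) ^+ n
        + (2 ^+ n) * (2 ^+ n) * expR (- (2 * n%:R))).
  under eq_bigr do rewrite -mulr_sumr big_split /=.
  rewrite -mulr_sumr big_split /=; congr (_ * (_ + _)).
    have -> : (1 + expR (- L)) ^+ n = \sum_(S : {set 'I_n}) expR (- L) ^+ #|S|.
      by rewrite sum_subsets card_ord.
    by rewrite mulr_suml; apply: eq_bigr => S _; rewrite mulr_sumr.
  have -> : (2 : R) ^+ n = \sum_(S : {set 'I_n}) 1 ^+ #|S|.
    by rewrite sum_subsets card_ord.
  rewrite mulr_suml mulr_suml; apply: eq_bigr => S _.
  rewrite mulr_sumr mulr_suml; apply: eq_bigr => T _.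
  by rewrite !expr1n !mul1r.
rewrite sumE.
have -> : 2 * (expR 2 + 1) * expR (- (3 * L)) = 2 * expR (- (3 * L)) * (expR 2 + 1) by ring.
rewrite ler_wpM2l ?mulr_ge0 ?expR_ge0 //; apply: lerD.
  have h : (1 + expR (- L)) ^+ n <= expR 1.
    apply: (@le_trans _ _ (expR (expR (- L)) ^+ n)).
      by apply: lerXn2r; rewrite ?nnegrE ?expR_ge0 ?addr_ge0 ?expR_ge0 ?expR_ge1Dx.
    by rewrite -expRM_natl expRN lnK ?posrE // divff // lt0r_neq0.
  have -> : 2 = 1 + 1 :> R by ring.
  rewrite expRD; apply: ler_pM => //; by rewrite exprn_ge0 // addr_ge0 ?expR_ge0.
have -> : - (2 * n%:R) = n%:R * (-1) + n%:R * (-1) :> R by ring.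
rewrite expRD expRM_natl mulrACA -!exprMn.
have h : 2 * expR (-1) <= 1 :> R.
  by rewrite expRN ler_pdivrMr ?expR_gt0 // mul1r; have := expR_ge1Dx (1 : R); lra.
have h0 : 0 <= 2 * expR (-1) :> R by rewrite mulr_ge0 ?expR_ge0.
by apply: exprn_ile1; [exact: mulr_ge0|exact: mulr_ile1].
Qed.

Lemma pow2_large (R : realType) (x : R) : exists J : nat, x <= 2 ^+ J.
Proof.
exists (Num.truncn x).+1; apply: ltW; apply: lt_le_trans (truncnS_gt _) _.
by rewrite -natrX ler_nat ltnW // ltn_expl.
Qed.

(** Outside the discrepancy event the centered matrix is small in operator norm;
    pairs of sets of very different sizes are controlled by the row sums. *)
Lemma op_norm_centered (R : realType) (a b D eps : R) : 0 < D -> 0 < eps ->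
  exists K eps1 : R, [/\ 1 <= K, 0 < eps1 &
  forall n (sigma : 'I_n -> int) (A : 'M[bool]_n),
    let L := ln (n%:R : R) in
    let E := centered (a * L / n%:R) (b * L / n%:R) sigma A in
    0 <= L -> A = A^T -> (forall u, \sum_v `|E u v| <= D * L) ->
    ~~ discrepant a b sigma K eps1 A ->
    forall f g, `|dot f (app E g)| <= eps * L * (nrm f * nrm g)].
Proof.
move=> D0 eps0.
have [J JP] := pow2_large (8 * D / eps).
pose eps1 := eps / (4 * (2 * J%:R + 1)).
have J0 : 0 < 2 * J%:R + 1 :> R by rewrite ltr_wpDl // mulr_ge0.
have eps10 : 0 < eps1 by rewrite divr_gt0 // mulr_gt0 // ltr0n.
pose K := Num.max 1 (D / eps1).
have K1 : 1 <= K by rewrite le_max lexx.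
have KD : D <= eps1 * K by rewrite mulrC -ler_pdivrMr // le_max lexx orbT.
exists K, eps1; split => // n sigma A L E L0 As rowE nd f g.
have Es u v : E u v = E v u by rewrite /E /centered edge_probC {1}As mxE.
have DL0 : 0 <= D * L by rewrite mulr_ge0 // ltW.
have aL0 : 0 <= eps1 * L by rewrite mulr_ge0 // ltW.
have unbal (s t : R) : 0 <= s -> 0 <= t -> K ^+ 2 * t < s -> D * L * t <= eps1 * L * Num.sqrt (s * t).
  move=> s0 t0 st; have h : K * t <= Num.sqrt (s * t).
    rewrite -[leLHS]ger0_norm ?mulr_ge0 ?(le_trans _ K1) // -sqrtr_sqr ler_wsqrtr //.
    by rewrite exprMn [t ^+ 2]expr2 mulrA ler_wpM2r // ltW.
  apply: (@le_trans _ _ (eps1 * L * (K * t))); last by rewrite ler_wpM2l.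
  have := ler_wpM2r t0 (ler_wpM2r L0 KD); lin.
have disc (S T : {set 'I_n}) : `|between E S T| <= eps1 * L * Num.sqrt (#|S|%:R * #|T|%:R).
  have [st|st] := leP (#|S|%:R : R) (K ^+ 2 * #|T|%:R); last first.
    by apply: le_trans (between_le_r Es rowE S T) _; exact: unbal.
  have [ts|ts] := leP (#|T|%:R : R) (K ^+ 2 * #|S|%:R); last first.
    apply: le_trans (between_le_l rowE S T) _.
    by rewrite (mulrC #|S|%:R); exact: unbal.
  rewrite leNgt; apply/negP => h; move/negP: nd; apply.
  by apply/existsP; exists S; apply/existsP; exists T; rewrite st ts.
apply: le_trans (op_norm aL0 DL0 Es disc rowE J f g) _.
rewrite ler_wpM2r ?mulr_ge0 ?nrm_ge0 //.
have -> : eps1 * L * (2 * J%:R + 1) / 2 = eps * L / 8.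
  by rewrite /eps1; field; exact: lt0r_neq0.
have P0 : 0 < 2 ^+ J :> R by rewrite exprn_gt0.
have h : D * L / 2 ^+ J <= eps * L / 8.
  rewrite ler_pdivrMr //; move: JP; rewrite ler_pdivrMr // => /(ler_wpM2r L0); lin.
by move: h; lin.
Qed.

(** * From the killed walk to a symmetric kernel *)

Section KilledWalk.
Variables (R : realType) (n : nat) (ell : 'I_n -> int) (i : int).
Variables (A : 'M[bool]_n) (L : R) (w : 'I_n -> R).
Hypotheses (As : A = A^T) (L0 : 0 < L) (w0 : forall v, 0 < w v).
Hypothesis wE : forall v z, A v z -> w v = degree R A v / L.

(** A vector [mu] on the kept vertices is a left eigenvector of the walk if and only
    if [mu / w] is an eigenvector of this symmetric kernel relative to the weights
    [w]. The kernel is extended by zero to all vertices. *)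
Definition killed_kernel (u v : 'I_n) : R :=
  ind R (kept ell i) u * ind R (kept ell i) v * (A u v)%:R / L.

Lemma killed_kernel_sym u v : killed_kernel u v = killed_kernel v u.
Proof. by rewrite /killed_kernel {1}As mxE; ring. Qed.

Lemma killed_kernel_ge0 u v : 0 <= killed_kernel u v.
Proof. by rewrite divr_ge0 ?(ltW L0) // mulr_ge0 ?ler0n // mulr_ge0 ?ind_ge0. Qed.

Lemma entry_at_enum (V : {set 'I_n}) (x : 'rV[R]_#|V|) j :
  entry_at x (enum_val j) = x 0 j.
Proof.
rewrite /entry_at (bigD1 j) //= big1 ?addr0 // => l /andP[/eqP h].
by rewrite (enum_val_inj h) eqxx.
Qed.

Lemma entry_at_out (V : {set 'I_n}) (x : 'rV[R]_#|V|) u :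
  u \notin V -> entry_at x u = 0.
Proof.
move=> uV; rewrite /entry_at big1 // => j /eqP h.
by have := enum_valP j; rewrite h (negbTE uV).
Qed.

Lemma sum_enum_val (V : {set 'I_n}) (F : 'I_n -> R) :
  (forall v, v \notin V -> F v = 0) -> \sum_v F v = \sum_(j < #|V|) F (enum_val j).
Proof.
move=> F0; rewrite -(big_enum_val (A := [in V]) F) [RHS]big_mkcond.
by apply: eq_bigr => v _; case: ifPn => // /F0.
Qed.

Lemma walk_mxE v z : walk_mx R A v z = (A v z)%:R / L / w v.
Proof.
rewrite mxE; have [vz|] := boolP (A v z); last by rewrite !mul0r.
have := w0 v; rewrite (wE vz) => d0.
have dn : degree R A v != 0 by apply/eqP => d; rewrite d mul0r ltxx in d0.
by field; rewrite dn lt0r_neq0.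
Qed.

Lemma killed_kernel_out u v : v \notin kept ell i -> killed_kernel u v = 0.
Proof. by move=> /negbTE h; rewrite /killed_kernel /ind h mulr0 !mul0r. Qed.

Lemma killed_kernel_enum (j l : 'I_#|kept ell i|) :
  killed_kernel (enum_val j) (enum_val l) = (A (enum_val j) (enum_val l))%:R / L
  :> R.
Proof. by rewrite /killed_kernel /ind !enum_valP !mul1r. Qed.

Lemma left_eigenvector_eq (mu : 'rV[R]_#|kept ell i|) lam :
  mu *m killed_walk_mx R ell A i = lam *: mu ->
  eigen_eq killed_kernel w lam (fun v => entry_at mu v / w v).
Proof.
move=> e z; have [zV|zV] := boolP (z \in kept ell i); last first.
  rewrite (entry_at_out mu zV) mul0r !mulr0 [app _ _ _]big1 // => v _.
  by rewrite killed_kernel_sym killed_kernel_out // mul0r.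
have -> : z = enum_val (enum_rank_in zV z) by rewrite enum_rankK_in.
set j := enum_rank_in zV z.
have wn v : w v != 0 by exact: lt0r_neq0.
have -> : w (enum_val j) * (entry_at mu (enum_val j) / w (enum_val j)) = mu 0 j.
  by rewrite entry_at_enum; field.
have := congr1 (fun M : 'rV_#|kept ell i| => M 0 j) e; rewrite [RHS]mxE => <-.
rewrite mxE /app (sum_enum_val (V := kept ell i)); last first.
  by move=> v /killed_kernel_out -> ; rewrite mul0r.
apply: eq_bigr => l _; rewrite entry_at_enum mxE walk_mxE.
rewrite killed_kernel_sym killed_kernel_enum; field.
by rewrite wn lt0r_neq0.
Qed.

(** The largest eigenvalue dominates the maximal Rayleigh quotient, which is itself
    an eigenvalue. *)
Lemma principal_killed (mu : 'rV[R]_#|kept ell i|) :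
  principal_left_eigenvector (killed_walk_mx R ell A i) mu ->
  exists2 lam, principal killed_kernel w lam (fun v => entry_at mu v / w v) &
    \sum_v w v * (entry_at mu v / w v) = 1.
Proof.
move=> [lam [_ lmax mue mu0 mu1]]; exists lam; last first.
  rewrite (eq_bigr (entry_at mu)) => [|v _]; last first.
    by rewrite mulrCA divff ?mulr1 // lt0r_neq0.
  rewrite (sum_enum_val (entry_at_out mu)) -mu1; apply: eq_bigr => j _.
  by rewrite entry_at_enum ger0_norm.
have [j0 mj0] : exists j, mu 0 j != 0.
  apply/not_existsP => h; move: mu1; rewrite big1 => [/esym/eqP|j _].
    by rewrite oner_eq0.
  by have /negP := h j; rewrite negbK => /eqP ->; rewrite normr0.
split.
- move=> v; rewrite divr_ge0 ?(ltW (w0 v)) // /entry_at.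
  by apply: sumr_ge0 => j _.
- exists (enum_val j0); rewrite entry_at_enum mulf_neq0 // invr_eq0 lt0r_neq0 //.
- exact: left_eigenvector_eq.
pose K (j l : 'I_#|kept ell i|) := killed_kernel (enum_val j) (enum_val l).
pose d (j : 'I_#|kept ell i|) := w (enum_val j).
have Ks j l : K j l = K l j by exact: killed_kernel_sym.
have d0 j : 0 < d j by exact: w0.
have [lam' [f [[j1 fj1] fe fr]]] : exists lam' (f : 'I_#|kept ell i| -> R),
   [/\ exists j, f j != 0, eigen_eq K d lam' f & rayleigh_bound K d lam'].
  move: K d Ks d0; clear -j0; case: #|kept ell i| j0 => [[]//|m _].
  by move=> K d Ks d0; exact: exists_rayleigh_maximum.
have lam'0 : 0 <= lam'.
  have := fr (fun j => (j == j0)%:R).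
  set s := dot _ _; set t := dot _ _ => h.
  have s0 : 0 <= s.
    apply: sumr_ge0 => j _; rewrite mulr_ge0 //; apply: sumr_ge0 => l _.
    by rewrite mulr_ge0 // killed_kernel_ge0.
  have t0 : 0 < t.
    rewrite /t /dot (bigD1 j0) //= eqxx !mulr1 mul1r ltr_wpDr //.
    apply: sumr_ge0 => j _; rewrite mulr_ge0 // mulr_ge0 // ltW //.
  by rewrite -(pmulr_lge0 _ t0); exact: le_trans h.
have lamle : lam' <= lam.
  apply: lmax; apply/eigenvalueP; exists (\row_j (d j * f j)).
    apply/rowP => l; rewrite !mxE -fe /app.
    apply: eq_bigr => j _; rewrite [X in X * _ = _]mxE [X in _ * X = _]mxE walk_mxE Ks /K killed_kernel_enum /d.
    by field; rewrite !lt0r_neq0.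
  apply/eqP => /rowP /(_ j1); rewrite !mxE => /eqP.
  by rewrite mulf_eq0 (negbTE fj1) orbF gt_eqF.
move=> g.
have e1 : dot g (app killed_kernel g) = dot (fun j => g (enum_val j)) (app K (fun j => g (enum_val j))).
  rewrite /dot (sum_enum_val (V := kept ell i)) => [|v vV]; last first.
    rewrite [app _ _ _]big1 ?mulr0 // => z _.
    by rewrite killed_kernel_sym killed_kernel_out // mul0r.
  apply: eq_bigr => j _; congr (_ * _); rewrite /app (sum_enum_val (V := kept ell i)) //.
  by move=> v vV; rewrite killed_kernel_out // mul0r.
rewrite e1; apply: le_trans (fr _) _.
set s := dot _ _.
have s0 : 0 <= s.
  by apply: sumr_ge0 => j _; rewrite mulrCA mulr_ge0 ?(ltW (d0 _)) // -expr2 sqr_ge0.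
apply: (@le_trans _ _ (lam * s)); first by rewrite ler_wpM2r.
rewrite ler_wpM2l ?(le_trans lam'0) //.
rewrite /s /dot -(big_enum_val (A := [in kept ell i]) (fun v => g v * (w v * g v))) [leLHS]big_mkcond.
apply: ler_sum => v _; case: ifP => // _.
by rewrite mulrCA mulr_ge0 ?(ltW (w0 _)) // -expr2 sqr_ge0.
Qed.

End KilledWalk.

(** * The kernels of the model *)

Lemma nrm_ind_mul (R : realType) (I : finType) (S : {set I}) (f : I -> R) :
  nrm (fun v => ind R S v * f v) <= nrm f.
Proof.
rewrite -[leRHS]mul1r; apply: nrm_mul_le => v.
by rewrite ger0_norm ?ind_ge0 ?ind_le1.
Qed.

Section ModelKernels.
Variables (R : realType) (n : nat) (a b delta : R) (sigma ell : 'I_n -> int) (i : int).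
Local Notation L := (ln (n%:R : R)).
Hypotheses (n1 : (1 < n)%N) (adm : admissible sigma ell delta) (i1 : i = 1 \/ i = -1).

Definition own_block : {set 'I_n} := [set v | (sigma v == i) && (ell v == 0)].
Definition other_block : {set 'I_n} := community sigma (- i).

Let Lpos : 0 < L. Proof. by rewrite ln_gt0 // ltr1n. Qed.
Let Ln0 : L != 0. Proof. exact: lt0r_neq0. Qed.
Let npos : 0 < n%:R :> R. Proof. by rewrite ltr0n ltnW. Qed.

Lemma opp_sign : - i = 1 \/ - i = -1.
Proof. by case: i1 => ->; [right|left; rewrite opprK]. Qed.

Lemma sign_neq : (- i == i) = false.
Proof. by case: i1 => ->. Qed.

Lemma blocks_disjoint : [disjoint own_block & other_block].
Proof.
rewrite -setI_eq0; apply/eqP/setP => v; rewrite !inE.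
by have [->|] := eqVneq (sigma v) i; rewrite ?andFb // (eq_sym i) sign_neq andbF.
Qed.

Lemma kept_blocks v : (v \in kept ell i) = (v \in own_block) || (v \in other_block).
Proof.
have [s1 s2 s3 _ _] := adm.
rewrite !inE.
have sg : (sigma v == - i) = ~~ (sigma v == i).
  by case: (s1 v) => ->; case: i1 => ->.
rewrite sg; have [-> /=|v0] := eqVneq (ell v) 0.
  by rewrite andbT orbN; case: i1 => ->.
by rewrite andbF (s3 v v0).
Qed.

Lemma model_block_sizes : block_sizes (1 - delta) own_block other_block.
Proof.
have [s1 s2 s3 s4 s5] := adm.
split; rewrite ?card_ord.
- exact: ltnW.
- exact: blocks_disjoint.
- have sub : revealed ell i \subset community sigma i.
    apply/fintype.subsetP => v; rewrite !inE => /eqP vi.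
    by rewrite -s3 vi // ; case: i1 => ->.
  have -> : own_block = community sigma i :\: revealed ell i.
    apply/setP => v; rewrite !inE; case: eqVneq => [si|]; last by rewrite andbF.
    rewrite andbT /=; have [e0|v0] := eqVneq (ell v) 0; first by rewrite e0; case: i1 => ->.
    by rewrite s3 // si eqxx.
  rewrite cardsD (finset.setIidPr sub) natrB ?subset_leq_card // s4 // s5 //.
  by field.
- by rewrite s4 //; exact: opp_sign.
Qed.

Lemma killed_kernel_mean (A : 'M[bool]_n) u v :
  killed_kernel ell i A L u v - mean_kernel a b own_block other_block u v
   = ind R (kept ell i) u * (ind R (kept ell i) v
       * centered (a * L / n%:R) (b * L / n%:R) sigma A u v) / L.
Proof.
have [s1 _ _ _ _] := adm.
have keptE z : ind R (kept ell i) z = ind R own_block z + ind R other_block z.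
  rewrite /ind kept_blocks; have [zU|zU] := boolP (z \in own_block).
    by rewrite (disjointFr blocks_disjoint zU) addr0.
  by rewrite add0r.
rewrite /killed_kernel /mean_kernel !keptE /centered /edge_prob card_ord.
have nn : n%:R != 0 :> R by exact: lt0r_neq0.
have dUC z : (z \in own_block) && (z \in other_block) = false.
  by case: (boolP (z \in own_block)) => // zU; rewrite (disjointFr blocks_disjoint zU).
have sU z : z \in own_block -> sigma z = i by rewrite inE => /andP[/eqP].
have sC z : z \in other_block -> sigma z = - i by rewrite inE => /eqP.
rewrite /ind.
case: (boolP (u \in own_block)) => uU; case: (boolP (v \in own_block)) => vU;
 case: (boolP (u \in other_block)) => uC; case: (boolP (v \in other_block)) => vC;
 try (by have := dUC u; rewrite uU uC); try (by have := dUC v; rewrite vU vC);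
 rewrite ?(sU _ uU) ?(sU _ vU) ?(sC _ uC) ?(sC _ vC) ?eqxx ?sign_neq ?(eq_sym i) ?sign_neq /=;
 by field; rewrite ?Ln0 ?nn.
Qed.

Section Degrees.
Variables (A : 'M[bool]_n) (eps cmin cmax : R).
Hypotheses (As : A = A^T) (eps0 : 0 < eps) (cmin0 : 0 < cmin).
Hypothesis cmin_mean : cmin <= (a + b) / 2.
Hypothesis cmax_mean : (a + b) / 2 <= cmax.
Hypothesis opA : forall f g,
  `|dot f (app (centered (a * L / n%:R) (b * L / n%:R) sigma A) g)| <= eps * L * (nrm f * nrm g).
Hypothesis degA : forall v, cmin * L <= degree R A v <= cmax * L.
Hypothesis Lbig : 1 <= cmin / 2 * L.
Hypothesis Lbig2 : cmax <= eps ^+ 2 * L.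

Local Notation E := (centered (a * L / n%:R) (b * L / n%:R) sigma A).

Lemma killed_kernel_op f g :
  `|dot f (app (killed_kernel ell i A L) g)
    - dot f (app (mean_kernel a b own_block other_block) g)| <= eps * (nrm f * nrm g).
Proof.
have -> : dot f (app (killed_kernel ell i A L) g)
    - dot f (app (mean_kernel a b own_block other_block) g)
  = L^-1 * dot (fun v => ind R (kept ell i) v * f v) (app E (fun v => ind R (kept ell i) v * g v)).
  rewrite -dotBr -dotZr; apply: eq_bigr => u _.
  have -> : app (killed_kernel ell i A L) g u - app (mean_kernel a b own_block other_block) g u
    = \sum_v (killed_kernel ell i A L u v - mean_kernel a b own_block other_block u v) * g v.
    by rewrite -sumrB; apply: eq_bigr => v _; rewrite mulrBl.
  rewrite /app !mulr_sumr; apply: eq_bigr => v _; rewrite killed_kernel_mean; ring.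
rewrite normrM gtr0_norm ?invr_gt0 // ler_pdivrMl //.
apply: le_trans (opA _ _) _.
have -> : L * (eps * (nrm f * nrm g)) = eps * L * (nrm f * nrm g) by ring.
rewrite ler_wpM2l ?mulr_ge0 ?(ltW eps0) ?(ltW Lpos) //.
by apply: ler_pM; rewrite ?nrm_ge0 ?nrm_ind_mul.
Qed.

Lemma sum_edge_prob_row v : \sum_z edge_prob (a * L / n%:R) (b * L / n%:R) sigma v z = L * (a + b) / 2.
Proof.
have [s1 _ _ s4 _] := adm.
have := sum_edge_prob a b n1 s1 s4 v 1 1.
under eq_bigr do rewrite if_same mulr1.
by rewrite !mulr1.
Qed.

Lemma degree_centered v : degree R A v / L - (a + b) / 2 = app E (fun=> 1) v / L.
Proof.
have -> : app E (fun=> 1) v = degree R A v - L * (a + b) / 2.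
  rewrite -(sum_edge_prob_row v) /degree -sumrB; apply: eq_bigr => z _.
  by rewrite mulr1.
by field.
Qed.

(** The centered degrees are the image of the constant function under the centered
    matrix. *)
Lemma degree_deviation :
  nrm (fun v => degree R A v / L - (a + b) / 2) <= eps * Num.sqrt #|'I_n|%:R.
Proof.
apply: nrm_dual => [|g]; first by rewrite mulr_ge0 ?sqrtr_ge0 // ltW.
have -> : dot g (fun v => degree R A v / L - (a + b) / 2) = L^-1 * dot g (app E (fun=> 1)).
  by rewrite -dotZr; apply: eq_bigr => v _; rewrite degree_centered mulrC [in RHS]mulrC; congr (_ * _); rewrite mulrC.
apply: le_trans (ler_norm _) _; rewrite normrM gtr0_norm ?invr_gt0 // ler_pdivrMl //.
apply: le_trans (opA _ _) _; rewrite le_eqVlt; apply/orP; left; apply/eqP.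
have -> : nrm (fun _ : 'I_n => 1) = Num.sqrt #|'I_n|%:R :> R.
  by rewrite /nrm /dot sumr_const mulr1.
by ring.
Qed.

Lemma concentrated_killed (c2 e2 : R) : c2 <= cmin -> eps <= e2 ->
  concentrated a b c2 cmax e2 own_block other_block
    (killed_kernel ell i A L) (fun v => degree R A v / L).
Proof.
move=> c2c ee; split.
- by move=> u v; exact: killed_kernel_sym.
- move=> f g; apply: le_trans (killed_kernel_op f g) _.
  by rewrite ler_wpM2r // mulr_ge0 ?nrm_ge0.
- move=> v; have /andP[h1 h2] := degA v.
  by rewrite ler_pdivlMr // ler_pdivrMr // h2 andbT (le_trans _ h1) // ler_wpM2r // ltW.
- by apply: le_trans degree_deviation _; rewrite ler_wpM2r // sqrtr_ge0.
Qed.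

Lemma nrm_row u : nrm (fun v => (A u v)%:R / L) <= eps.
Proof.
have h : nrm (fun v => (A u v)%:R / L) ^+ 2 = degree R A u / L ^+ 2.
  rewrite nrm_sqr /dot /degree mulr_suml; apply: eq_bigr => v _.
  by case: (A u v) => /=; field; exact: Ln0.
rewrite -(@ler_pXn2r _ 2) ?nnegrE ?nrm_ge0 ?(ltW eps0) // h.
rewrite ler_pdivrMr ?exprn_gt0 //; have /andP[_ h2] := degA u.
apply: le_trans h2 _; rewrite expr2 mulrA ler_wpM2r // ltW //.
Qed.

Lemma nrm_killed_row u : nrm (killed_kernel ell i A L u) <= eps.
Proof.
apply: le_trans (nrm_row u); apply: ler_nrm => v.
rewrite ger0_norm ?killed_kernel_ge0 // /killed_kernel.
rewrite ler_wpM2r ?invr_ge0 ?(ltW Lpos) // ler_piMl ?ler0n //.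
by rewrite mulr_ile1 ?ind_ge0 ?ind_le1.
Qed.

Lemma sum_killed_row u : \sum_v killed_kernel ell i A L u v <= cmax.
Proof.
have /andP[_ h] := degA u.
apply: (@le_trans _ _ (degree R A u / L)); last by rewrite ler_pdivrMr.
rewrite /degree mulr_suml; apply: ler_sum => v _.
rewrite /killed_kernel ler_wpM2r ?invr_ge0 ?(ltW Lpos) // ler_piMl ?ler0n //.
by rewrite mulr_ile1 ?ind_ge0 ?ind_le1.
Qed.

(** At the isolated vertex [u], whose degree is zero, the mean degree keeps the
    weight in the range of the others; it depends on the isolated matrix only. *)
Definition isolated_weight (u : 'I_n) (A' : 'M[bool]_n) (v : 'I_n) : R :=
  if v == u then (a + b) / 2 else degree R A' v / L.

Lemma isolate_sym u : isolate u A = (isolate u A)^T.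
Proof. by apply/matrixP => v z; rewrite !mxE {1}As mxE; congr andb; rewrite andbC. Qed.

Lemma degree_isolate u v : v != u ->
  degree R (isolate u A) v = degree R A v - (A v u)%:R.
Proof.
move=> vu; rewrite /degree (bigD1 u) //= [in RHS](bigD1 u) //= mxE eqxx !andbF add0r.
rewrite [RHS]addrAC subrr add0r; apply: eq_bigr => z zu.
by rewrite mxE vu zu !andbT.
Qed.

Lemma isolated_weight_ge u v : cmin / 2 <= isolated_weight u (isolate u A) v <= cmax.
Proof.
rewrite /isolated_weight; case: eqVneq => [_|vu].
  by rewrite cmax_mean andbT; apply: le_trans cmin_mean; move: cmin0; move=> *; lra.
rewrite degree_isolate // ler_pdivlMr // ler_pdivrMr //.
have /andP[h1 h2] := degA v.
case: (A v u) => /=; apply/andP; split; move: h1 h2 Lbig; rewrite ?subr0; move=> *; lra.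
Qed.

Lemma isolated_weight_gt0 u v : 0 < isolated_weight u (isolate u A) v.
Proof. by have /andP[h _] := isolated_weight_ge u v; apply: lt_le_trans h; rewrite divr_gt0. Qed.

Lemma isolated_weight_degree u v z : isolate u A v z ->
  isolated_weight u (isolate u A) v = degree R (isolate u A) v / L.
Proof. by rewrite mxE /isolated_weight => /and3P[_ /negbTE ->]. Qed.

Lemma killed_kernel_isolate u v z :
  killed_kernel ell i (isolate u A) L v z
    = (v != u)%:R * (z != u)%:R * killed_kernel ell i A L v z :> R.
Proof.
rewrite /killed_kernel mxE; case: (v != u); case: (z != u);
 rewrite ?andbT ?andbF /=; ring.
Qed.

(** Removing a row costs its Euclidean norm, which is of order [1 / sqrt (ln n)]. *)
Lemma concentrated_isolated u :
  concentrated a b (cmin / 2) cmax (3 * eps) own_block other_block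
    (killed_kernel ell i (isolate u A) L) (isolated_weight u (isolate u A)).
Proof.
split.
- by move=> v z; apply: killed_kernel_sym; exact: isolate_sym.
- move=> f g; pose k := killed_kernel ell i A L.
  pose f' v : R := (v != u)%:R * f v.
  have -> : dot f (app (killed_kernel ell i (isolate u A) L) g)
    = dot f (app k g) - f u * dot (k u) g - g u * dot (k u) f'.
    have -> : dot f (app (killed_kernel ell i (isolate u A) L) g)
       = \sum_v f' v * (app k g v - k v u * g u).
      apply: eq_bigr => v _.
      have -> : app (killed_kernel ell i (isolate u A) L) g v = (v != u)%:R * (app k g v - k v u * g u).
        rewrite /app [in RHS](bigD1 u) //= [X in _ = _ * X]addrAC subrr add0r mulr_sumr.
        rewrite (bigD1 u) //= killed_kernel_isolate eqxx mulr0 !mul0r add0r.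
        by apply: eq_bigr => z zu; rewrite killed_kernel_isolate zu mulr1 mulrA.
      by rewrite /f'; ring.
    have -> : dot f (app k g) - f u * dot (k u) g = \sum_v f' v * app k g v.
      rewrite /dot (bigD1 u) //= [in RHS](bigD1 u) //= /f' eqxx mul0r mul0r add0r.
      rewrite -/(dot (k u) g) [LHS]addrAC subrr add0r; apply: eq_bigr => v vu.
      by rewrite vu mul1r.
    rewrite [g u * _]mulr_sumr -sumrB; apply: eq_bigr => v _.
    rewrite /k (killed_kernel_sym _ _ _ As u v); ring.
  have h1 := killed_kernel_op f g; rewrite -/k in h1.
  have kn := nrm_killed_row u; rewrite -/k in kn.
  have h2 : `|f u * dot (k u) g| <= nrm f * (eps * nrm g).
    rewrite normrM; apply: ler_pM; rewrite ?coord_le_nrm //.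
    by apply: le_trans (cauchy_schwarz _ _) _; rewrite ler_wpM2r ?nrm_ge0.
  have h3 : `|g u * dot (k u) f'| <= nrm g * (eps * nrm f).
    rewrite normrM; apply: ler_pM; rewrite ?coord_le_nrm //.
    apply: le_trans (cauchy_schwarz _ _) _; apply: ler_pM; rewrite ?nrm_ge0 //.
    rewrite -[leRHS]mul1r; apply: nrm_mul_le => v; by case: (v != u); rewrite ?normr1 ?normr0.
  set x := dot f (app k g) in h1 *; set y := dot f (app _ g) in h1 *.
  set s := f u * _ in h2 *; set t := g u * _ in h3 *.
  have -> : x - s - t - y = (x - y) - s - t by ring.
  apply: le_trans (ler_normB _ _) _; have := ler_normB (x - y) s.
  have -> : 3 * eps * (nrm f * nrm g) = eps * (nrm f * nrm g) + nrm f * (eps * nrm g) + nrm g * (eps * nrm f) by ring.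
  move: h1 h2 h3; move=> *; lra.
- by move=> v; exact: isolated_weight_ge.
apply: (@le_trans _ _ (nrm (fun v => `|degree R A v / L - (a + b) / 2| + (A u v)%:R / L))).
  apply: ler_nrm => v; rewrite /isolated_weight; case: eqVneq => [_|vu].
    by rewrite subrr normr0 addr_ge0 // divr_ge0 // ltW.
  have -> : A u v = A v u by rewrite {1}As mxE.
  rewrite degree_isolate //.
  have -> : (degree R A v - (A v u)%:R) / L - (a + b) / 2
     = (degree R A v / L - (a + b) / 2) - (A v u)%:R / L by ring.
  apply: le_trans (ler_normB _ _) _; rewrite lerD2l ger0_norm // divr_ge0 // ltW //.
apply: le_trans (nrmD _ _) _.
have h1 : nrm (fun v => `|degree R A v / L - (a + b) / 2|) <= eps * Num.sqrt #|'I_n|%:R.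
  apply: le_trans degree_deviation; rewrite le_eqVlt; apply/orP; left; apply/eqP.
  by congr Num.sqrt; apply: eq_bigr => v _; rewrite -normrM ger0_norm // -expr2 sqr_ge0.
have h2 := nrm_row u.
have sn : 1 <= Num.sqrt #|'I_n|%:R :> R.
  by rewrite -[X in X <= _]sqrtr1 ler_wsqrtr // card_ord ler1n ltnW.
have := ler_wpM2l (ltW eps0) sn; move: eps0 h1 h2 => p0 h1 h2 h3; lra.
Qed.

Lemma isolates_killed u (mu' : 'rV[R]_#|kept ell i|) : u \in kept ell i ->
  isolates (killed_kernel ell i A L) (fun v => degree R A v / L) u
    (killed_kernel ell i (isolate u A) L) (isolated_weight u (isolate u A))
    (fun v => entry_at mu' v / isolated_weight u (isolate u A) v).
Proof.
move=> uV; split.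
- by move=> z; rewrite killed_kernel_isolate eqxx !mul0r.
- by move=> v z vu zu; rewrite killed_kernel_isolate vu zu !mul1r.
move=> v vu; have [vV|vV] := boolP (v \in kept ell i); last first.
  by rewrite entry_at_out // mul0r !mulr0.
rewrite {1}/isolated_weight (negbTE vu) degree_isolate //.
have -> : degree R A v / L - (degree R A v - (A v u)%:R) / L = (A v u)%:R / L by ring.
rewrite ger0_norm ?divr_ge0 ?(ltW Lpos) // /killed_kernel /ind uV vV !mul1r.
by rewrite {1}As mxE.
Qed.

End Degrees.
End ModelKernels.

Section Rho.
Variables (R : realType) (a b delta : R).
Hypotheses (b0 : 0 < b) (ab : b < a) (d0 : 0 < delta) (d1 : delta < 1).
Local Notation rho := (rho a b delta).

Lemma rho_root : b * rho ^+ 2 = a * delta * rho + (1 - delta) * b.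
Proof.
rewrite /Defs.rho; set s := Num.sqrt _.
have s2 : s ^+ 2 = a ^+ 2 * delta ^+ 2 + 4 * (1 - delta) * b ^+ 2.
  have d1' : 0 <= 1 - delta by rewrite subr_ge0 ltW.
  by rewrite sqr_sqrtr // addr_ge0 // mulr_ge0 ?sqr_ge0 // mulr_ge0.
have bn : b != 0 by exact: lt0r_neq0.
transitivity ((a ^+ 2 * delta ^+ 2 + 2 * a * delta * s + s ^+ 2) / (4 * b)); first by field.
by rewrite s2; field.
Qed.

Lemma rho_gt0 : 0 < rho.
Proof.
rewrite divr_gt0 ?mulr_gt0 ?ltr0n // ltr_wpDr ?sqrtr_ge0 // mulr_gt0 //.
exact: lt_trans ab.
Qed.

Lemma rho_gt1 : 1 < rho.
Proof.
rewrite ltNge; apply/negP => r1.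
have h := rho_root; rewrite expr2 in h.
have r0 := rho_gt0.
have h1 : b * rho - a * delta < b * (1 - delta).
  have : b * rho <= b * 1 by rewrite ler_wpM2l // ltW.
  have : b * delta < a * delta by rewrite ltr_pM2r.
  by move=> *; lra.
have h2 : rho * (b * rho - a * delta) = (1 - delta) * b by move: h; lra.
have b1 : 0 < (1 - delta) * b by rewrite mulr_gt0 // subr_gt0.
have h3 : 0 < b * rho - a * delta by rewrite -(pmulr_rgt0 _ r0) h2.
have : rho * (b * rho - a * delta) <= 1 * (b * rho - a * delta) by rewrite ler_wpM2r // ltW.
by rewrite h2; move: h1; lra.
Qed.

Lemma rho_perron : perron_ratio a b (1 - delta) rho.
Proof.
split=> //; [exact: ltW| |exact: ltW rho_gt1|].
  by rewrite subr_gt0 d1 /= lerBlDr lerDl ltW.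
have := rho_root; rewrite expr2 => h.
have -> : rho * (a * (1 - delta) + b * rho) = rho * a * (1 - delta) + b * (rho * rho) by ring.
by rewrite h; ring.
Qed.

Lemma cbar_gamma : cbar a b delta * gamma a b delta
   = (a * (rho + (1 - delta) ^+ 2) + b * (rho + 1) * (1 - delta)) / 4.
Proof.
rewrite /cbar; have g0 : gamma a b delta != 0.
  rewrite lt0r_neq0 // sqrtr_gt0 divr_gt0 ?ltr0n // addr_gt0 ?subr_gt0 //.
  by rewrite exprn_gt0 // rho_gt0.
by field.
Qed.

End Rho.

Section RowEvent.
Variables (R : realType) (n : nat) (a b delta : R) (sigma ell : 'I_n -> int).
Variable mu : forall i : int, 'M[bool]_n -> 'rV[R]_#|kept ell i|.
Local Notation L := (ln (n%:R : R)).

Definition isolated_deviation (i : int) (u : 'I_n) (A' : 'M[bool]_n) : 'I_n -> R :=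
  deviation (1 - delta) (rho a b delta) (own_block sigma ell i) (other_block sigma i)
    (fun z => entry_at (mu i A') z / isolated_weight a b u A' z).

(** The deviation scaled to [0, 1], and truncated to 0 on the matrices where its
    mean is not small, so that the bounds of the tail estimate hold for every
    matrix. *)
Definition row_coefficient (kap : R) i u A' v : R :=
  if \sum_z isolated_deviation i u A' z <= kap * n%:R
  then ind R (kept ell i) v * (isolated_deviation i u A' v
         / \big[Num.max/1]_z isolated_deviation i u A' z)
  else 0.

(** The coefficients depend on the matrix with [u] isolated only, hence are
    independent of the row of [u]. *)
Definition row_atypical (eta0 kap : R) i u (A : 'M[bool]_n) : bool :=
  eta0 * L < \sum_v row_coefficient kap i u (isolate u A) v * (A u v)%:R.

Lemma row_coefficient01 kap i u A' v : 0 <= row_coefficient kap i u A' v <= 1.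
Proof.
rewrite /row_coefficient; case: ifP => _; last by rewrite lexx ler01.
set M := \big[_/_]_z _; have M1 : 1 <= M by exact: bigmax_ge_id.
have M0 : 0 < M by exact: lt_le_trans M1.
have dM : isolated_deviation i u A' v <= M by exact: le_bigmax.
rewrite mulr_ge0 ?ind_ge0 ?divr_ge0 ?(ltW M0) ?normr_ge0 //=.
rewrite mulr_ile1 ?ind_ge0 ?ind_le1 ?divr_ge0 ?(ltW M0) ?normr_ge0 //.
by rewrite ler_pdivrMr // mul1r.
Qed.

Lemma sum_row_coefficient kap i u A' : 0 <= kap ->
  \sum_v row_coefficient kap i u A' v <= kap * n%:R.
Proof.
move=> k0; rewrite /row_coefficient.
case: (boolP (\sum_z isolated_deviation i u A' z <= kap * n%:R)) => h; last first.
  by rewrite big1 // mulr_ge0.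
apply: le_trans h; apply: ler_sum => v _.
set M := \big[_/_]_z _; have M1 : 1 <= M by exact: bigmax_ge_id.
have M0 : 0 < M by exact: lt_le_trans M1.
have dv : 0 <= isolated_deviation i u A' v by exact: normr_ge0.
apply: (@le_trans _ _ (1 * (isolated_deviation i u A' v / M))).
  by rewrite ler_wpM2r ?ind_le1 // divr_ge0 // ltW.
by rewrite mul1r ler_pdivrMr // ler_peMr.
Qed.

Lemma row_typical eta0 kap i u A : (1 < n)%N -> u \in kept ell i ->
  ~~ row_atypical eta0 kap i u A ->
  row_deviation_small (1 - delta) (rho a b delta) eta0 kap
    (own_block sigma ell i) (other_block sigma i) (killed_kernel ell i A L) u
    (fun z => entry_at (mu i (isolate u A)) z / isolated_weight a b u (isolate u A) z).
Proof.
move=> n1 uV; have L0 : 0 < L by rewrite ln_gt0 // ltr1n.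
rewrite /row_atypical -leNgt => h small.
rewrite card_ord in small; set d := deviation _ _ _ _ _ in small *.
have dE : isolated_deviation i u (isolate u A) = d by [].
set M := \big[_/_]_v _; have M1 : 1 <= M by exact: bigmax_ge_id.
have M0 : 0 < M by exact: lt_le_trans M1.
have -> : app (killed_kernel ell i A L) d u
  = M / L * \sum_v row_coefficient kap i u (isolate u A) v * (A u v)%:R.
  rewrite mulr_sumr; apply: eq_bigr => v _.
  rewrite /row_coefficient dE small -/M /killed_kernel /ind uV [true%:R]/=.
  by field; rewrite !lt0r_neq0.
apply: (@le_trans _ _ (M / L * (eta0 * L))).
  by rewrite ler_wpM2l // divr_ge0 // ltW.
by rewrite le_eqVlt; apply/orP; left; apply/eqP; field; rewrite lt0r_neq0.
Qed.

End RowEvent.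

(** The expansion of the principal eigenvector, for the kernel of the adjacency
    matrix and those of the matrices with one kept vertex isolated. *)
Lemma killed_expansion (R : realType) (a b delta cmin cmax : R) :
  0 < b -> b < a -> 0 < delta -> delta < 1 ->
  0 < cmin -> cmin <= (a + b) / 2 -> (a + b) / 2 <= cmax ->
  forall eta : R, 0 < eta -> exists2 eta0 : R, 0 < eta0 &
  forall kap : R, 0 < kap -> exists eps : R, exists n0 : nat, [/\ 0 < eps, (1 < n0)%N &
  forall n (sigma ell : 'I_n -> int) (mu : forall i : int, 'M[bool]_n -> 'rV[R]_#|kept ell i|)
         (A : 'M[bool]_n) (i : int),
    let L := ln (n%:R : R) in
    (n0 <= n)%N -> admissible sigma ell delta -> principal_choice mu ->
    i = 1 \/ i = -1 -> A = A^T ->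
    (forall f g, `|dot f (app (centered (a * L / n%:R) (b * L / n%:R) sigma A) g)|
       <= eps * L * (nrm f * nrm g)) ->
    (forall v, cmin * L <= degree R A v <= cmax * L) ->
    (forall u, ~~ row_atypical a b delta sigma mu eta0 kap i u A) ->
    forall u, u \in kept ell i ->
      `|cbar a b delta * gamma a b delta * n%:R * entry_at (mu i A) u
        - (\sum_v (A u v)%:R * profile (rho a b delta) (own_block sigma ell i) (other_block sigma i) v) / L|
      <= eta].
Proof.
move=> b0 ab d0 d1 cmin0 cmin_mean cmax_mean eta eta_gt0.
have PR := rho_perron b0 ab d0 d1.
have c20 : 0 < cmin / 2 by rewrite divr_gt0.
have c2c : cmin / 2 <= cmin by move: cmin0; lin.
have c2m : cmin / 2 <= cmax by move: cmin0 cmin_mean cmax_mean; lin.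
have [eta0 eta00 LE] := local_expansion PR c20 c2m eta_gt0.
exists eta0 => // kap kap0; have [eps0 eps00 {}LE] := LE kap kap0.
pose eps := eps0 / 3; have epsp : 0 < eps by rewrite divr_gt0.
have [n1 n1P] := ln_large (2 / cmin); have [n2 n2P] := ln_large (cmax / eps ^+ 2).
exists eps, (maxn 2 (maxn n1 n2)); split => //; first exact: leq_maxl.
move=> n sigma ell mu A i L; rewrite !geq_max => /and3P[nn nn1 nn2] adm pc i1 As op deg typ u uV.
have L0 : 0 < L by rewrite ln_gt0 // ltr1n.
have Lbig : 1 <= cmin / 2 * L.
  have := n1P n nn1; rewrite ler_pdivrMr // -/L; lin.
have Lbig2 : cmax <= eps ^+ 2 * L.
  have := n2P n nn2; rewrite ler_pdivrMr ?exprn_gt0 // -/L; lin.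
pose U := own_block sigma ell i; pose C := other_block sigma i.
pose k := killed_kernel ell i A L; pose w v := degree R A v / L.
have w0 v : 0 < w v.
  have /andP[h _] := deg v; rewrite divr_gt0 //; apply: lt_le_trans h.
  by rewrite mulr_gt0.
have wE v z : A v z -> w v = degree R A v / L by [].
pose h v := entry_at (mu i A) v / w v.
have [lam PP sum1] := principal_killed As L0 w0 wE (pc i A i1 As).
have BS : block_sizes (1 - delta) U C by exact: model_block_sizes.
have e3 : eps <= eps0 by rewrite /eps; move: eps00; lin.
have CO : concentrated a b (cmin / 2) cmax eps0 U C k w.
  exact: (concentrated_killed nn adm i1 As epsp op deg).
(* A vertex that is not kept already has a zero row: there nothing is isolated. *)
pose B v : 'M[bool]_n := if v \in kept ell i then isolate v A else A.
pose k' v := if v \in kept ell i then killed_kernel ell i (isolate v A) L else k.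
pose w' v := if v \in kept ell i then isolated_weight a b v (isolate v A) else w.
have ex v : exists lam', principal (k' v) (w' v) lam'
    (fun z => entry_at (mu i (B v)) z / w' v z).
  rewrite /k' /w' /B; case: ifPn => vV; last by exists lam.
  have As' := isolate_sym As v.
  have w'0 := isolated_weight_gt0 nn cmin0 cmin_mean cmax_mean deg Lbig v.
  have [lam' PP' _] := principal_killed As' L0 w'0
     (isolated_weight_degree a b (u := v) (A := A)) (pc i _ i1 As').
  by exists lam'.
pose lam' v := projT1 (cid (ex v)).
have PP' v : principal (k' v) (w' v) (lam' v) (fun z => entry_at (mu i (B v)) z / w' v z).
  by rewrite /lam'; case: cid.
have := LE 'I_n U C k w eps0 lam h k' w' lam' (fun v z => entry_at (mu i (B v)) z / w' v z)
  BS CO (ltW eps00) (lexx _) _ PP _ PP' _ _ _ _ sum1 u.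
have k0 v z : 0 <= k v z by exact: killed_kernel_ge0.
have CO' v : concentrated a b (cmin / 2) cmax eps0 U C (k' v) (w' v).
  rewrite /k' /w'; case: ifPn => vV //.
  have -> : eps0 = 3 * eps by rewrite /eps; field.
  exact: (concentrated_isolated nn adm i1 As epsp cmin0 cmin_mean cmax_mean op deg Lbig Lbig2 v).
have kout v z : v \notin kept ell i -> k v z = 0.
  by move=> vV; rewrite /k killed_kernel_sym // killed_kernel_sym // killed_kernel_sym // killed_kernel_out.
have ISO v : isolates k w v (k' v) (w' v) (fun z => entry_at (mu i (B v)) z / w' v z).
  rewrite /k' /w' /B; case: ifPn => vV; first exact: isolates_killed.
  split => //; first by move=> z; exact: kout.
  by move=> z zv; rewrite subrr normr0 mul0r kout ?mul0r.
have kn v : nrm (k v) <= eps0.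
  by apply: le_trans e3; exact: (nrm_killed_row ell i nn epsp deg Lbig2).
have kr v : \sum_z k v z <= cmax by exact: (sum_killed_row ell i nn deg).
have RD v : row_deviation_small (1 - delta) (rho a b delta) eta0 kap U C k v
    (fun z => entry_at (mu i (B v)) z / w' v z).
  rewrite /w' /B; case: ifPn => vV; first exact: row_typical.
  move=> _; rewrite [app _ _ _]big1 => [|z _]; last by rewrite kout ?mul0r.
  by rewrite mulr_ge0 ?(ltW eta00) // (le_trans ler01) // bigmax_ge_id.
move=> /(_ k0 CO' ISO kn kr RD).
rewrite -cbar_gamma // card_ord.
have -> : w u * h u = entry_at (mu i A) u by rewrite /h mulrCA divff ?mulr1 // lt0r_neq0.
have -> // : app k (profile (rho a b delta) U C) u
  = (\sum_v (A u v)%:R * profile (rho a b delta) U C v) / L.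
rewrite /app mulr_suml; apply: eq_bigr => v _.
rewrite /k /killed_kernel /ind uV /profile /ind (kept_blocks adm i1 v) -/U -/C.
case: (v \in U); case: (v \in C) => /=; ring.
Qed.

(** * The mixed estimator *)

Definition majority (R : realType) n (sigma : 'I_n -> int) (A : 'M[bool]_n) (u : 'I_n) : R :=
  \sum_v (if sigma u == sigma v then 1 else -1) * (A u v)%:R.

(** The two expansions and the revealed score combine into [rho - 1] times the
    signed number of neighbours of [u]: revealed neighbours count with weight
    [rho] in one eigenvector only, and subtracting their number leaves the same
    weight as for the others. *)
Lemma mixed_estimator_correct (R : realType) (a b delta eta : R) n
    (sigma ell : 'I_n -> int) (mu : forall i : int, 'M[bool]_n -> 'rV[R]_#|kept ell i|)
    (A : 'M[bool]_n) (u : 'I_n) :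
  let L := ln (n%:R : R) in
  0 < L -> 1 < rho a b delta -> admissible sigma ell delta -> ell u = 0 ->
  (forall i, i = 1 \/ i = -1 ->
    `|cbar a b delta * gamma a b delta * n%:R * entry_at (mu i A) u
        - (\sum_v (A u v)%:R * profile (rho a b delta) (own_block sigma ell i) (other_block sigma i) v) / L|
      <= (rho a b delta - 1) * eta / 2) ->
  eta * L < majority R sigma A u ->
  mixed_estimator a b delta mu A u = sigma u.
Proof.
move=> L L0 rho1 adm ellu ex maj.
have [s1 s2 s3 _ _] := adm.
set r := rho a b delta in rho1 ex *.
pose Ip i := \sum_v (A u v)%:R * profile r (own_block sigma ell i) (other_block sigma i) v.
pose c := cbar a b delta * gamma a b delta * n%:R.
have ex' i : i = 1 \/ i = -1 -> `|c * L * entry_at (mu i A) u - Ip i| <= (r - 1) * eta / 2 * L.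
  move=> /ex h; have -> : c * L * entry_at (mu i A) u - Ip i
     = (c * entry_at (mu i A) u - Ip i / L) * L by field; exact: lt0r_neq0.
  by rewrite normrM (gtr0_norm L0) ler_wpM2r // ltW.
have split : Ip (-1) - Ip 1 - revealed_score R ell A u
   = (r - 1) * \sum_v (sigma v)%:~R * (A u v)%:R.
  rewrite /revealed_score -!dot_indE /dot /Ip -!sumrB mulr_sumr.
  apply: eq_bigr => v _; rewrite /profile /ind !inE opprK.
  have [ev|ev] := eqVneq (ell v) 0.
    by rewrite ev; case: (s1 v) => -> /=; ring.
  by rewrite -(s3 v ev); case: (s2 v) ev => -> //= _; case: (A u v) => /=; ring.
have majE : \sum_v (sigma v)%:~R * (A u v)%:R = (sigma u)%:~R * majority R sigma A u.
  rewrite /majority mulr_sumr; apply: eq_bigr => v _.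
  by case: (s1 u) => ->; case: (s1 v) => -> /=; ring.
have score : mixed_score a b delta mu A u - (r - 1) * ((sigma u)%:~R * majority R sigma A u)
   = (c * L * entry_at (mu (-1) A) u - Ip (-1)) - (c * L * entry_at (mu 1 A) u - Ip 1).
  rewrite -majE -split /mixed_score /qsd_score /c -/L; ring.
have bd : `|mixed_score a b delta mu A u - (r - 1) * ((sigma u)%:~R * majority R sigma A u)| <= (r - 1) * eta * L.
  rewrite score; apply: le_trans (ler_normB _ _) _.
  have := ex' 1 (or_introl erefl); have := ex' (-1) (or_intror erefl); lin.
have pos : (r - 1) * (eta * L) < (r - 1) * majority R sigma A u.
  by rewrite ltr_pM2l // subr_gt0.
rewrite /mixed_estimator; move: bd; rewrite ler_norml => /andP[h1 h2].
case: (s1 u) => su; rewrite su in h1 h2 *.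
  by rewrite gtr0_sgz //; move: h1 pos; rewrite mul1r; lin.
rewrite ltr0_sgz //; move: h2 pos; rewrite mulN1r; lin.
Qed.

Lemma error_rate_le1 (R : realType) n (sigma ell est : 'I_n -> int) :
  error_rate R sigma ell est <= 1.
Proof.
rewrite /error_rate; apply: (@le_trans _ _ (#|unrevealed ell|%:R^-1 * #|unrevealed ell|%:R)).
  rewrite ler_wpM2l ?invr_ge0 // -sum1_card natr_sum; apply: ler_sum => v _.
  by rewrite ler_nat leq_b1.
have [->|h] := eqVneq (#|unrevealed ell|%:R : R) 0; first by rewrite mulr0.
by rewrite mulVf.
Qed.

(** Outside the exceptional event the misclassified vertices are those where the
    majority of the neighbours is wrong; the average over vertices of these
    probabilities needs no union bound. *)
Lemma expected_error_le (R : realType) (a b delta : R) n (sigma ell : 'I_n -> int)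
    (est : 'M[bool]_n -> 'I_n -> int) (bad : pred 'M[bool]_n)
    (wrong : 'I_n -> pred 'M[bool]_n) (x y : R) :
  (1 < n)%N -> 0 < b -> b <= a -> a * ln (n%:R : R) / n%:R <= 1 ->
  (forall A u, A = A^T -> ~~ bad A -> ell u = 0 -> est A u != sigma u -> wrong u A) ->
  prob a b sigma bad <= x -> (forall u, prob a b sigma (wrong u) <= y) -> 0 <= y ->
  plsbm_expectation (a * ln n%:R / n%:R) (b * ln n%:R / n%:R) sigma
    (fun A => error_rate R sigma ell (est A)) <= y + x.
Proof.
move=> n1 b0 ab aLN hw bx wy y0.
have P01 := p01 n1 b0 ab aLN; have Q01 := q01 n1 b0 ab aLN.
apply: (@le_trans _ _ (#|unrevealed ell|%:R^-1 * \sum_(u in unrevealed ell) prob a b sigma (wrong u)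
   + prob a b sigma bad)).
  rewrite -mean_sum -meanZ -meanD; apply: ler_mean => // A As.
  case: (boolP (bad A)) => [bA|nb].
    apply: le_trans (error_rate_le1 _ _ _ _) _; rewrite lerDr.
    by rewrite mulr_ge0 ?invr_ge0 // sumr_ge0.
  rewrite addr0 ler_wpM2l ?invr_ge0 //; apply: ler_sum => u.
  rewrite inE => /eqP eu; case: (boolP (est A u != sigma u)) => // e.
  by rewrite (hw A u As nb eu e).
apply: lerD => //.
apply: (@le_trans _ _ (#|unrevealed ell|%:R^-1 * (#|unrevealed ell|%:R * y))).
  rewrite ler_wpM2l ?invr_ge0 // mulrC mulr_natr -sumr_const.
  by apply: ler_sum => u _; exact: wy.
have [->|h] := eqVneq (#|unrevealed ell|%:R : R) 0; first by rewrite mul0r mulr0.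
by rewrite mulKf.
Qed.

Lemma exists_union_le (R : realType) (a b c : R) n (sigma : 'I_n -> int)
    (P : 'I_n -> pred 'M[bool]_n) :
  (1 < n)%N -> 0 < b -> b <= a -> a * ln (n%:R : R) / n%:R <= 1 ->
  (forall u, prob a b sigma (P u) <= expR (- ((c + 1) * ln (n%:R : R)))) ->
  prob a b sigma (fun A => [exists u, P u A]) <= expR (- (c * ln (n%:R : R))).
Proof.
move=> n1 b0 ab aLN hP; apply: (le_trans (prob_union sigma n1 b0 ab aLN P)).
apply: le_trans (ler_sum _ (fun u _ => hP u)) _.
rewrite sumr_const card_ord -[leLHS]mulr_natl.
have n0 : 0 < n%:R :> R by rewrite ltr0n ltnW.
rewrite -[X in X * _](lnK n0) -expRD ler_expR; lra.
Qed.

(** The tail exponents: a low degree has probability [n ^- (2 + g / 2)] with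
    [g := (a + b) / 2 - 2], which beats [n ^- 1] after the union bound because
    [a + b > 4]; the other exceptional events have arbitrarily high polynomial
    rate, and only the majority tail depends on [eta]. *)
Lemma expected_error_bound (R : realType) (a b delta : R) :
  0 < b -> b < a -> 0 < delta -> delta < 1 -> 4 < a + b ->
  exists2 kappa : R, 0 < kappa & exists2 C0 : R, 0 < C0 &
  forall eta : R, 0 < eta -> exists n0 : nat, forall n
      (sigma ell : 'I_n -> int) (mu : forall i : int, 'M[bool]_n -> 'rV[R]_#|kept ell i|),
    (n0 <= n)%N -> admissible sigma ell delta -> principal_choice mu ->
    plsbm_expectation (a * ln n%:R / n%:R) (b * ln n%:R / n%:R) sigma
      (fun A => error_rate R sigma ell (mixed_estimator a b delta mu A))
    <= expR (ln (n%:R : R) * (eta - (Num.sqrt a - Num.sqrt b) ^+ 2 / 2))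
       + C0 * expR (- ((1 + kappa) * ln (n%:R : R))).
Proof.
move=> b0 ab d0 d1 ab4.
have a0 : 0 < a by exact: lt_trans ab.
have [m mE] : exists x : R, x = (a + b) / 2 by eexists.
have m2 : 2 < m by rewrite mE; move: ab4; lin.
have m0 : 0 < m by move: m2; lin.
have [g gE] : exists x : R, x = m - 2 by eexists.
have g0 : 0 < g by rewrite gE subr_gt0.
(* With this t0 the term m * expR (- t0) and then, by the choice of cmin, the term
   t0 * cmin cost g / 4 each. *)
have [t0 t0E] : exists x : R, x = ln (4 * m / g) by eexists.
have mg : 1 < 4 * m / g by rewrite ltr_pdivlMr // mul1r gE; move: m0; lin.
have t00 : 0 < t0 by rewrite t0E ln_gt0.
have et0 : expR (- t0) = g / (4 * m).
  by rewrite expRN t0E lnK ?posrE ?(lt_trans ltr01) // invf_div.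
have [cmin cminE] : exists x : R, x = Num.min (g / (4 * t0)) m by eexists.
have cmin0 : 0 < cmin by rewrite cminE lt_min m0 divr_gt0 ?mulr_gt0 ?ltr0n.
have cm : cmin <= (a + b) / 2 by rewrite -mE cminE ge_min lexx orbT.
have ct : t0 * cmin <= g / 4.
  apply: (@le_trans _ _ (t0 * (g / (4 * t0)))).
    by rewrite ler_wpM2l ?(ltW t00) // cminE ge_min lexx.
  by rewrite le_eqVlt; apply/orP; left; apply/eqP; field; exact: lt0r_neq0.
have [cmax cmaxE] : exists x : R, x = m * expR 1 + 3 by eexists.
have e1 : 1 <= expR 1 :> R by have := expR_ge1Dx (1 : R); lra.
have mc : (a + b) / 2 <= cmax.
  by rewrite -mE cmaxE; have := ler_wpM2l (ltW m0) e1; lin.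
have [kappa kappaE] : exists x : R, x = Num.min (g / 2) 1 by eexists.
have kappa0 : 0 < kappa by rewrite kappaE lt_min ltr01 divr_gt0.
have kg : kappa <= g / 2 by rewrite kappaE ge_min lexx.
have k1 : kappa <= 1 by rewrite kappaE ge_min lexx orbT.
exists kappa => //; exists (2 * (expR 2 + 1) + 4).
  by rewrite addr_gt0 ?mulr_gt0 // addr_gt0 // expR_gt0.
move=> eta eta_gt0.
have [T TE] : exists x : R, x = ln (Num.sqrt a / Num.sqrt b) by eexists.
have T0 : 0 <= T.
  by rewrite TE ln_ge0 // ler_pdivlMr ?sqrtr_gt0 // mul1r ler_wsqrtr // ltW.
have T1 : 0 < T + 1 by rewrite ltr_wpDl.
have [eta1 eta1E] : exists x : R, x = eta / (T + 1) by eexists.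
have eta10 : 0 < eta1 by rewrite eta1E divr_gt0.
have Teta : T * eta1 <= eta.
  rewrite eta1E mulrA ler_pdivrMr // mulrC ler_wpM2l ?(ltW eta_gt0) //; lra.
have rho1 := rho_gt1 b0 ab d0 d1.
have etar : 0 < (rho a b delta - 1) * eta1 / 2.
  by rewrite divr_gt0 // mulr_gt0 // subr_gt0.
have [eta0 eta00 KE] := killed_expansion b0 ab d0 d1 cmin0 cm mc etar.
have [th thE] : exists x : R, x = 4 / eta0 by eexists.
have th0 : 0 < th by rewrite thE divr_gt0.
have [kap kapE] : exists x : R, x = (a * th * expR th)^-1 by eexists.
have kap0 : 0 < kap by rewrite kapE invr_gt0 !mulr_gt0 ?expR_gt0.
have [eps [n1 [eps0 n1g {}KE]]] := KE kap kap0.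
have D0 : 0 < cmax + m by rewrite addr_gt0 // (lt_le_trans m0) // mE.
have [K [eps1 [K1 eps10 OP]]] := op_norm_centered a b D0 eps0.
have [n2 n2g PD] := prob_discrepant b0 (ltW ab) K1 eps10.
have [n3 n3P] := ln_large (2 * a).
exists (maxn n1 (maxn n2 n3)) => n sigma ell mu.
rewrite !geq_max => /and3P[nn1 nn2 nn3] adm pc.
have n2' : (1 < n)%N by exact: leq_trans n1g nn1.
have N0 : 0 < n%:R :> R by rewrite ltr0n ltnW.
set L := ln (n%:R : R).
have L0 : 0 < L by rewrite ln_gt0 // ltr1n.
have aLN : a * L / n%:R <= 1.
  rewrite ler_pdivrMr // mul1r -[leRHS](lnK N0) -/L.
  have := @expR_ge1Dxn R L 1 (ltW L0); have := n3P n nn3; rewrite -/L => h1 h2.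
  have h3 : a * L <= L ^+ 2 / 2 by have := ler_wpM2l (ltW L0) h1; rewrite expr2; lin.
  by apply: le_trans h3 _; apply: le_trans h2; rewrite lerDr.
have [s1 _ _ s4 _] := adm.
pose low (u : 'I_n) (A : 'M[bool]_n) : bool := - t0 * (cmin * L) <= - t0 * degree R A u.
pose high (u : 'I_n) (A : 'M[bool]_n) : bool := 1 * (cmax * L) <= 1 * degree R A u.
pose ra (i : int) (u : 'I_n) (A : 'M[bool]_n) : bool := row_atypical a b delta sigma mu eta0 kap i u A.
pose bad (A : 'M[bool]_n) := [|| [exists u, low u A], [exists u, high u A], discrepant a b sigma K eps1 A,
   [exists u, ra 1 u A] | [exists u, ra (-1) u A]].
have lowP : prob a b sigma (fun A => [exists u, low u A]) <= expR (- ((1 + kappa) * L)).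
  apply: exists_union_le => // [|u]; first exact: ltW.
  apply: le_trans (degree_tail n2' b0 (ltW ab) aLN s1 s4 u (- t0) cmin) _.
  rewrite ler_expR -/L -mE et0.
  have -> : m * (g / (4 * m) - 1) - - t0 * cmin = g / 4 - m + t0 * cmin.
    by field; exact: lt0r_neq0.
  have h : g / 4 - m + t0 * cmin <= - (1 + kappa + 1) by move: ct kg gE; lin.
  by apply: le_trans (ler_wpM2l (ltW L0) h) _; rewrite mulrN mulrC.
have highP : prob a b sigma (fun A => [exists u, high u A]) <= expR (- (2 * L)).
  apply: exists_union_le => // [|u]; first exact: ltW.
  apply: le_trans (degree_tail n2' b0 (ltW ab) aLN s1 s4 u 1 cmax) _.
  rewrite ler_expR -/L -mE cmaxE.
  have h : m * (expR 1 - 1) - 1 * (m * expR 1 + 3) <= - (2 + 1) by move: m0; lin.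
  by apply: le_trans (ler_wpM2l (ltW L0) h) _; rewrite mulrN mulrC.
have raP i : prob a b sigma (fun A => [exists u, ra i u A]) <= expR (- (2 * L)).
  apply: exists_union_le => // [|u]; first exact: ltW.
  apply: le_trans (row_tail sigma n2' b0 (ltW ab) aLN u eta0 (ltW th0)
    (row_coefficient01 a b delta sigma mu kap i u)
    (fun A' => sum_row_coefficient a b delta sigma mu i u A' (ltW kap0))) _.
  rewrite ler_expR -/L.
  have -> : a * kap * th * expR th = 1.
    by rewrite kapE; field; rewrite !lt0r_neq0 ?expR_gt0.
  have -> : th * eta0 = 4 by rewrite thE divfK // lt0r_neq0.
  lra.
have discP := PD n sigma nn2 aLN.
have eK : expR (- (2 * L)) <= expR (- ((1 + kappa) * L)).
  by rewrite ler_expR lerN2 ler_wpM2r ?(ltW L0) //; move: k1; lin.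
have e3 : expR (- (3 * L)) <= expR (- ((1 + kappa) * L)).
  by rewrite ler_expR lerN2 ler_wpM2r ?(ltW L0) //; move: k1; lin.
apply: (@expected_error_le R a b delta n sigma ell (mixed_estimator a b delta mu) bad
   (fun u A => majority R sigma A u <= eta1 * L)) => //.
- exact: ltW.
- move=> A u As nb eu est; rewrite leNgt; apply/negP => maj; move/negP: est; apply.
  apply/eqP; apply: (mixed_estimator_correct L0 rho1 adm eu _ maj) => i i1.
  move: nb; rewrite !negb_or => /and5P[/existsPn nl /existsPn nh nd /existsPn np /existsPn nm].
  have deg v : cmin * L <= degree R A v <= cmax * L.
    have := nl v; have := nh v; rewrite /low /high !mul1r -!ltNge.
    by rewrite ltr_nM2l ?oppr_lt0 // => /ltW -> /ltW ->.
  apply: (KE n sigma ell mu A i nn1 adm pc i1 As _ deg) => [|v|].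
  + apply: OP; [exact: ltW|exact: As| |exact: nd].
    move=> v; apply: (@le_trans _ _ (\sum_z ((A v z)%:R + edge_prob (a * L / n%:R) (b * L / n%:R) sigma v z))).
      apply: ler_sum => z _; apply: le_trans (ler_normB _ _) _.
      have /andP[e0 _] := edge_prob01 sigma (p01 n2' b0 (ltW ab) aLN) (q01 n2' b0 (ltW ab) aLN) v z.
      by rewrite !ger0_norm.
    rewrite big_split /= (sum_edge_prob_row a b n2' adm).
    have /andP[_ h] := deg v; rewrite -/(degree R A v) -/L mE; move: h; lin.
  + by case: i1 => ->; [exact: np|exact: nm].
  + by rewrite !inE eu; case: i1 => ->.
- apply: (@le_trans _ _ (expR (- ((1 + kappa) * L)) + (expR (- (2 * L)) + (2 * (expR 2 + 1) * expR (- (3 * L))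
      + (expR (- (2 * L)) + expR (- (2 * L))))))).
    have orP := prob_or sigma n2' b0 (ltW ab) aLN.
    apply: le_trans (orP _ _) _; apply: lerD => //.
    apply: le_trans (orP _ _) _; apply: lerD => //.
    apply: le_trans (orP _ _) _; apply: lerD => //.
    by apply: le_trans (orP _ _) _; apply: lerD.
  have e20 : 0 <= 2 * (expR 2 + 1) :> R by rewrite mulr_ge0 // addr_ge0 ?expR_ge0.
  have := ler_wpM2l e20 e3; move: eK; lin.
- move=> u; apply: le_trans (majority_tail n2' b0 (ltW ab) aLN s1 s4 u eta1) _.
  by rewrite ler_expR -/L -TE ler_wpM2l ?(ltW L0) // lerD2r.
Qed.

(** * From a fixed to a vanishing slack *)

Local Open Scope classical_set_scope.

(** A bound that holds eventually with every fixed slack holds eventually with a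
    slack that tends to zero. *)
Lemma vanishing_slack (R : realType) (P : nat -> R -> Prop) :
  (forall n x y, (0 < n)%N -> x <= y -> P n x -> P n y) ->
  (forall eta, 0 < eta -> exists n0, forall n, (n0 <= n)%N -> P n eta) ->
  exists2 f : nat -> R, f n @[n --> \oo] --> (0 : R) & \forall n \near \oo, P n (f n).
Proof.
move=> Pmono Pev; pose S n := [set x : R | 0 <= x /\ P n x].
have lbS n : lbound (S n) 0 by move=> x [].
exists (fun n => inf (S n) + n.+1%:R^-1).
  apply/cvgrPdist_le => e e0; have e20 : 0 < e / 2 by rewrite divr_gt0.
  have [n0 n0P] := Pev _ e20.
  exists (maxn n0 (Num.truncn (e / 2)^-1)) => // n /=; rewrite geq_max => /andP[h1 h2].
  have Se : S n (e / 2) by split; [exact: ltW|exact: n0P].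
  have i0 : 0 <= inf (S n) by apply: lb_le_inf => //; exists (e / 2).
  have ie : inf (S n) <= e / 2 by apply: ge_inf => //; exists 0.
  have ne : n.+1%:R^-1 <= e / 2.
    rewrite -[leRHS]invrK lef_pV2 ?posrE ?invr_gt0 ?ltr0n //.
    by apply: ltW; apply: lt_le_trans (truncnS_gt _) _; rewrite ler_nat.
  by rewrite sub0r normrN ger0_norm ?addr_ge0 ?invr_ge0 // [leRHS]splitr lerD.
have [n0 n0P] := Pev 1 ltr01.
exists (maxn 1 n0) => // n /=; rewrite geq_max => /andP[h1 h2].
have hi : has_inf (S n) by split; [exists 1; split; [exact: ler01|exact: n0P]|exists 0].
have v0 : 0 < n.+1%:R^-1 :> R by rewrite invr_gt0 ltr0n.
have [x [x0 Px] xlt] := inf_adherent v0 hi.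
exact: Pmono h1 (ltW xlt) Px.
Qed.

Theorem theorem4 (R : realType) (a b delta : R)
    (hb : 0 < b) (hab : b < a) (hdelta0 : 0 < delta) (hdelta1 : delta < 1)
    (hab4 : 4 < a + b) :
  exists e1 e2 : nat -> R,
    [/\ e1 n @[n --> \oo] --> (0 : R),
        e2 =o_\oo (fun n : nat => n%:R^-1 : R) &
        \forall n \near \oo,
          forall (sigma ell : 'I_n -> int)
                 (mu : forall i : int, 'M[bool]_n -> 'rV[R]_#|kept ell i|),
            admissible sigma ell delta ->
            principal_choice mu ->
            plsbm_expectation (a * ln n%:R / n%:R) (b * ln n%:R / n%:R) sigma
              (fun A => error_rate R sigma ell (mixed_estimator a b delta mu A))
            <= n%:R `^ (- ((1 + e1 n) * (Num.sqrt a - Num.sqrt b) ^+ 2 / 2))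
               + e2 n].
Proof.
have [kappa kappa0 [C0 C00 EB]] := expected_error_bound hb hab hdelta0 hdelta1 hab4.
pose rate := (Num.sqrt a - Num.sqrt b) ^+ 2 / 2.
have rate0 : 0 < rate.
  rewrite divr_gt0 ?ltr0n // exprn_gt0 // subr_gt0 ltr_sqrt //.
  exact: lt_trans hab.
pose e2 (n : nat) : R := C0 * expR (- ((1 + kappa) * ln n%:R)).
pose P (n : nat) (eta : R) : Prop := forall (sigma ell : 'I_n -> int)
  (mu : forall i : int, 'M[bool]_n -> 'rV[R]_#|kept ell i|),
  admissible sigma ell delta -> principal_choice mu ->
  plsbm_expectation (a * ln n%:R / n%:R) (b * ln n%:R / n%:R) sigma
    (fun A => error_rate R sigma ell (mixed_estimator a b delta mu A))
  <= expR (ln n%:R * (eta - rate)) + e2 n.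
have Pmono n x y : (0 < n)%N -> x <= y -> P n x -> P n y.
  move=> n0 xy Px sigma ell mu adm pc; apply: le_trans (Px sigma ell mu adm pc) _.
  by rewrite lerD2r ler_expR ler_wpM2l ?ln_ge0 ?ler1n // lerD2r.
have [f f0 fP] := vanishing_slack Pmono (fun eta eta0 =>
   let: ex_intro n0 h := EB eta eta0 in
   ex_intro _ n0 (fun n nn0 sigma ell mu adm pc => h n sigma ell mu nn0 adm pc)).
exists (fun n => - f n / rate), e2; split.
- have -> : 0 = - 0 / rate by rewrite oppr0 mul0r.
  by apply: cvgMl; exact: cvgN.
- apply/eqoP => e e0.
  have [n0 n0P] := ln_large (ln (C0 / e) / kappa).
  exists (maxn 1 n0) => // n /=; rewrite geq_max => /andP[h1 h2].
  have np : 0 < n%:R :> R by rewrite ltr0n.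
  rewrite /e2 !ger0_norm ?invr_ge0 ?mulr_ge0 ?expR_ge0 ?(ltW C00) //.
  have -> : (n%:R : R)^-1 = expR (- ln n%:R) by rewrite expRN lnK.
  have -> : - ((1 + kappa) * ln (n%:R : R)) = - (kappa * ln n%:R) + - ln n%:R by ring.
  rewrite expRD mulrA ler_wpM2r ?expR_ge0 // expRN ler_pdivrMr ?expR_gt0 //.
  rewrite mulrC -ler_pdivrMr // -[leLHS]lnK ?posrE ?divr_gt0 // ler_expR.
  by rewrite [leRHS]mulrC -ler_pdivrMr //; exact: n0P.
have [n0 _ n0P] := fP.
exists (maxn 1 n0) => // n /=; rewrite geq_max => /andP[h1 h2] sigma ell mu adm pc.
apply: le_trans (n0P n h2 sigma ell mu adm pc) _.
have np : 0 < n%:R :> R by rewrite ltr0n.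
have -> : - ((1 + - f n / rate) * (Num.sqrt a - Num.sqrt b) ^+ 2 / 2) = f n - rate.
  by rewrite -mulrA -/rate; field; exact: lt0r_neq0.
by rewrite lerD2r /powR gt_eqF // (mulrC (ln _)).
Qed.
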